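(* For any finite or infinite segment $I\subset\mathbb{Z}$ (of the form $[\alpha,\beta]$, $[\alpha,\infty)$, $(-\infty,\beta]$ or $(-\infty,\infty)$) there is a unique $\mathbf{GL}^0(\ell\oplus\ell^\diamond)$-invariant probability measure on the flag space $\mathbf{Fl}[I]$.
   Context: Spaces and group. $\mathbb{F}_q$ is a finite field. $\ell$ is the direct sum of countably many copies of $\mathbb{F}_q$ (basis $e_1,e_2,\dots$), with the discrete topology; $\ell^\diamond$ is the direct product of countably many copies of $\mathbb{F}_q$ (coordinate vectors $f_1,f_2,\dots$; elements are formal infinite combinations $\sum w_j f_j$), with the product topology (compact). $\ell\oplus\ell^\diamond$ has the product topology. Elements are written as row vectors and operators act on the right: $v\mapsto vg$. $\mathbf{GL}(\ell\oplus\ell^\diamond)$ is the group of all continuous linear operators $g=\begin{pmatrix}a&b\\c&d\end{pmatrix}$ in $\ell\oplus\ell^\diamond$ having a continuous inverse. For such $g$, the block $a:\ell\to\ell$ has finite-dimensional kernel and an image of finite codimension, and $\theta(g):=\dim(\ell/\ell a)-\dim\ker a$ is a homomorphism $\mathbf{GL}(\ell\oplus\ell^\diamond)\to\mathbb{Z}$; $\mathbf{GL}^0(\ell\oplus\ell^\diamond)$ is its kernel. Grassmannian. For any infinite matrix $T$ over $\mathbb{F}_q$ let $\mathrm{graph}(T)=\{v\oplus vT: v\in\ell\}$; $\mathcal{M}$ is the set of all such subspaces of $\ell\oplus\ell^\diamond$. A subspace $M\subset\ell\oplus\ell^\diamond$ is semi-infinite if there is $L\in\mathcal{M}$ with $\dim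 L/(L\cap M)<\infty$ and $\dim M/(L\cap M)<\infty$; its relative dimension is $\mathrm{Dim}(M):=\dim M/(L\cap M)-\dim L/(L\cap M)$ (independent of $L$). $\mathbf{Gr}^j$ is the set of semi-infinite subspaces of relative dimension $j\in\mathbb{Z}$. $\mathbf{GL}^0(\ell\oplus\ell^\diamond)$ acts on each $\mathbf{Gr}^j$ by $L\mapsto Lg$. Borel structure. For finite subsets $\Omega,\Xi\subset\mathbb{N}$ let $V[\Omega,\Xi]$ be spanned by the $e_i$, $i\notin\Omega$, and the $f_j$, $j\in\Xi$, and let $W[\Omega,\Xi]$ be the topological direct sum of the lines $\mathbb{F}_q e_i$, $i\in\Omega$, and $\mathbb{F}_q f_j$, $j\notin\Xi$ (infinite combinations of the $f_j$ allowed). The chart $\mathcal{M}[\Omega,\Xi]$ is the set of graphs of linear operators $V[\Omega,\Xi]\to W[\Omega,\Xi]$; it is identified via matrix entries with a countable product of copies of $\mathbb{F}_q$. The charts cover the set of all semi-infinite subspaces; a set of semi-infinite subspaces is Borel if its intersection with each chart is Borel for the product topology of that chart. Flags. For a segment $I\subset\mathbb{Z}$, $\mathbf{Fl}[I]$ is the space of all flags $(L_j)_{j\in I}$ with $L_j\in\mathbf{Gr}^j$ and $L_j\subset L_{j+1}$ whenever $j,j+1\in I$ (e.g. for $I=[\alpha,\beta]$: $L_\alpha\subset L_{\alpha+1}\subset\dots\subset L_\beta$). It carries the Borel structure induced from $\prod_{j\in I}\mathbf{Gr}^j$, and $\mathbf{GL}^0(\ell\oplus\ell^\diamond)$ acts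 by $(L_j)\mapsto(L_jg)$. *)

(* Defs.v *)
From HB Require Import structures.
From mathcomp Require Import all_boot all_order all_algebra finmap.
From mathcomp Require Import zify.
From mathcomp Require Import all_classical all_reals all_analysis.

Set Implicit Arguments.
Unset Strict Implicit.
Unset Printing Implicit Defensive.

Import Order.TTheory GRing.Theory Num.Theory.

Local Open Scope classical_set_scope.
Local Open Scope ring_scope.

Definition is_subspace (K : fieldType) (V : lmodType K) (M : set V) : Prop :=
  M 0 /\ forall (a : K) (x y : V), M x -> M y -> M (a *: x + y).

(* For subspaces A `<=` B of V, [quot_dim A B n] means dim (B / A) = n: some
   b_0, ..., b_(n-1) in B have classes forming a basis of B / A. *)
Definition quot_dim (K : fieldType) (V : lmodType K) (A B : set V) (n : nat) :
    Prop :=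
  exists b : 'I_n -> V, (forall i, B (b i)) /\
    forall x, B x ->
      exists! c : 'rV[K]_n, A (x - \sum_(i < n) c ord0 i *: b i).

Section Spaces.
Variable F : finFieldType.

Definition finsupp_pred : {pred (nat -> F^o)} :=
  fun v => `[< finite_set [set i | v i != 0] >].

Lemma finsupp_submod_closed : submod_closed finsupp_pred.
Proof.
split.
  apply/asboolP; rewrite (_ : [set i | _] = set0)//.
  by apply/seteqP; split => i //=; rewrite eqxx.
move=> a u v /asboolP fu /asboolP fv; apply/asboolP.
have fuv : finite_set ([set i | u i != 0] `|` [set i | v i != 0]).
  by rewrite finite_setU.
apply: sub_finite_set fuv => i /= nz.
have [ui0|] := eqVneq (u i) 0; last by left.
right; apply: contraNneq nz => vi0.
by rewrite [X in X == _](_ : _ = a *: u i + v i)// ui0 vi0 scaler0 addr0.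
Qed.

HB.instance Definition _ :=
  GRing.isSubmodClosed.Build F (nat -> F^o) finsupp_pred finsupp_submod_closed.

Definition ell : Type := {v : nat -> F^o | v \in finsupp_pred}.
HB.instance Definition _ := SubChoice.on ell.
HB.instance Definition _ := [SubChoice_isSubLmodule of ell by <:].
HB.instance Definition _ := Topological.copy ell (discrete_topology ell).

Definition elld : Type := nat -> F^o.
HB.instance Definition _ := GRing.Lmodule.on elld.
HB.instance Definition _ :=
  Topological.copy elld {ptws nat -> discrete_topology F}.

Definition E : Type := (ell * elld)%type.
HB.instance Definition _ := GRing.Lmodule.on E.
HB.instance Definition _ := Topological.on E.

(* Coordinates of a vector: [inl i] is the one along e_i, [inr j] the one along
   f_j. *)
Definition ecoord (x : E) (k : nat + nat) : F :=
  match k with inl i => val x.1 i | inr j => x.2 j end.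

Definition GL (g : {linear E -> E}) : Prop :=
  continuous g /\ exists h : E -> E, [/\ continuous h, cancel g h & cancel h g].

(* Operators act on row vectors from the right, so the block a of
   g = (a b; c d) is read off the image of v (+) 0. *)
Definition block_a (g : {linear E -> E}) (v : ell) : ell :=
  (g ((v, 0) : E)).1.

Definition theta (g : {linear E -> E}) (k : int) : Prop :=
  exists m n : nat,
    [/\ quot_dim (range (block_a g)) [set: ell] m,
        quot_dim [set 0 : ell] [set v | block_a g v = 0] n &
        k = m%:Z - n%:Z].

Definition GL0 (g : {linear E -> E}) : Prop := GL g /\ theta g 0.

(* v T, the sum being finite because v has finite support. *)
Definition rvmul (v : ell) (T : nat -> nat -> F) : elld :=
  fun j => \sum_(i \in [set: nat]) val v i * T i j.

Definition graph (T : nat -> nat -> F) : set E :=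
  [set ((v, rvmul v T) : E) | v in [set: ell]].

Definition rel_dim (M : set E) (j : int) : Prop :=
  exists (T : nat -> nat -> F) (m n : nat),
    [/\ quot_dim (graph T `&` M) M m, quot_dim (graph T `&` M) (graph T) n &
        j = m%:Z - n%:Z].

Definition Gr (j : int) : set (set E) :=
  [set M | is_subspace M /\ rel_dim M j].

(* Vectors supported on R: the closure of the span of the basis vectors with
   index in R. *)
Definition coord_space (R : pred (nat + nat)) : set E :=
  [set x | forall k, ~~ R k -> ecoord x k = 0].

(* The row indices of the chart: e_i for i \notin Omega, f_j for j \in Xi. The
   column indices are the remaining ones. *)
Definition chart_row (Omega Xi : {fset nat}) : pred (nat + nat) :=
  fun k => match k with inl i => i \notin Omega | inr j => j \in Xi end.

(* No closure occurs here, as only finitely many f_j are allowed. *)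
Definition chartV (Omega Xi : {fset nat}) : set E :=
  coord_space (chart_row Omega Xi).

Definition chartW (Omega Xi : {fset nat}) : set E :=
  coord_space (predC (chart_row Omega Xi)).

Definition chart_matrix (Omega Xi : {fset nat}) : Type :=
  {ptws {k | chart_row Omega Xi k} * {k | ~~ chart_row Omega Xi k} ->
     discrete_topology F}.
HB.instance Definition _ Omega Xi := Topological.on (chart_matrix Omega Xi).

(* The graph of the operator chartV -> chartW with matrix T. *)
Definition chart_graph (Omega Xi : {fset nat}) (T : chart_matrix Omega Xi) :
    set E :=
  [set x | exists v w : E,
    [/\ chartV Omega Xi v, chartW Omega Xi w,
        forall c : {k | ~~ chart_row Omega Xi k},
          ecoord w (val c) =
            \sum_(r \in [set: {k | chart_row Omega Xi k}])
              ecoord v (val r) * T (r, c) &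
        x = v + w]].

(* Every linear operator chartV -> chartW has a matrix, so [chart_graph] is a
   bijection from matrices onto the chart. *)
Definition borel_subspaces (S : set (set E)) : Prop :=
  forall Omega Xi : {fset nat},
    <<s (@open (chart_matrix Omega Xi)) >> (@chart_graph Omega Xi @^-1` S).

Definition Fl (I : set int) : set (I -> set E) :=
  [set L | (forall j : I, Gr (val j) (L j)) /\
    forall j k : I, val k = val j + 1 -> L j `<=` L k].
Arguments Fl : clear implicits.

Definition flag (I : set int) : Type := set_type (Fl I).
HB.instance Definition _ I := Choice.on (flag I).

Let coordP a x y k : ecoord (a *: x + y) k = a * ecoord x k + ecoord y k.
Proof. by case: k. Qed.

Let coord0 k : ecoord 0 k = 0.
Proof. by case: k. Qed.

Let coord_sum n (c : 'I_n -> F) (b : 'I_n -> E) k :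
  ecoord (\sum_(i < n) c i *: b i) k = \sum_(i < n) c i * ecoord (b i) k.
Proof.
elim: n c b => [|n IH] c b; first by rewrite !big_ord0 coord0.
by rewrite !big_ord_recl coordP IH.
Qed.

Let coord_delta (k : nat + nat) :
  exists x : E, forall k', ecoord x k' = (k' == k)%:R.
Proof.
case: k => [i|i].
  have fi : (fun i' : nat => (i' == i)%:R : F^o) \in finsupp_pred.
    apply/asboolP; apply: sub_finite_set (finite_set1 i) => i' /=.
    by apply: contraNeq => /negPf ->.
  by exists ((exist (fun v => v \in finsupp_pred) _ fi : ell), 0) => -[i'|i'].
by exists (0, (fun i' : nat => (i' == i)%:R : F^o)) => -[i'|i'].
Qed.

Let quot_dim_coord n (R R' : pred (nat + nat)) (f : 'I_n -> nat + nat) :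
  injective f -> (forall i, ~~ R' (f i)) ->
  (forall k, R k <-> R' k \/ exists i, k = f i) ->
  quot_dim (coord_space R') (coord_space R) n.
Proof.
move=> finj fR' RR'; have [d dP] := choice coord_delta.
have sumE (c : 'rV[F]_n) k :
    ecoord (\sum_(i < n) c ord0 i *: d (f i)) k =
    \sum_(i < n) c ord0 i * (k == f i)%:R.
  by rewrite coord_sum; apply: eq_bigr => i _; rewrite dP.
have sumf (c : 'rV[F]_n) i : \sum_(i0 < n) c ord0 i0 * (f i == f i0)%:R = c ord0 i.
  rewrite (bigD1 i)//= eqxx mulr1 big1 ?addr0// => i' i'i.
  by rewrite (inj_eq finj) eq_sym (negPf i'i) mulr0.
exists (d \o f); split => [i k Rk /=|x Rx].
  rewrite dP; case: eqP => // kf; case/negP: Rk; apply/RR'.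
  by right; exists i.
have subE (c : 'rV[F]_n) k :
   ecoord (x - \sum_(i < n) c ord0 i *: (d \o f) i) k =
   ecoord x k - \sum_(i < n) c ord0 i * (k == f i)%:R.
  by rewrite addrC -scaleN1r coordP sumE mulN1r addrC.
exists (\row_i ecoord x (f i)); split => [k R'k|c Hc].
  rewrite subE; have [[i ->]|nk] := pselect (exists i, k = f i).
    by rewrite sumf mxE subrr.
  rewrite Rx ?sub0r; last by apply/negP => /RR' [] //; apply/negP.
  rewrite big1 ?oppr0// => i _; case: eqP => [kf|]; last by rewrite mulr0.
  by case: nk; exists i.
apply/rowP => i; rewrite mxE.
by have := Hc (f i) (fR' i); rewrite subE sumf => /subr0_eq.
Qed.

Let graph0 : graph (fun _ _ => 0) = coord_space (fun k => if k is inl _ then true else false).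
Proof.
apply/seteqP; split => [_ [v _ <-] [i|i]//= _|x xR].
  by rewrite /rvmul fsbig1// => ? _; rewrite mulr0.
exists x.1 => //; case: x xR => v w xR; congr pair; apply/funext => j.
by rewrite /rvmul fsbig1 => [|? _]; [rewrite -(xR (inr j))|rewrite mulr0].
Qed.

Let std_rows (j : int) : pred (nat + nat) :=
  fun k => match k with inl i => - j <= i%:Z | inr i => i%:Z < j end.

Let Gr_std j : Gr j (coord_space (std_rows j)).
Proof.
split.
  split=> [k _|a x y xR yR k nk]; first by rewrite coord0.
  by rewrite coordP xR// yR// mulr0 addr0.
exists (fun _ _ => 0), `|Num.max j 0|%N, `|Num.max (- j) 0|%N.
rewrite graph0.
set R0 := (X in coord_space X `&` _).
have -> : coord_space R0 `&` coord_space (std_rows j) =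
    coord_space (predI R0 (std_rows j)).
  apply/seteqP; split => [x [x1 x2] k /=|x xR].
    by rewrite negb_and => /orP[/x1|/x2].
  by split => k nk; apply: xR; rewrite /= negb_and nk ?orbT.
split.
- apply: (@quot_dim_coord _ _ _ (fun i => inr (i : nat))) => //.
    by move=> i i' [] /val_inj.
  move=> [i|i] /=; first by split=> [->|[//|[]//]]; left.
  split=> [ij|[//|[i' [->]]]]; last by have := ltn_ord i'; lia.
  by right; unshelve eexists (Ordinal (_ : (i < _)%N)) => //; lia.
- apply: (@quot_dim_coord _ _ _ (fun i => inl (i : nat))).
  + by move=> i i' [] /val_inj.
  + by move=> i /=; have := ltn_ord i; lia.
  move=> [i|i] /=; last by split=> [//|[//|[]//]].
  split => // _; have [ji|ij] := leP (- j) i; first by left.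
  by right; unshelve eexists (Ordinal (_ : (i < _)%N)) => //; lia.
- lia.
Qed.

Lemma Fl_nonempty (I : set int) : Fl I !=set0.
Proof.
exists (fun j => coord_space (std_rows (val j))); split => [j|j k jk x xj].
  exact: Gr_std.
move=> r nr; apply: xj; apply: contraNN nr; rewrite jk.
by case: r => i /=; lia.
Qed.

(* The library asks for a point in every measurable space. *)
Definition flag0 (I : set int) : flag I :=
  let L := cid (Fl_nonempty I) in exist _ (projT1 L) (mem_set (projT2 L)).
HB.instance Definition _ I := isPointed.Build (flag I) (flag0 I).

(* Generators of the sigma-algebra induced by the product of the Gr j. *)
Definition flag_cylinders (I : set int) : set (set (flag I)) :=
  [set A | exists (j : I) (S : set (set E)),
    [/\ S `<=` Gr (val j), borel_subspaces S &
        A = [set L : flag I | S (val L j)]]].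
Arguments flag_cylinders : clear implicits.

Definition flag_space (I : set int) := g_sigma_algebraType (flag_cylinders I).

(* The translate A g of a set of flags. *)
Definition flag_translate (I : set int) (g : {linear E -> E})
    (A : set (flag_space I)) : set (flag_space I) :=
  [set L' | exists2 L, A L & forall j : I, val L' j = g @` val L j].

Definition GL0_invariant (R : realType) (I : set int)
    (P : probability (flag_space I) R) : Prop :=
  forall g : {linear E -> E}, GL0 g ->
    forall A : set (flag_space I), measurable A -> P (flag_translate g A) = P A.

End Spaces.

Arguments flag_space : clear implicits.

Definition is_segment (I : set int) : Prop :=
  [\/ exists a b : int, a <= b /\ I = `[a, b]%classic,
      exists a : int, I = `[a, +oo[%classic,
      exists b : int, I = `]-oo, b]%classic |
      I = [set: int]].

(* Main.v *)
Require Import Defs.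
From HB Require Import structures.
From mathcomp Require Import all_boot all_order all_algebra finmap.
From mathcomp Require Import mxabelem zify.
From mathcomp Require Import all_classical all_reals all_analysis.
From mathcomp Require Import measurable_realfun.

Set Implicit Arguments.
Unset Strict Implicit.
Unset Printing Implicit Defensive.
Import Order.TTheory GRing.Theory Num.Theory.
Import numFieldNormedType.Exports.

(** Let V_N be the space of vectors with e-part supported below N, and U_N the
    space of those whose only nonzero coordinates are along the f_j with j >= N.
    The V_N exhaust the space, the U_N shrink to 0, and V_N / U_N is F^(2N). A
    subspace M leaves there its level N, the image of its intersection with V_N.
    It is semi-infinite of relative dimension j exactly when, for N large, it is
    transverse to the pair (V_N, U_N) and its level has dimension N + j
    ([Gr_eventually], [Gr_intro]). In a chart, the levels of a subspace and the
    corners of its matrix determine each other ([agree_upto_lev],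
    [lev_agree_upto]). Therefore the measurable sets of flags are generated by
    the level events, the sets that depend on finitely many levels
    ([flag_measurableE]), and it suffices to know a measure on level events
    ([level_event_measure_unique]).

    An invertible matrix of size 2N acts on the coordinates of index below N and
    defines a finitary operator, which belongs to GL^0. Conversely, as far as
    finitely many levels of the image are concerned, every element of GL^0 acts
    as a finitary operator; the condition theta = 0 is what makes the ranks match
    ([GL0_approx]). So the group may be replaced by the union of the finite
    groups GL_2N.

    Uniqueness. The group GL_2N is transitive on the flags of F^(2N) with given
    dimensions. Hence, for a level event A and flags transverse at level N, the
    proportion of h in GL_2N that move the flag into A is the same for all of
    them. Averaging an invariant measure over GL_2N shows that, among the flags
    transverse at level N, it gives A exactly this proportion ([orbit_count]).
    Every flag is transverse at some level, so letting N grow determines the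
    measure of A ([invariant_level_event_unique]).

    Existence. Fix a flag and take the proportions of h in GL_2N moving it into
    A; their limits along a free ultrafilter form a finitely additive function of
    A, invariant on level events. It is countably additive provided that no
    mass escapes. A random invertible matrix spreads each nonzero vector
    uniformly over the nonzero vectors ([count_incidence]); a first moment
    estimate then shows that the moved flag fails to be transverse at the levels
    2|j| + s, for some degree j in a window, with probability at most 6 / 2^s,
    whatever the window and N ([count_bad_flag_ops]). Flags that are transverse
    at prescribed levels form a compact family ([flag_compactness]). So a
    decreasing sequence of level events whose limit proportions stay above a
    positive number has a common flag ([limit_freq_decreasing]), and the extension
    theorem of Caratheodory provides the measure. *)

(** * Invertible matrices: extension and counting *)

Local Open Scope ring_scope.

Section MatrixExtension.
Variable F : fieldType.

Lemma kermx_sub_factor p n (A B : 'M[F]_(p, n)) :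
  (kermx A <= kermx B)%MS -> A *m (pinvmx A *m B) = B.
Proof.
move=> sAB; apply/eqP; rewrite -subr_eq0 mulmxA -{2}[B]mul1mx -mulmxBl.
apply/eqP/sub_kermxP; apply: submx_trans sAB; apply/sub_kermxP.
by rewrite mulmxBl mul1mx mulmxKpV ?submx_refl// subrr.
Qed.

(** Both row spaces are copies of F^p modulo the common kernel, and an isomorphism
    between two subspaces of F^n extends to an automorphism of F^n. *)
Lemma unitmx_same_kernel p n (A B : 'M[F]_(p, n)) :
  (forall u : 'rV[F]_p, u *m A = 0 <-> u *m B = 0) ->
  exists2 h : 'M[F]_n, h \in unitmx & A *m h = B.
Proof.
move=> kAB.
have ks : (kermx A :=: kermx B)%MS.
  apply/eqmxP/andP; split; apply/rV_subP => u /sub_kermxP u0;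
    by apply/sub_kermxP/kAB.
have AB : A *m (pinvmx A *m B) = B by apply: kermx_sub_factor; rewrite ks.
have rAB : \rank (A *m (pinvmx A *m B)) = \rank A.
  rewrite AB; have : \rank (kermx A) = \rank (kermx B) by rewrite ks.
  by rewrite !mxrank_ker; have := rank_leq_row A; have := rank_leq_row B; lia.
by have [h hu hE] := complete_unitmx rAB; exists h => //; rewrite -hE.
Qed.

Lemma rV_row_mx_ind p1 p2 (P : 'rV[F]_(p1 + p2) -> Prop) :
  (forall a b, P (row_mx a b)) -> forall u, P u.
Proof. by move=> H u; rewrite -(hsubmxK u). Qed.

(** The inductive step in the transitivity of GL_n on flags: k on A and any
    isomorphism between complements of A in A' and of B in B' glue to an
    injection of A', which [unitmx_same_kernel] turns into an automorphism. *)
Lemma unitmx_extend n (A A' B B' k : 'M[F]_n) :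
  k \in unitmx -> (A <= A')%MS -> (B <= B')%MS -> (A *m k :=: B)%MS ->
  \rank A' = \rank B' ->
  exists h : 'M[F]_n, [/\ h \in unitmx, A *m h = A *m k & (A' *m h :=: B')%MS].
Proof.
move=> ku sA sB AkB rAB.
have rk : \rank A = \rank B by rewrite -AkB mxrankMfree// row_free_unit.
set C := (A' :\: A)%MS; set D := (B' :\: B)%MS.
have rC : \rank C = \rank D.
  have := mxrank_cap_compl A' A; have := mxrank_cap_compl B' B.
  rewrite (capmx_idPr sA) (capmx_idPr sB).
  by rewrite -/C -/D; lia.
have [k2 k2u CD] := eq_rank_unitmx rC.
have dA : (A :&: C = 0)%MS by rewrite capmxC; apply: capmx_diff.
have dB : (B :&: D = 0)%MS by rewrite capmxC; apply: capmx_diff.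
have inj g m (u : 'rV[F]_m) (X : 'M[F]_(m, n)) : g \in unitmx ->
    u *m (X *m g) = 0 -> u *m X = 0.
  by move=> gu; rewrite mulmxA => /(congr1 (mulmx^~ (invmx g))); rewrite mulmxK// mul0mx.
(* k on A and k2 on the complement C have independent images. *)
have [|h hu] := @unitmx_same_kernel _ _ (col_mx A C) (col_mx (A *m k) (C *m k2)).
  apply: rV_row_mx_ind => a b; rewrite !mul_row_col; split => [/eqP|/eqP];
    rewrite addr_eq0 => /eqP E.
    have aA0 : a *m A = 0.
      apply/eqP; rewrite -submx0 -dA sub_capmx submxMl/= E.
      by rewrite -mulNmx submxMl.
    by rewrite mulmxA aA0 mul0mx add0r mulmxA -[b *m C]opprK -E aA0 oppr0 mul0mx.
  have aA0 : a *m (A *m k) = 0.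
    apply/eqP; rewrite -submx0 -dB sub_capmx -{1}AkB submxMl/= E.
    by rewrite -mulNmx CD submxMl.
  rewrite (inj _ _ _ _ ku aA0) add0r.
  by apply: (inj _ _ _ _ k2u); rewrite -[LHS]opprK -E aA0 oppr0.
rewrite mul_col_mx => /eq_col_mx [h1 h2]; exists h; split => //.
have addD (X X' : 'M[F]_n) : (X <= X')%MS -> (X' :=: X + (X' :\: X))%MS.
  move=> sX; apply/eqmxP; rewrite addsmx_sub sX diffmxSl /= andbT.
  apply: (@submx_trans _ _ _ _ _ _ ((X' :\: X) + (X' :&: X))%MS).
    by rewrite addsmx_diff_cap_eq.
  by rewrite addsmxC addsmxS ?capmxSr.
apply/eqmxP; rewrite !(eqmxMr h (addD _ _ sA)) !(addD _ _ sB) !addsmxMr h1 h2.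
by apply/eqmxP; exact: adds_eqmx AkB (eqmx_sym CD).
Qed.

(** GL_n is transitive on flags with prescribed dimensions: a matrix that is right
    on one member is corrected on the next one without changing it on the
    members before. The predicate p marks the degrees present in the flag, and
    its convexity makes the consecutive inclusions a single chain. *)
Lemma unitmx_flags n r (p : pred nat) (K L : nat -> 'M[F]_n) :
  (forall i j k, i <= j <= k -> p i -> p k -> p j)%N ->
  (forall i, p i -> p i.+1 -> (K i <= K i.+1)%MS) ->
  (forall i, p i -> p i.+1 -> (L i <= L i.+1)%MS) ->
  (forall i, p i -> \rank (K i) = \rank (L i)) ->
  exists2 h : 'M[F]_n, h \in unitmx &
    forall i, (i <= r)%N -> p i -> (K i *m h :=: L i)%MS.
Proof.
move=> cp sK sL rKL.
have mono (X : nat -> 'M[F]_n) : (forall i, p i -> p i.+1 -> (X i <= X i.+1)%MS) ->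
    forall i j, (i <= j)%N -> p i -> p j -> (X i <= X j)%MS.
  move=> sX i j; elim: j => [|j IH].
    by rewrite leqn0 => /eqP ->; rewrite submx_refl.
  rewrite leq_eqVlt => /predU1P[->|]; first by rewrite submx_refl.
  rewrite ltnS => ij pi pj1.
  have pj : p j by apply: cp pi pj1; rewrite ij leqnSn.
  exact: submx_trans (IH ij pi pj) (sX _ pj pj1).
elim: r => [|r [h hu hE]].
  have [p0|np0] := boolP (p 0%N).
    have [h hu hE] := eq_rank_unitmx (rKL _ p0).
    by exists h => // i; rewrite leqn0 => /eqP -> _; apply: eqmx_sym.
  by exists 1%:M => [|i]; rewrite ?unitmx1// leqn0 => /eqP ->; rewrite (negPf np0).
have [p1|np1] := boolP (p r.+1); last first.
  exists h => // i; rewrite leq_eqVlt => /predU1P[->|]; first by rewrite (negPf np1).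
  by rewrite ltnS; apply: hE.
have [pr|npr] := boolP (p r); last first.
  have [k ku kE] := eq_rank_unitmx (rKL _ p1).
  exists k => // i; rewrite leq_eqVlt => /predU1P[-> _|]; first exact: eqmx_sym.
  rewrite ltnS => ir pi; case/negP: npr; apply: cp pi p1.
  by rewrite ir leqnSn.
have [k [ku k1 k2]] :=
  unitmx_extend hu (sK _ pr p1) (sL _ pr p1) (hE _ (leqnn _) pr) (rKL _ p1).
exists k => // i; rewrite leq_eqVlt => /predU1P[-> _//|]; rewrite ltnS => ir pi.
have /submxP[X XE] := mono _ sK _ _ ir pi pr.
by rewrite XE -mulmxA k1 mulmxA -XE; exact: hE.
Qed.

(** Steinitz exchange: a coordinate subspace that is maximal among those meeting A
    trivially is a complement of A. *)
Lemma coordinate_complement n (A : 'M[F]_n) :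
  exists S : {set 'I_n}, let B := (\sum_(i in S) <<delta_mx ord0 i : 'rV[F]_n>>)%MS in
    (A :&: B = 0)%MS /\ (A + B :=: 1%:M)%MS.
Proof.
pose B (S : {set 'I_n}) := (\sum_(i in S) <<delta_mx ord0 i : 'rV[F]_n>>)%MS.
have P0 : (A :&: B finset.set0)%MS == 0 by rewrite /B big_set0 capmx0 eqxx.
have [S maxS] := ex_maxset (ex_intro (fun S => (A :&: B S)%MS == 0) finset.set0 P0).
have dS : (A :&: B S = 0)%MS by apply/eqP; case/maxsetP: maxS.
exists S; split => //; apply/eqmxP; rewrite submx1/=; apply/row_subP => i.
rewrite rowE mulmx1; have [iS|niS] := boolP (i \in S).
  apply: submx_trans (addsmxSr _ _); apply: (sumsmx_sup i) => //.
  by rewrite genmxE.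
have : ~~ ((A :&: B (i |: S))%MS == 0).
  apply/negP => dSi; case/maxsetP: maxS => _ /(_ _ dSi) E.
  by move/negP: niS; apply; rewrite -E ?finset.subsetUr// !inE eqxx.
case/rowV0Pn => v; rewrite sub_capmx => /andP[vA].
rewrite /B big_setU1//= => /sub_addsmxP [[x y] /= vE] v0.
have [z zE] : exists z, x *m <<delta_mx ord0 i : 'rV[F]_n>>%MS = z *: delta_mx ord0 i.
  by apply/sub_rVP; rewrite mulmx_sub// genmxE.
rewrite zE in vE; have [z0|z0] := eqVneq z 0.
  move: v0; rewrite -submx0 -dS sub_capmx vA/= vE z0 scale0r add0r.
  by rewrite submxMl.
have -> : delta_mx 0 i = z^-1 *: (v - y *m B S).
  by rewrite vE addrK scalerA mulVf// scale1r.
apply: scalemx_sub; apply: addmx_sub; first exact: submx_trans vA (addsmxSl _ _).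
by rewrite -mulNmx mulmx_sub// addsmxSr.
Qed.

End MatrixExtension.

Section Counting.
Variable F : finFieldType.
Local Notation q := #|F|.

Lemma card_submx m n (A : 'M[F]_(m, n)) :
  #|[set x : 'rV[F]_n | (x <= A)%MS]| = (q ^ \rank A)%N.
Proof. by rewrite -card_rowg; apply: eq_card => x; rewrite !inE. Qed.

Lemma card_submx_neq0 m n (A : 'M[F]_(m, n)) :
  #|[set x : 'rV[F]_n | (x <= A)%MS & x != 0]| = (q ^ \rank A - 1)%N.
Proof.
rewrite -card_submx [in RHS](cardsD1 0) inE sub0mx add1n subn1/=.
by apply: eq_card => x; rewrite !inE andbC.
Qed.

Lemma sum_unitmx_mulr n (h : 'M[F]_n) (f : 'M[F]_n -> nat) : h \in unitmx ->
  (\sum_(k | k \in unitmx) f (k *m h) = \sum_(k | k \in unitmx) f k)%N.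
Proof.
move=> hu; rewrite [RHS](reindex_onto (mulmx^~ h) (mulmx^~ (invmx h)))/=.
  by apply: eq_bigl => k; rewrite mulmxK// eqxx andbT unitmx_mul hu andbT.
by move=> k _; rewrite mulmxKV.
Qed.

Lemma sum_unitmx_mull n (h : 'M[F]_n) (f : 'M[F]_n -> nat) : h \in unitmx ->
  (\sum_(k | k \in unitmx) f (h *m k) = \sum_(k | k \in unitmx) f k)%N.
Proof.
move=> hu; rewrite [RHS](reindex_onto (mulmx h) (mulmx (invmx h)))/=.
  by apply: eq_bigl => k; rewrite mulKmx// eqxx andbT unitmx_mul hu.
by move=> k _; rewrite mulKVmx.
Qed.

Lemma unitmx_nonzero_transitive n (x y : 'rV[F]_n) : x != 0 -> y != 0 ->
  exists2 h : 'M[F]_n, h \in unitmx & x *m h = y.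
Proof.
move=> x0 y0; apply: unitmx_same_kernel => u.
have E (z : 'rV[F]_n) : z != 0 -> u *m z = 0 <-> u = 0.
  move=> z0; split => [|->]; last by rewrite mul0mx.
  rewrite [u]mx11_scalar mul_scalar_mx => /eqP.
  by rewrite scaler_eq0 (negPf z0) orbF => /eqP ->; rewrite -scalemx1 scale0r.
by rewrite !E.
Qed.

Local Notation G n := #|[set h : 'M[F]_n | h \in unitmx]|.

(** GL_n being transitive on nonzero vectors, a random invertible h sends a fixed
    nonzero x to a uniformly distributed nonzero vector. Summation over x in A
    of the probability that x h falls in B gives the expected number of such x. *)
Lemma count_incidence n (A B : 'M[F]_n) :
  ((\sum_(h : 'M[F]_n | h \in unitmx)
     #|[set x : 'rV[F]_n | [&& (x <= A)%MS, x != 0%R & (x *m h <= B)%MS]]|)%N * (q ^ n - 1)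
   = G n * ((q ^ \rank A - 1) * (q ^ \rank B - 1)))%N.
Proof.
pose c (x y : 'rV[F]_n) := (\sum_(h : 'M[F]_n | h \in unitmx) (x *m h == y))%N.
have cE x y y' : y != 0 -> y' != 0 -> c x y = c x y'.
  move=> y0 y'0; have [k ku <-] := unitmx_nonzero_transitive y0 y'0.
  rewrite /c -(sum_unitmx_mulr (fun h => nat_of_bool (x *m h == y *m k)) ku).
  apply: eq_bigr => h _; rewrite mulmxA (inj_eq (can_inj (mulmxK ku)))//.
have sumc x : x != 0 -> (\sum_(y : 'rV[F]_n | y != 0%R) c x y = G n)%N.
  move=> x0; rewrite /c exchange_big/= -sum1dep_card; apply: eq_bigr => h hu.
  rewrite (bigD1 (x *m h))/=; last first.
    by rewrite -(mul0mx _ h) (inj_eq (can_inj (mulmxK hu))).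
  rewrite eqxx big1 ?addn0// => y /andP[_]; rewrite eq_sym.
  by case: eqP.
have cq x y : x != 0 -> y != 0 -> (c x y * (q ^ n - 1) = G n)%N.
  move=> x0 y0; rewrite -(sumc x x0).
  rewrite (eq_bigr (fun=> c x y)); last by move=> z z0; exact: cE.
  rewrite sum_nat_const mulnC; congr (_ * _)%N.
  rewrite -[n in LHS](mxrank1 F) -card_submx_neq0; apply: eq_card => z.
  by rewrite !inE submx1.
have -> : (\sum_(h : 'M[F]_n | h \in unitmx)
     #|[set x : 'rV[F]_n | [&& (x <= A)%MS, x != 0%R & (x *m h <= B)%MS]]| =
   \sum_(x : 'rV[F]_n | (x <= A)%MS && (x != 0%R))
     \sum_(y : 'rV[F]_n | (y <= B)%MS && (y != 0%R)) c x y)%N.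
  under [RHS]eq_bigr do rewrite exchange_big.
  rewrite exchange_big /=; apply: eq_bigr => h hu.
  rewrite -sum1dep_card big_mkcond [RHS]big_mkcond/=; apply: eq_bigr => x _.
  case: (boolP (x <= A)%MS) => //= xA; case: (boolP (x != 0%R)) => //= x0.
  have xh0 : x *m h != 0 by rewrite -(mul0mx _ h) (inj_eq (can_inj (mulmxK hu))).
  case: ifP => xhB.
    rewrite (bigD1 (x *m h)) ?xhB//= eqxx big1 ?addn0// => y /andP[_]; rewrite eq_sym.
    by case: eqP.
  rewrite big1// => y /andP[yB _]; case: eqP => // E.
  by rewrite E yB in xhB.
rewrite big_distrl/= (eq_bigr (fun=> G n * (q ^ \rank B - 1)))%N; last first.
  move=> x /andP[_ x0]; rewrite big_distrl/= (eq_bigr (fun=> G n)) => [|y /andP[_]];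
    last exact: cq.
  rewrite sum_nat_const mulnC; congr (_ * _)%N.
  by rewrite -(card_submx_neq0 B); apply: eq_card => z; rewrite !inE.
rewrite sum_nat_const mulnCA; congr (_ * (_ * _))%N.
by rewrite -(card_submx_neq0 A); apply: eq_card => z; rewrite !inE.
Qed.

Lemma sum_incidence_le n (A B : 'M[F]_n) : (0 < n)%N ->
  ((\sum_(h : 'M[F]_n | h \in unitmx)
     #|[set x : 'rV[F]_n | [&& (x <= A)%MS, x != 0%R & (x *m h <= B)%MS]]|)%N * q ^ n
   <= G n * q ^ (\rank A + \rank B))%N.
Proof.
move=> n0; have := count_incidence A B; set S := (\sum_(_ | _) _)%N => E.
have q1 : (1 < q)%N by exact: card_finNzRing_gt1.
have qn1 : (1 < q ^ n)%N by rewrite -(exp1n n) ltn_exp2r.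
have an : (q ^ \rank A <= q ^ n)%N by rewrite leq_exp2l// rank_leq_row.
have a0 : (0 < q ^ \rank A)%N by rewrite expn_gt0 (ltnW q1).
have b0 : (0 < q ^ \rank B)%N by rewrite expn_gt0 (ltnW q1).
rewrite expnD -(@leq_pmul2r (q ^ n - 1)) ?subn_gt0// mulnAC E.
move: (q ^ \rank A)%N (q ^ \rank B)%N (q ^ n)%N an a0 b0 {E} qn1 => a b c.
rewrite -!mulnA leq_mul2l => an a0 b0 c1; apply/orP; right.
have {}an : ((a - 1) * c <= a * (c - 1))%N by rewrite mulnBl mulnBr; lia.
by rewrite mulnCA [leqRHS]mulnCA; apply: leq_mul; rewrite ?leq_subr.
Qed.

(** First moment bound: each h in question contributes at least one vector to the
    incidence count. *)
Lemma count_meet n (A B : 'M[F]_n) : (0 < n)%N ->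
  (#|[set h : 'M[F]_n | (h \in unitmx) &&
      [exists x : 'rV[F]_n, [&& (x <= A)%MS, x != 0%R & (x *m h <= B)%MS]]]| * q ^ n
   <= G n * q ^ (\rank A + \rank B))%N.
Proof.
move=> n0; apply: leq_trans (sum_incidence_le A B n0).
rewrite leq_mul2r; apply/orP; right; rewrite -sum1dep_card big_mkcondr/=.
apply: leq_sum => h hu; case: existsP => // -[x xE].
by rewrite card_gt0; apply/set0Pn; exists x; rewrite inE.
Qed.

(** The intersection of A h and B has dimension at least d, and at least d + 1 when
    their sum is not everything. Every h thus contributes at least q^d - 1
    nonzero vectors to the incidence count, the exceptional ones at least q^d
    more, while the average is at most q^d. Counting the excess over q^d - 1 is
    what leaves a small proportion q^-d for the exceptional h. *)
Lemma count_not_full n d (A B : 'M[F]_n) : (0 < n)%N ->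
  (\rank A + \rank B = n + d)%N ->
  (#|[set h : 'M[F]_n | (h \in unitmx) && ~~ row_full (A *m h + B)%MS]| * q ^ d <= G n)%N.
Proof.
move=> n0 abd; have := sum_incidence_le A B n0.
have q1 : (1 < q)%N by exact: card_finNzRing_gt1.
rewrite abd expnD mulnCA mulnC leq_pmul2l ?expn_gt0 ?(ltnW q1)// => le1.
set bad := [set _ | _].
have : (\sum_(h : 'M[F]_n | h \in unitmx) ((q ^ d - 1) + (h \in bad) * q ^ d)
   <= G n * q ^ d)%N.
  apply: leq_trans le1; apply: leq_sum => h hu.
  have -> : #|[set x : 'rV[F]_n | [&& (x <= A)%MS, x != 0%R & (x *m h <= B)%MS]]| =
      (q ^ \rank (A *m h :&: B)%MS - 1)%N.
    rewrite -card_submx_neq0 -(card_imset _ (can_inj (mulmxK hu))).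
    apply: eq_card => y; rewrite inE sub_capmx; apply/imsetP/idP.
      move=> [x]; rewrite inE => /and3P[xA x0 xB] ->.
      rewrite submxMr//= xB/= -(mul0mx _ h) (inj_eq (can_inj (mulmxK hu)))//.
    move=> /andP[/andP[yA yB] y0]; exists (y *m invmx h); last by rewrite mulmxKV.
    rewrite inE mulmxKV// yB andbT; apply/andP; split.
      by rewrite -[A](mulmxK hu) submxMr.
    by apply: contraNneq y0 => E; rewrite -[y](mulmxKV hu) E mul0mx.
  have rA : \rank (A *m h) = \rank A by rewrite mxrankMfree// row_free_unit.
  have := mxrank_sum_cap (A *m h) B; rewrite rA abd => E.
  rewrite inE hu/= /row_full; have rle := rank_leq_row (A *m h + B)%MS.
  have [rn|rn] := eqVneq (\rank (A *m h + B)%MS) n.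
    by rewrite mul0n addn0 leq_sub2r// leq_exp2l//; lia.
  rewrite mul1n; apply: (@leq_trans (q ^ d.+1 - 1)).
    rewrite expnS; have : (0 < q ^ d)%N by rewrite expn_gt0 (ltnW q1).
    by move: (q ^ d)%N => c; nia.
  by rewrite leq_sub2r// leq_exp2l//; lia.
rewrite big_split/= sum_nat_const -big_distrl/=.
have -> : #|[pred h : 'M[F]_n | h \in unitmx]| = G n by rewrite cardsE.
have -> : (\sum_(h : 'M[F]_n | h \in unitmx) (h \in bad) = #|bad|)%N.
  rewrite -sum1_card big_mkcond [RHS]big_mkcond/=; apply: eq_bigr => h _.
  by rewrite !inE; case: (h \in unitmx).
have : (0 < q ^ d)%N by rewrite expn_gt0 (ltnW q1).
case: (q ^ d)%N => // c _; rewrite subn1/= !mulnS.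
by set u := (G n * c)%N; set v := (#|bad| * c)%N; lia.
Qed.

End Counting.

(** * Coordinates and finite levels *)

Local Open Scope classical_set_scope.
Local Open Scope ring_scope.

Section Subspace.
Variables (K : fieldType) (V : lmodType K) (M : set V).
Hypothesis sM : is_subspace M.
Lemma subspace0 : M 0. Proof. exact: sM.1. Qed.
Lemma subspaceD x y : M x -> M y -> M (x + y).
Proof. by move=> Mx My; have := sM.2 1 _ _ Mx My; rewrite scale1r. Qed.
Lemma subspaceZ a x : M x -> M (a *: x).
Proof. by move=> Mx; have := sM.2 a _ _ Mx sM.1; rewrite addr0. Qed.
Lemma subspaceN x : M x -> M (- x).
Proof. by rewrite -scaleN1r; exact: subspaceZ. Qed.
Lemma subspaceB x y : M x -> M y -> M (x - y).
Proof. by move=> Mx /subspaceN; exact: subspaceD. Qed.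
Lemma subspace_sum (I : Type) (r : seq I) (P : pred I) (f : I -> V) :
  (forall i, P i -> M (f i)) -> M (\sum_(i <- r | P i) f i).
Proof. by move=> Mf; apply: big_ind => //; [exact: subspace0|exact: subspaceD]. Qed.
Lemma subspaceBr x y : M y -> M (x - y) <-> M x.
Proof.
by move=> My; split => [Mxy|Mx]; [rewrite -(subrK y x); exact: subspaceD|exact: subspaceB].
Qed.
End Subspace.

Lemma subspaceI (K : fieldType) (V : lmodType K) (A B : set V) :
  is_subspace A -> is_subspace B -> is_subspace (A `&` B).
Proof.
move=> [A0 sA] [B0 sB]; split; first by split.
by move=> a x y [Ax Bx] [Ay By]; split; [exact: sA|exact: sB].
Qed.

Lemma subspace_image (K : fieldType) (V W : lmodType K) (f : {linear V -> W}) (A : set V) :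
  is_subspace A -> is_subspace (f @` A).
Proof.
move=> sA; split; first by exists 0; [exact: sA.1|rewrite linear0].
move=> a _ _ [x Ax <-] [y Ay <-]; exists (a *: x + y); first exact: sA.2.
by rewrite linearP.
Qed.

Section QuotDim.
Variables (F : fieldType) (V : lmodType F).

(** The hypotheses say that phi induces an isomorphism of B / A onto b / a. All
    dimensions of quotients of infinite-dimensional spaces are computed by
    producing such a phi into a space of row vectors. *)
Lemma quot_dim_rank (A B : set V) p (phi : {linear V -> 'rV[F]_p}) (a b : 'M[F]_p) n :
  is_subspace B -> (a <= b)%MS ->
  (forall x, B x -> (phi x <= b)%MS) ->
  (forall y : 'rV_p, (y <= b)%MS -> exists2 x, B x & (y - phi x <= a)%MS) ->
  (forall x, B x -> A x <-> (phi x <= a)%MS) ->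
  quot_dim A B n <-> \rank b = (\rank a + n)%N.
Proof.
move=> sB ab phib bphi Aa.
have comb (c : 'rV[F]_n) (v : 'I_n -> V) :
    phi (\sum_i c ord0 i *: v i) = c *m \matrix_i phi (v i).
  rewrite linear_sum/= mulmx_sum_row; apply: eq_bigr => i _.
  by rewrite linearZ/= rowK.
split => [[v [Bv vP]]|rab].
  pose P : 'M[F]_(n, p) := \matrix_i phi (v i).
  have Bc (c : 'rV[F]_n) : B (\sum_i c ord0 i *: v i).
    by apply: subspace_sum => // i _; exact: subspaceZ.
  have freeP (c : 'rV_n) : (c *m P <= a)%MS -> c = 0.
    move=> cPa; have [c0 [_ c0u]] := vP _ sB.1.
    rewrite -(c0u 0); first last.
      by rewrite big1 ?subr0 => [|i _]; [apply/Aa;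
        [exact: sB.1|rewrite linear0 sub0mx]|rewrite mxE scale0r].
    apply/esym/c0u; apply/Aa; first by apply: subspaceB => //; exact: sB.1.
    by rewrite linearB/= linear0 sub0r eqmx_opp comb.
  have aP0 : (a :&: P = 0)%MS.
    apply/eqP/rowV0P => u; rewrite sub_capmx => /andP[ua /submxP[c uc]].
    by rewrite uc (freeP c) ?mul0mx// -uc.
  have rP : \rank P = n.
    by apply/eqP/(@inj_row_free _ _ _ P) => c cP0; apply: freeP; rewrite cP0 sub0mx.
  have -> : \rank b = \rank (a + P)%MS; last by rewrite mxrank_disjoint_sum// rP.
  apply/eqmx_rank/andP; split; last first.
    rewrite addsmx_sub ab/=; apply/row_subP => i; rewrite rowK; exact: phib.
  apply/rV_subP => y yb; have [x Bx yx] := bphi _ yb.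
  have [c [Ac _]] := vP _ Bx.
  rewrite -(subrK (phi x) y); apply: addmx_sub; first exact: submx_trans yx (addsmxSl _ _).
  rewrite -(subrK (c *m P) (phi x)); apply: addmx_sub; last by rewrite mulmx_sub// addsmxSr.
  apply: submx_trans (addsmxSl _ _); rewrite -comb -linearB/=; apply/Aa => //.
  exact: subspaceB.
set C := (b :\: a)%MS.
have rC : \rank C = n.
  by have := mxrank_cap_compl b a; rewrite (capmx_idPr ab) -/C; lia.
have aC : (a :&: C = 0)%MS by rewrite capmxC capmx_diff.
have bE : (b <= C + a)%MS.
  apply: (@submx_trans _ _ _ _ _ _ (C + (b :&: a))%MS).
    by rewrite addsmx_diff_cap_eq.
  by rewrite addsmxS ?capmxSr.
have [R [freeR RC]] : exists R : 'M[F]_(n, p), row_free R /\ (R :=: C)%MS.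
  move: (row_base_free C) (eq_row_base C); rewrite -rC => fr eq.
  by exists (row_base C).
have /choice[v vP] : forall i : 'I_n, exists x, B x /\ (row i R - phi x <= a)%MS.
  move=> i; have [|x Bx xa] := bphi (row i R); last by exists x.
  by apply: submx_trans (row_sub _ _) _; rewrite RC diffmxSl.
exists v; split => [i|x Bx]; first by have [] := vP i.
have Bc (c : 'rV[F]_n) : B (\sum_i c ord0 i *: v i).
  by apply: subspace_sum => // i _; apply: subspaceZ => //; have [] := vP i.
have AE (c : 'rV[F]_n) : A (x - \sum_(i < n) c ord0 i *: v i) <-> (phi x - c *m R <= a)%MS.
  rewrite (Aa _ (subspaceB sB Bx (Bc c))) linearB/= comb.
  have d : (c *m R - c *m (\matrix_i phi (v i)) <= a)%MS.
    rewrite -mulmxBr mulmx_sub//; apply/row_subP => i.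
    by rewrite linearB/= rowK; have [] := vP i.
  split => H; last first.
    by rewrite -(subrKA (c *m R)) addmx_sub.
  by rewrite -(subrKA (c *m (\matrix_i phi (v i)))) addmx_sub// -eqmx_opp opprB.
have /sub_addsmxP[[y z] /= yz] : (phi x <= C + a)%MS by apply: submx_trans (phib _ Bx) bE.
have /submxP[c cE] : (y *m C <= R)%MS by rewrite RC submxMl.
exists c; split => [|c' /AE H].
  by apply/AE; rewrite yz cE addrAC subrr add0r submxMl.
have RC' : (R <= C)%MS by rewrite RC.
have : ((c - c') *m R <= a :&: C)%MS.
  rewrite sub_capmx (mulmx_sub _ RC') andbT mulmxBl -cE.
  rewrite (_ : _ - _ = (y *m C - c' *m R + z *m a) - z *m a); last first.
    by rewrite addrK.
  by rewrite (addrAC (y *m C)) -yz addmx_sub// -mulNmx submxMl.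
rewrite aC submx0 -(mul0mx _ R) (inj_eq (row_free_inj freeR)) subr_eq0 => /eqP.
by [].
Qed.

End QuotDim.

Section Coordinates.
Variable F : finFieldType.
Local Notation E := (E F).

Lemma ecoordP a (x y : E) k : ecoord (a *: x + y) k = a * ecoord x k + ecoord y k.
Proof. by case: k. Qed.

(** A coordinate with its linear structure, to which the general lemmas on linear
    maps apply. *)
Definition coord_map (k : nat + nat) (x : E) : F^o := ecoord x k.
Lemma coord_map_linear k : linear (coord_map k).
Proof. by move=> a x y; rewrite /coord_map ecoordP. Qed.
HB.instance Definition _ k := GRing.isLinear.Build F E F^o _ (coord_map k) (coord_map_linear k).

Lemma ecoord0 k : ecoord (0 : E) k = 0. Proof. exact: (linear0 (coord_map k)). Qed.
Lemma ecoordD (x y : E) k : ecoord (x + y) k = ecoord x k + ecoord y k.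
Proof. exact: (linearD (coord_map k)). Qed.
Lemma ecoordB (x y : E) k : ecoord (x - y) k = ecoord x k - ecoord y k.
Proof. exact: (linearB (coord_map k)). Qed.
Lemma ecoordZ a (x : E) k : ecoord (a *: x) k = a * ecoord x k.
Proof. by rewrite -[a *: x]addr0 ecoordP ecoord0 addr0. Qed.
Lemma ecoord_sum (I : Type) (r : seq I) (P : pred I) (f : I -> E) k :
  ecoord (\sum_(i <- r | P i) f i) k = \sum_(i <- r | P i) ecoord (f i) k.
Proof. exact: (linear_sum (coord_map k)). Qed.

Lemma ecoord_inj (x y : E) : (forall k, ecoord x k = ecoord y k) -> x = y.
Proof.
case: x y => [v w] [v' w'] H; congr pair.
  by apply/val_inj/funext => i; exact: (H (inl i)).
by apply/funext => i; exact: (H (inr i)).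
Qed.

Lemma ell_finsupp (x : E) : exists N, forall i, (N <= i)%N -> ecoord x (inl i) = 0.
Proof.
have /asboolP/finite_fsetP[A AE] := valP x.1.
exists (\max_(i <- A) i).+1%N => i Ni; apply/eqP/negPn/negP => nz.
have : [set i | val x.1 i != 0] i by [].
rewrite AE => /= iA; have := @leq_bigmax_seq _ (enum_fset A) xpredT id i iA isT.
by rewrite leqNgt Ni.
Qed.

Lemma vector_of_coords (f : nat + nat -> F) N :
  (forall i, (N <= i)%N -> f (inl i) = 0) -> exists x : E, forall k, ecoord x k = f k.
Proof.
move=> f0.
have fi : (fun i => f (inl i) : F^o) \in @finsupp_pred F.
  apply/asboolP; apply: (@sub_finite_set _ _ `I_N); last exact: finite_II.
  by move=> i /= nz; rewrite ltnNge; apply: contra nz => /f0 ->.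
by exists ((exist (fun v => v \in @finsupp_pred F) _ fi : ell F), (fun i => f (inr i))) => -[].
Qed.

Lemma delta_subproof k : exists x : E, forall k', ecoord x k' = (k' == k)%:R.
Proof.
apply: (@vector_of_coords _ (if k is inl i then i.+1 else 0)) => i.
by case: k => [j|j] //= ji; rewrite (_ : _ == _ = false)//; apply/eqP => -[ij];
  rewrite ij ltnn in ji.
Qed.
Definition edelta k : E := projT1 (cid (delta_subproof k)).
Lemma edeltaE k k' : ecoord (edelta k) k' = (k' == k)%:R.
Proof. exact: (projT2 (cid (delta_subproof k))). Qed.

Definition low N (k : nat + nat) : bool := match k with inl i | inr i => (i < N)%N end.

Definition idx N (i : 'I_(N + N)) : nat + nat :=
  match fintype.split i with inl a => inl (a : nat) | inr b => inr (b : nat) end.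

Lemma idx_inj N : injective (@idx N).
Proof.
move=> i j; rewrite /idx; case: (fintype.splitP i) => a ia;
  case: (fintype.splitP j) => b jb //= -[] /val_inj ab;
  by apply: ord_inj; rewrite ia jb ab.
Qed.

Lemma low_idx N (i : 'I_(N + N)) : low N (idx i).
Proof. by rewrite /idx; case: (fintype.split i) => a /=; exact: ltn_ord. Qed.

Lemma lowP N k : low N k -> exists i, k = @idx N i.
Proof.
case: k => [i|i] /= iN.
  exists (lshift N (Ordinal iN)); rewrite /idx; case: fintype.splitP => j /= ij.
    by rewrite ij.
  by exfalso; move: iN; rewrite ij; lia.
exists (rshift N (Ordinal iN)); rewrite /idx; case: fintype.splitP => j /= ij.
  by exfalso; have := ltn_ord j; lia.
by congr inr; lia.
Qed.

Lemma low_le M N k : (M <= N)%N -> low M k -> low N k.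
Proof. by case: k => i MN /= iM; exact: leq_trans iM MN. Qed.

(** On the space [Vs N] below, the kernel of this map is [Us N]: it identifies
    V_N / U_N with F^(2N). *)
Definition prj N (x : E) : 'rV[F]_(N + N) := \row_i ecoord x (idx i).
Lemma prj_linear N : linear (prj N).
Proof. by move=> a x y; apply/rowP => i; rewrite !mxE ecoordP. Qed.
HB.instance Definition _ N :=
  GRing.isLinear.Build F E 'rV[F]_(N + N) _ (prj N) (@prj_linear N).

Definition emb N (y : 'rV[F]_(N + N)) : E := \sum_i y 0 i *: edelta (idx i).
Lemma emb_linear N : linear (@emb N).
Proof.
move=> a x y; rewrite /emb scaler_sumr -big_split/=; apply: eq_bigr => i _.
by rewrite !mxE scalerDl scalerA.
Qed.
HB.instance Definition _ N :=
  GRing.isLinear.Build F 'rV[F]_(N + N) E _ (@emb N) (@emb_linear N).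

Lemma ecoord_emb_idx N (y : 'rV[F]_(N + N)) i : ecoord (emb y) (idx i) = y 0 i.
Proof.
rewrite ecoord_sum (bigD1 i)//= ecoordZ edeltaE eqxx mulr1 big1 ?addr0// => j ji.
by rewrite ecoordZ edeltaE (inj_eq (@idx_inj N)) eq_sym (negPf ji) mulr0.
Qed.

Lemma ecoord_emb_notlow N (y : 'rV[F]_(N + N)) k : ~~ low N k -> ecoord (emb y) k = 0.
Proof.
move=> nk; rewrite ecoord_sum big1// => i _.
rewrite ecoordZ edeltaE; case: eqP => [E|]; rewrite ?mulr0//.
by rewrite E low_idx in nk.
Qed.

Lemma prj_emb N (y : 'rV[F]_(N + N)) : prj N (emb y) = y.
Proof. by apply/rowP => i; rewrite mxE ecoord_emb_idx. Qed.

Lemma prjP N x y : prj N x = prj N y <-> (forall k, low N k -> ecoord x k = ecoord y k).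
Proof.
split => [xy k /lowP[i ->]|xy]; last by apply/rowP => i; rewrite !mxE xy// low_idx.
by have /rowP/(_ i) := xy; rewrite !mxE.
Qed.

Lemma prj_le M N x y : (M <= N)%N -> prj N x = prj N y -> prj M x = prj M y.
Proof. by move=> MN /prjP H; apply/prjP => k kM; apply/H/(low_le MN). Qed.

Lemma coord_space_subspace R : is_subspace (@coord_space F R).
Proof.
split => [k _|a x y xR yR k nk]; first by rewrite ecoord0.
by rewrite ecoordP xR// yR// mulr0 addr0.
Qed.

Definition rowV N : pred (nat + nat) := fun k => if k is inl i then (i < N)%N else true.
Definition rowU N : pred (nat + nat) := fun k => if k is inr i then (N <= i)%N else false.

(** V_N increases to the whole space, and the U_N, which lie in every V_M, decrease
    to 0 and form a base of neighbourhoods of 0. The finite spaces V_N / U_N are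
    the approximations of the infinite-dimensional one. *)
Definition Vs N : set E := coord_space (rowV N).
Definition Us N : set E := coord_space (rowU N).

Lemma Vs_sub N : is_subspace (Vs N). Proof. exact: coord_space_subspace. Qed.
Lemma Us_sub N : is_subspace (Us N). Proof. exact: coord_space_subspace. Qed.

Lemma coord_spaceS (R R' : pred (nat + nat)) :
  (forall k, R k -> R' k) -> @coord_space F R `<=` coord_space R'.
Proof. by move=> RR' x xR k nk; apply: xR; apply: contra nk; exact: RR'. Qed.

Lemma Vs_le M N : (M <= N)%N -> Vs M `<=` Vs N.
Proof. by move=> MN; apply: coord_spaceS => -[i|i]//= iM; exact: leq_trans iM MN. Qed.
Lemma Us_le M N : (M <= N)%N -> Us N `<=` Us M.
Proof. by move=> MN; apply: coord_spaceS => -[i|i]//=; exact: leq_trans. Qed.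
Lemma UsVs M N : Us M `<=` Vs N. Proof. by apply: coord_spaceS => -[]. Qed.

Lemma Vs_ex x : exists N, Vs N x.
Proof.
have [N Nx] := ell_finsupp x; exists N => -[i|i]//=; rewrite -leqNgt; exact: Nx.
Qed.

Lemma Vs_bigex n (f : 'I_n -> E) : exists N, forall i, Vs N (f i).
Proof.
have /choice[N NP] : forall i, exists N, Vs N (f i) by move=> i; exact: Vs_ex.
exists (\max_i N i)%N => i; apply: Vs_le (NP i); exact: leq_bigmax.
Qed.

Lemma Us_all x : (forall n, exists2 N, (n <= N)%N & Us N x) -> x = 0.
Proof.
move=> xU; apply: ecoord_inj => k; rewrite ecoord0.
have [N nN xN] := xU (match k with inl i | inr i => i.+1 end).
by apply: xN; case: k nN => //= i; rewrite -ltnNge.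
Qed.

Lemma emb_Vs N y : Vs N (@emb N y).
Proof. by move=> [i|i]//= /(@ecoord_emb_notlow N y (inl i)). Qed.

Lemma Us_prj N x : Us N x <-> Vs N x /\ prj N x = 0.
Proof.
split => [xU|[xV x0]].
  split; first exact: UsVs xU.
  by apply/rowP => i; rewrite !mxE; apply: xU; have := low_idx i; case: (idx i) => //= j;
    rewrite -ltnNge.
move=> k nk; have [lk|nlk] := boolP (low N k).
  have := x0; rewrite -(linear0 (prj N)) => /prjP/(_ _ lk); by rewrite ecoord0.
by case: k nk nlk => [i|i] nk nlk; [exact: xV|case/negP: nlk; rewrite /= ltnNge].
Qed.

Lemma Us_subprj N x y : Vs N x -> Vs N y -> prj N x = prj N y -> Us N (x - y).
Proof.
move=> Vx Vy xy; apply/Us_prj; split; first exact: subspaceB (Vs_sub N) _ _ Vx Vy.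
by rewrite linearB/= xy subrr.
Qed.

Lemma Us_embprj N x : Vs N x -> Us N (x - emb (prj N x)).
Proof. by move=> Vx; apply: Us_subprj => //; [exact: emb_Vs|rewrite prj_emb]. Qed.

(** The level N of M is the image of the intersection of M with V_N in
    V_N / U_N = F^(2N). It is presented by the canonical matrix of its row space,
    so that equal images are equal matrices. *)
Definition lev N (M : set E) : 'M[F]_(N + N) :=
  <<(\sum_(y : 'rV[F]_(N + N) | `[< exists x, [/\ M x, Vs N x & prj N x = y] >]) <<y>>)%MS>>%MS.

Lemma levP N M (y : 'rV[F]_(N + N)) : is_subspace M ->
  (y <= lev N M)%MS <-> exists x, [/\ M x, Vs N x & prj N x = y].
Proof.
move=> sM; rewrite /lev genmxE; split; last first.
  by move=> H; apply: (sumsmx_sup y); [exact/asboolP|rewrite genmxE].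
move/sub_sumsmxP => [u ->].
apply: (big_ind (fun y => exists x, [/\ M x, Vs N x & prj N x = y])) =>
  [|y1 y2 [x1 [M1 V1 <-]] [x2 [M2 V2 <-]]|i /asboolP [x [Mx Vx xi]]].
- exists 0; split; [exact: sM.1|exact: (Vs_sub N).1|by rewrite linear0].
- exists (x1 + x2); split; [exact: subspaceD|exact: (subspaceD (Vs_sub N))|by rewrite linearD].
have /sub_rVP[a ->] : (u i *m <<i>>%MS <= i)%MS by rewrite mulmx_sub// genmxE.
exists (a *: x); split; [exact: subspaceZ|exact: (subspaceZ (Vs_sub N))|by rewrite
  linearZ/= xi].
Qed.

Lemma lev_sub N M x : is_subspace M -> M x -> Vs N x -> (prj N x <= lev N M)%MS.
Proof. by move=> sM Mx Vx; apply/levP => //; exists x. Qed.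

Lemma lev_genmx N M : <<lev N M>>%MS = lev N M.
Proof. by rewrite /lev genmx_id. Qed.

Lemma eq_lev N M M' : is_subspace M -> is_subspace M' ->
  (forall y : 'rV[F]_(N + N), (exists x, [/\ M x, Vs N x & prj N x = y]) <->
     (exists x, [/\ M' x, Vs N x & prj N x = y])) -> lev N M = lev N M'.
Proof.
move=> sM sM' H; rewrite -(lev_genmx N M) -(lev_genmx N M'); apply/genmxP/andP.
by split; apply/rV_subP => y /levP yM; apply/levP => //; apply/H/yM.
Qed.

Lemma lev_ext N (M : set E) (A : 'M[F]_(N + N)) : is_subspace M ->
  (forall y : 'rV[F]_(N + N), (y <= A)%MS <-> (exists x, [/\ M x, Vs N x & prj N x = y])) ->
  (lev N M :=: A)%MS.
Proof.
move=> sM H; apply/eqmxP/andP; split; apply/rV_subP => y.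
  by move=> /levP yM; apply/H/yM.
by move=> /H yM; apply/levP.
Qed.

Lemma levS N M M' : is_subspace M -> is_subspace M' -> M `<=` M' -> (lev N M <= lev N M')%MS.
Proof.
move=> sM sM' MM'; apply/rV_subP => y /levP -/(_ sM) [x [Mx Vx xy]]; apply/levP => //.
by exists x; split => //; exact: MM'.
Qed.

(** As V_M contains U_N, a vector of V_N that agrees modulo U_N with a vector of V_M
    is itself in V_M. *)
Lemma lev_le M N X Y : (M <= N)%N -> is_subspace X -> is_subspace Y ->
  lev N X = lev N Y -> lev M X = lev M Y.
Proof.
move=> MN; wlog suff aux : X Y / is_subspace X -> is_subspace Y -> lev N X = lev N Y ->
    forall y : 'rV[F]_(M + M),
    (exists x, [/\ X x, Vs M x & prj M x = y]) -> (exists x, [/\ Y x, Vs M x & prj M x = y]).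
  by move=> sX sY XY; apply: eq_lev => // y; split; apply: aux.
move=> sX sY XY y [x [Xx Vx xy]].
have := lev_sub sX Xx (Vs_le MN Vx); rewrite XY => /levP -/(_ sY)[x' [Yx' Vx' xx']].
exists x'; split => //; last by rewrite -xy; apply: prj_le MN _.
have := Us_subprj Vx' (Vs_le MN Vx) xx' => /(@UsVs N M).
by move/(subspaceBr (Vs_sub M) _ Vx).
Qed.

Lemma lev_coordP N R (y : 'rV[F]_(N + N)) :
  (y <= lev N (coord_space R))%MS <-> (forall i, ~~ R (idx i) -> y 0 i = 0).
Proof.
rewrite levP; last exact: coord_space_subspace; split.
  by move=> [x [xR _ <-]] i ni; rewrite mxE xR.
move=> H; exists (emb y); split; [|exact: emb_Vs|exact: prj_emb].
move=> k nk; have [/lowP[i E]|] := boolP (low N k); last exact: ecoord_emb_notlow.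
by rewrite E ecoord_emb_idx H// -E.
Qed.

Lemma coordspan_subP n (S : pred 'I_n) (y : 'rV[F]_n) :
  (y <= \sum_(i | S i) <<delta_mx 0 i : 'rV[F]_n>>)%MS <-> (forall i, ~~ S i -> y 0 i = 0).
Proof.
split => [/sub_sumsmxP[u ->] i ni|H].
  rewrite summxE big1// => j Sj.
  have /sub_rVP[a ->] : (u j *m <<delta_mx 0 j : 'rV[F]_n>>%MS <= (delta_mx 0 j : 'rV[F]_n))%MS.
    by rewrite mulmx_sub// genmxE.
  rewrite !mxE eqxx/=; case: eqP => [ij|]; last by rewrite mulr0.
  by rewrite ij Sj in ni.
rewrite [y]row_sum_delta; apply: summx_sub => i _.
have [Si|/H ->] := boolP (S i); last by rewrite scale0r sub0mx.
by apply: scalemx_sub; apply: (sumsmx_sup i) => //; rewrite genmxE.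
Qed.

Lemma lev_coord N R :
  (lev N (coord_space R) :=: \sum_(i | R (idx i)) <<delta_mx 0 i : 'rV[F]_(N + N)>>)%MS.
Proof.
apply/eqmxP/andP; split; apply/rV_subP => y.
  by move/lev_coordP/(coordspan_subP (fun i => R (idx i))).
by move/(coordspan_subP (fun i => R (idx i)))/lev_coordP.
Qed.

Lemma rank_lev_coord N R : \rank (lev N (@coord_space F R)) = #|[pred i | R (@idx N i)]|.
Proof.
rewrite lev_coord; have := @mxdirect_delta F _ (fun i => R (@idx N i)) _ id (in2W (@inj_id _)).
rewrite mxdirectE/= => /eqP ->; rewrite -sum1_card; apply: eq_bigr => i _.
by rewrite mxrank_gen mxrank_delta.
Qed.

Lemma card_idx N R : #|[pred i | R (@idx N i)]| =
  (#|[pred i : 'I_N | R (inl (i : nat))]| + #|[pred i : 'I_N | R (inr (i : nat))]|)%N.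
Proof.
rewrite -!sum1_card big_split_ord/=; congr (_ + _)%N; apply: eq_bigl => i; rewrite !inE /idx.
  by case: fintype.splitP => j /= ij; [rewrite ij|exfalso; have := ltn_ord i; lia].
by case: fintype.splitP => j /= ij; [exfalso; have := ltn_ord j; lia|congr (R (inr _)); lia].
Qed.

Lemma card_ord_lt N m : (m <= N)%N -> #|[pred i : 'I_N | (i < m)%N]| = m.
Proof.
move=> mN; rewrite -sum1_card -[in RHS](card_ord m) -sum1_card.
by rewrite (big_ord_widen N (fun=> 1%N) mN).
Qed.

Lemma rank_Vs N m : (m <= N)%N -> \rank (lev N (Vs m)) = (N + m)%N.
Proof.
move=> mN; rewrite rank_lev_coord card_idx/= card_ord_lt// addnC; congr (_ + _)%N.
by rewrite cardT size_enum_ord.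
Qed.

Lemma rank_Us N m : (m <= N)%N -> \rank (lev N (Us m)) = (N - m)%N.
Proof.
move=> mN; rewrite rank_lev_coord card_idx/= card0 add0n.
have := cardC [pred i : 'I_N | (i < m)%N]; rewrite card_ord_lt// card_ord => E.
rewrite -[in RHS]E addKn; apply: eq_card => i; by rewrite !inE leqNgt.
Qed.

End Coordinates.

(** * Semi-infinite subspaces at finite levels *)

Section Transversality.
Variable F : finFieldType.
Local Notation E := (E F).
Implicit Types M A B : set E.
Local Arguments ecoord : simpl never.

(** Every semi-infinite M satisfies this for large m. The intersection of M with V_m
    is then faithfully recorded by the level m, and outside V_m the subspace M
    fills the whole quotient by V_m, as all semi-infinite subspaces do in the end. *)
Definition transverse m M :=
  (forall x, M x -> Us m x -> x = 0) /\ (forall x, exists2 y, M y & Vs m (x - y)).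

Lemma transverse_le m n M : (m <= n)%N -> transverse m M -> transverse n M.
Proof.
move=> mn [M1 M2]; split; first by move=> x Mx xU; apply: M1 => //; exact: Us_le xU.
by move=> x; have [y My xy] := M2 x; exists y => //; exact: Vs_le xy.
Qed.

Lemma quot_dim_lev N A B n : is_subspace A -> is_subspace B ->
  A `<=` B -> B `<=` Vs N -> (forall x, B x -> Us N x -> A x) ->
  quot_dim A B n <-> \rank (lev N B) = (\rank (lev N A) + n)%N.
Proof.
move=> sA sB AB BV BUA; apply: (@quot_dim_rank _ _ _ _ _ (prj N)) => //.
- exact: levS.
- by move=> x Bx; apply: lev_sub => //; exact: BV.
- move=> y /levP -/(_ sB) [x [Bx Vx xy]]; exists x => //.
  by rewrite /= xy subrr sub0mx.
- move=> x Bx; split => [Ax|/levP -/(_ sA)[x' [Ax' Vx' xx']]].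
    by apply: lev_sub => //; exact: BV.
  apply/(subspaceBr sA x Ax')/BUA; last exact: Us_subprj (BV _ Bx) Vx' (esym xx').
  by apply: (subspaceB sB Bx); exact: AB.
Qed.

Lemma set0_subspace : is_subspace [set (0%R : E)].
Proof. by split => // a x y -> ->; rewrite /= scaler0 addr0. Qed.

Lemma rank_lev0 N : \rank (lev N [set (0%R : E)]) = 0%N.
Proof.
apply/eqP; rewrite mxrank_eq0; apply/rowV0P => y /levP -/(_ set0_subspace)[x [-> _ <-]].
by rewrite linear0.
Qed.

(** Passing to levels commutes with this intersection because U_N lies in V_m. *)
Lemma levI_Vs m N M : (m <= N)%N -> is_subspace M ->
  (lev N (M `&` Vs m) :=: lev N M :&: lev N (Vs m))%MS.
Proof.
move=> mN sM; have sMV := subspaceI sM (Vs_sub F m).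
apply: lev_ext => // y; rewrite sub_capmx; split.
  move=> /andP[/levP -/(_ sM)[x [Mx Vx <-]] /levP -/(_ (Vs_sub F m))[x' [Vx' V'x' xx']]].
  exists x; split => //; split => //.
  have := Us_subprj Vx V'x' (esym xx') => /(@UsVs F N m).
  by move/(subspaceBr (Vs_sub F m) _ Vx').
move=> [x [[Mx Vmx] Vx <-]]; apply/andP; split; apply: lev_sub => //.
exact: Vs_sub.
Qed.

Lemma transverse_lev_full m N M : (m <= N)%N -> is_subspace M -> transverse m M ->
  row_full (lev N M + lev N (Vs m))%MS.
Proof.
move=> mN sM [_ M2]; rewrite -sub1mx; apply/rV_subP => y _.
have [x Mx Vx] := M2 (emb y).
have V1 : Vs N (emb y - x) := Vs_le mN Vx.
have V2 : Vs N x.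
  by rewrite -(opprB x) in V1; have := subspaceN (Vs_sub F N) V1;
    rewrite opprK => /(subspaceBr (Vs_sub F N) x (@emb_Vs _ _ y)).
rewrite -[y](prj_emb (F:=F)) -(subrK x (emb y)) linearD/= addrC.
by apply: addmx_sub_adds; apply: lev_sub => //; exact: Vs_sub.
Qed.

(** The levels N of M and of V_m span F^(2N), and they meet in the level N of the
    intersection of M and V_m, whose rank does not depend on N >= m since that
    intersection contains no vector of U_m. The dimension formula concludes. *)
Lemma transverse_rank_step m N M : (m <= N)%N -> is_subspace M -> transverse m M ->
  \rank (lev N M) = (\rank (lev m M) + (N - m))%N.
Proof.
move=> mN sM gM; have full := transverse_lev_full mN sM gM.
have := mxrank_sum_cap (lev N M) (lev N (Vs m)).
rewrite (eqP full) rank_Vs// -(levI_Vs mN sM).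
have sMV := subspaceI sM (Vs_sub F m).
have q k : (m <= k)%N -> quot_dim [set (0%R : E)] (M `&` Vs m) (\rank (lev N (M `&` Vs m))) <->
    \rank (lev k (M `&` Vs m)) = (\rank (lev k [set (0%R : E)]) + (\rank (lev N (M `&` Vs
      m))))%N.
  move=> mk; apply: quot_dim_lev => //; first exact: set0_subspace.
  - by move=> _ ->; exact: subspace0.
  - by move=> x [_ /(Vs_le mk)].
  - by move=> x [Mx _] /(Us_le mk) Ux; apply: gM.1.
have qN := (q _ mN).2; rewrite rank_lev0 add0n in qN.
have := (q _ (leqnn m)).1 (qN erefl); rewrite rank_lev0 add0n => <-.
rewrite (_ : lev m (M `&` Vs m) = lev m M); first by lia.
apply: eq_lev => // y; split => -[x [H1 H2 H3]]; exists x; split => //.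
by case: H1.
Qed.

Lemma rvmulE (x : E) T N j : (forall i, (N <= i)%N -> ecoord x (inl i) = 0) ->
  rvmul x.1 T j = \sum_(i < N) ecoord x (inl (i : nat)) * T i j.
Proof.
move=> x0; rewrite /rvmul (@fsbigE _ _ _ _ _ (iota 0 N)) ?iota_uniq//; last first.
  move=> i _; rewrite mem_iota add0n -leqNgt => /x0 E0.
  by rewrite (_ : val x.1 i = 0)// mul0r.
rewrite -(big_mkord xpredT (fun i => ecoord x (inl i) * T i j)) /index_iota subn0.
by apply: eq_bigl => i; rewrite in_setT.
Qed.

Lemma graphP T (x : E) : graph T x <-> forall j, ecoord x (inr j) = rvmul x.1 T j.
Proof.
split => [[v _ <-] j//|H]; exists x.1 => //.
by case: x H => v w H; congr pair; apply/funext => j; rewrite -H.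
Qed.

Lemma graph_subspace T : @is_subspace F E (graph T).
Proof.
split; first by apply/graphP => j; rewrite ecoord0 (@rvmulE 0 T 0) ?big_ord0// => i _;
  rewrite ecoord0.
move=> a x y /graphP xg /graphP yg; apply/graphP => j; rewrite ecoordP xg yg.
have [N Nx] := ell_finsupp x; have [N' Ny] := ell_finsupp y.
set K := maxn N N'.
have Kx i : (K <= i)%N -> ecoord x (inl i) = 0 by move=> Ki; apply: Nx;
  exact: leq_trans (leq_maxl _ _) Ki.
have Ky i : (K <= i)%N -> ecoord y (inl i) = 0 by move=> Ki; apply: Ny;
  exact: leq_trans (leq_maxr _ _) Ki.
rewrite (rvmulE _ _ Kx) (rvmulE _ _ Ky) (@rvmulE (a *: x + y) T K) => [|i Ki]; last first.
  by rewrite ecoordP Kx// Ky// mulr0 addr0.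
rewrite big_distrr -big_split; apply: eq_bigr => i _.
by rewrite ecoordP mulrDl -mulrA.
Qed.

Lemma graph_transverse0 T : transverse 0 (graph T : set E).
Proof.
split => [x /graphP xg xU|x].
  apply: ecoord_inj => -[i|j]; rewrite ecoord0; first exact: xU.
  rewrite xg (@rvmulE x T 0) ?big_ord0// => i _; exact: xU.
exists ((x.1, rvmul x.1 T) : E); first by exists x.1.
by move=> [i _|i /negP[]//]; rewrite ecoordB subrr.
Qed.

Lemma graph_rank T m : \rank (lev m (graph T : set E)) = m.
Proof.
rewrite (transverse_rank_step (leq0n m) (graph_subspace T) (graph_transverse0 T)) subn0.
by have := rank_leq_row (lev 0 (graph T)); rewrite leqn0 => /eqP ->.
Qed.

Lemma nonzero_notUs (x : E) : x != 0 -> exists n, ~ Us n x.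
Proof.
move=> x0; apply: contrapT => H; case/negP: x0; apply/eqP/Us_all => n.
by exists n => //; apply: contrapT => nU; apply: H; exists n.
Qed.

(** Take a graph L that is commensurable with M, and let m exceed the e-parts of
    representatives of M and of L modulo their intersection. A vector of M in U_0
    is determined by its class modulo L, as L meets U_0 trivially; there are
    finitely many classes, so M meets U_m trivially once m is large. The rank is
    m for the graph L, and the two quotients account for the difference. *)
Lemma Gr_eventually j M : Gr j M ->
  exists m0, forall m, (m0 <= m)%N -> transverse m M /\ (\rank (lev m M))%:Z = m%:Z + j.
Proof.
move=> [sM [T [m' [n' [[b [Mb bP]] [b' [gb' bP']] ->]]]]].
have sG := graph_subspace T; have [G1 G2] := graph_transverse0 T.
have sD := subspaceI sG sM.
pose comb n (v : 'I_n -> E) (c : 'rV[F]_n) := \sum_(i < n) c ord0 i *: v i.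
(* At most one vector of M in U_0 has class c, and it is not in U_(nc c). *)
have /choice[nc ncP] : forall c : 'rV[F]_m', exists n, forall x, M x -> Us 0 x -> x != 0 ->
    (graph T `&` M) (x - comb _ b c) -> ~ Us n x.
  move=> c; have [[x [Mx Ux x0 Dx]]|no] := pselect (exists x, [/\ M x, Us 0 x,
    x != 0 & (graph T `&` M) (x - comb _ b c)]).
    have [n nP] := nonzero_notUs x0; exists n => x' Mx' Ux' _ Dx'.
    suff -> : x' = x by [].
    apply/eqP; rewrite -subr_eq0; apply/eqP; apply: G1.
      have -> : x' - x = (x' - comb _ b c) - (x - comb _ b c) by rewrite opprB addrA subrK.
      by apply: (subspaceB sG); [exact: Dx'.1|exact: Dx.1].
    exact: (subspaceB (Us_sub F 0) Ux' Ux).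
  by exists 0%N => x Mx Ux x0 Dx; exfalso; apply: no; exists x.
have [N1 N1P] := Vs_bigex b; have [N2 N2P] := Vs_bigex b'.
exists (maxn (\max_c nc c) (maxn N1 N2)) => m; rewrite !geq_max => /and3P[ncm N1m N2m].
have Vb i : Vs m (b i) := Vs_le N1m (N1P i).
have Vb' i : Vs m (b' i) := Vs_le N2m (N2P i).
have Vcomb n (v : 'I_n -> E) c : (forall i, Vs m (v i)) -> Vs m (comb n v c).
  by move=> Vv; apply: (subspace_sum (Vs_sub F m)) => i _; apply: (subspaceZ (Vs_sub F m)).
have gM : transverse m M.
  split => [x Mx Ux|x].
    apply/eqP/negPn/negP => x0; have [c [Dc _]] := bP _ Mx.
    apply: (ncP c x) => //; first exact: Us_le Ux.
    apply: Us_le Ux; apply: leq_trans ncm; exact: (leq_bigmax (F := nc)).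
  have [y Gy Vy] := G2 x; have [c [Dc _]] := bP' _ Gy.
  exists (y - comb _ b' c); first exact: Dc.2.
  rewrite opprB addrCA; apply: (subspaceD (Vs_sub F m)); first exact: Vcomb.
  exact: Vs_le Vy.
split => //.
have qd n (v : 'I_n -> E) B : is_subspace B -> transverse m B -> graph T `&` M `<=` B ->
   (forall i, B (v i)) -> (forall i, Vs m (v i)) ->
   (forall x, B x -> exists! c : 'rV[F]_n, (graph T `&` M) (x - comb _ v c)) ->
   \rank (lev m B) = (\rank (lev m (graph T `&` M)) + n)%N.
  move=> sB gB DB Bv Vv vP.
  have levE (X : set E) : is_subspace X -> lev m (X `&` Vs m) = lev m X.
    move=> sX; apply: eq_lev => //; first exact: (subspaceI sX (Vs_sub F m)).
    by move=> y; split => -[x [H1 H2 H3]]; exists x; split => //; case: H1.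
  rewrite -(levE B)// -(levE (graph T `&` M))//.
  apply/quot_dim_lev; try by apply: subspaceI => //; exact: Vs_sub.
  - by move=> x [/DB].
  - by move=> x [].
  - move=> x [Bx Vx] Ux; rewrite (gB.1 x Bx Ux).
    by split; [exact: subspace0|exact: (subspace0 (Vs_sub F m))].
  exists v; split; first by move=> i; split.
  move=> x [Bx Vx]; have [c [Dc cu]] := vP _ Bx; exists c; split.
    by split => //; apply: (subspaceB (Vs_sub F m)) => //; exact: Vcomb.
  by move=> c' [/cu].
have r1 := qd _ b M sM gM (@subIsetr _ _ _) Mb Vb bP.
have r2 := qd _ b' _ sG (transverse_le (leq0n m) (graph_transverse0 T)) (@subIsetl _ _ _)
  gb' Vb' bP'.
by rewrite graph_rank in r2; lia.
Qed.

Section ExtendByBasis.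
Variable y : nat -> E.
Definition ebound (x : E) : nat := projT1 (cid (ell_finsupp x)).

(** The linear map sending e_i to [y i] and killing the f_j. The sum may be cut at
    any bound of the e-part of x; [ebound] picks one. *)
Definition elift (x : E) : E := \sum_(i < ebound x) ecoord x (inl (i : nat)) *: y i.

Lemma eliftE x N : (forall i, (N <= i)%N -> ecoord x (inl i) = 0) ->
  elift x = \sum_(i < N) ecoord x (inl (i : nat)) *: y i.
Proof.
have aux (M M' : nat) : (M <= M')%N -> (forall i, (M <= i)%N -> ecoord x (inl i) = 0) ->
    \sum_(i < M) ecoord x (inl (i : nat)) *: y i = \sum_(i < M') ecoord x (inl (i : nat))
      *: y i.
  move=> MM' xM; rewrite (big_ord_widen M' (fun i => ecoord x (inl i) *: y i) MM').
  rewrite [LHS]big_mkcond; apply: eq_bigr => i _; case: ifPn => //; rewrite -leqNgt => /xM ->.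
  by rewrite scale0r.
move=> xN; rewrite /elift; have xB := projT2 (cid (ell_finsupp x)); rewrite -/(ebound x) in xB.
by have [le|/ltnW le] := leqP (ebound x) N; [apply: aux|apply/esym/aux].
Qed.

Lemma elift_linear : linear elift.
Proof.
move=> a u v; have [N Nu] := ell_finsupp u; have [N' Nv] := ell_finsupp v.
set K := maxn N N'.
have Ku i : (K <= i)%N -> ecoord u (inl i) = 0 by move=> Ki; apply: Nu;
  exact: leq_trans (leq_maxl _ _) Ki.
have Kv i : (K <= i)%N -> ecoord v (inl i) = 0 by move=> Ki; apply: Nv;
  exact: leq_trans (leq_maxr _ _) Ki.
rewrite (eliftE Ku) (eliftE Kv) (@eliftE _ K) => [|i Ki]; last first.
  by rewrite ecoordP Ku// Kv// mulr0 addr0.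
rewrite scaler_sumr -big_split; apply: eq_bigr => i _.
by rewrite ecoordP scalerDl scalerA.
Qed.
HB.instance Definition _ := GRing.isLinear.Build F E E _ elift elift_linear.
End ExtendByBasis.

Definition ell_rows : pred (nat + nat) := fun k => if k is inl _ then true else false.
Definition ell_space : set E := coord_space ell_rows.

Lemma ell_space_Us0 N x : ell_space x -> Us N x -> x = 0.
Proof. by move=> xe xU; apply: ecoord_inj => -[i|i]; rewrite ecoord0;
  [exact: xU|exact: xe]. Qed.

Lemma rank_ell_space N : \rank (lev N ell_space) = N.
Proof.
rewrite rank_lev_coord card_idx/= card0 addn0 cardT size_enum_ord//.
Qed.

(** For i >= m, transversality yields [y i] in M congruent to e_i modulo V_m, and
    these lifts span the part of a graph with i-th row the f-part of [y i], the
    rows below m being 0. Modulo the span of the lifts, M is its level m and the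
    graph is the level m of ell, so that the relative dimension is the difference
    of the two ranks. *)
Lemma Gr_intro j m M : is_subspace M -> transverse m M ->
  (\rank (lev m M))%:Z = m%:Z + j -> Gr j M.
Proof.
move=> sM gM rM; split => //.
have /choice[y yP] : forall i, exists y : E, (i < m)%N /\ y = 0 \/
    [/\ (m <= i)%N, M y & Vs m (edelta F (inl i) - y)].
  move=> i; have [im|mi] := ltnP i m; first by exists 0; left.
  by have [y My Vy] := gM.2 (edelta F (inl i)); exists y; right.
have y0 i : (i < m)%N -> y i = 0 by move=> im; case: (yP i) => [[]//|[mi]]; lia.
have My i : M (y i) by case: (yP i) => [[_ ->]|[]//]; exact: subspace0.
have ydelta i k : (m <= i)%N -> (m <= k)%N -> ecoord (y i) (inl k) = (k == i)%:R.
  move=> mi mk; case: (yP i) => [[]|[_ _ /(_ (inl k))]]; first by lia.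
  by rewrite /= -leqNgt ecoordB edeltaE => /(_ mk)/subr0_eq ->.
pose T i j := ecoord (y i) (inr j).
have sG := @graph_subspace T.
(* S x lies in M and in the graph of T, and the remainder p x lies in V_m. *)
pose S := elift y; pose p x := x - S x.
have MS x : M (S x).
  by apply: (subspace_sum sM) => i _; apply: (subspaceZ sM).
have Se x k : (m <= k)%N -> ecoord (S x) (inl k) = ecoord x (inl k).
  move=> mk; have [N Nx] := ell_finsupp x; rewrite /S (@eliftE _ _ (maxn N k.+1)).
    rewrite ecoord_sum (bigD1 (Ordinal (leq_maxr N k.+1)))//= ecoordZ ydelta// eqxx mulr1.
    rewrite big1 ?addr0// => i ik; rewrite ecoordZ; have [im|mi] := ltnP i m.
      by rewrite y0// ecoord0 mulr0.
    rewrite ydelta// (_ : _ == _ = false) ?mulr0//; apply: contraNF ik => /eqP ki.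
    by apply/eqP/val_inj.
  by move=> i; rewrite geq_max => /andP[/Nx].
have Gs x : graph T (S x).
  apply/graphP => l; have [N Nx] := ell_finsupp x.
  have Kx i : (maxn m N <= i)%N -> ecoord x (inl i) = 0.
    by rewrite geq_max => /andP[_ /Nx].
  rewrite (@rvmulE (S x) T (maxn m N)) => [|i Ki]; last first.
    by rewrite Se ?Kx//; move: Ki; rewrite geq_max => /andP[].
  rewrite /S (eliftE y Kx) ecoord_sum; apply: eq_bigr => i _; rewrite -(eliftE y Kx).
  rewrite ecoordZ /T; have [im|mi] := ltnP i m; first by rewrite y0// ecoord0 !mulr0.
  by rewrite -/(S x) Se.
have Vp x : Vs m (p x).
  by move=> [i|i]//=; rewrite -leqNgt ecoordB => mi; rewrite Se// subrr.
have pV x : Vs m x -> p x = x.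
  move=> Vx; rewrite /p /S (@eliftE _ _ m) => [|i mi]; last first.
    by apply: Vx; rewrite /= -leqNgt.
  by rewrite big1 ?subr0// => i _; rewrite y0// scaler0.
have Ge x : graph T x -> Vs m x -> ell_space x.
  move=> /graphP xG Vx [i|l]//= _; rewrite xG (@rvmulE x T m) => [|i mi]; last first.
    by apply: Vx; rewrite /= -leqNgt.
  by rewrite big1// => i _; rewrite /T y0// ecoord0 mulr0.
have eG x : ell_space x -> Vs m x -> graph T x.
  move=> xe Vx; apply/graphP => l; rewrite xe// (@rvmulE x T m) => [|i mi]; last first.
    by apply: Vx; rewrite /= -leqNgt.
  by rewrite big1// => i _; rewrite /T y0// ecoord0 mulr0.
have sE : is_subspace ell_space by exact: coord_space_subspace.
have sa := subspaceI sM sE.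
pose q x := prj m (p x).
have qlin : linear q.
  by move=> a u v; rewrite /q /p /S linearP opprD addrACA -scalerBr linearP.
pose Q : {linear E -> 'rV[F]_(m + m)} := HB.pack q (GRing.isLinear.Build F E _ _ q qlin).
have aM : (lev m (M `&` ell_space) <= lev m M)%MS by apply: levS => // x [].
have ae : (lev m (M `&` ell_space) <= lev m ell_space)%MS by apply: levS => // x [].
have rE := rank_ell_space m.
exists T, (\rank (lev m M) - \rank (lev m (M `&` ell_space)))%N,
  (m - \rank (lev m (M `&` ell_space)))%N.
have la := mxrankS aM; have le := mxrankS ae; rewrite rE in le.
split; last by lia.
- apply: (@quot_dim_rank _ _ _ _ _ Q (lev m (M `&` ell_space)) (lev m M) _ _ _ _ _ _).2 => //.
  + by move=> x Mx; apply: lev_sub => //; exact: (subspaceB sM).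
  + move=> u /levP -/(_ sM)[x [Mx Vx xu]]; exists x => //.
    by rewrite /Q /= /q pV// xu subrr sub0mx.
  + move=> x Mx; have Mpx : M (p x) by exact: (subspaceB sM).
    split => [[Gx _]|/levP -/(_ sa)[x' [[Mx' ex'] Vx' xx']]].
      apply: lev_sub => //; split => //; apply: Ge => //; exact: (subspaceB sG).
    split => //.
    have E : p x - x' = 0.
      by apply: gM.1; [exact: (subspaceB sM)|apply: Us_subprj => //; rewrite xx'].
    by apply/(subspaceBr sG x (Gs x)); rewrite -/(p x) (subr0_eq E); exact: eG.
  + by rewrite subnKC.
- apply: (@quot_dim_rank _ _ _ _ _ Q (lev m (M `&` ell_space)) (lev m ell_space) _ _ _ _ _
  _).2 => //.
  + by move=> x Gx; apply: lev_sub => //; apply: Ge => //; exact: (subspaceB sG).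
  + move=> u /levP -/(_ sE)[x [ex Vx xu]]; exists x; first exact: eG.
    by rewrite /Q /= /q pV// xu subrr sub0mx.
  + move=> x Gx; have Gpx : graph T (p x) by exact: (subspaceB sG).
    split => [[_ Mx]|/levP -/(_ sa)[x' [[Mx' ex'] Vx' xx']]].
      by apply: lev_sub => //; split; [exact: (subspaceB sM)|exact: Ge].
    split => //.
    have E : p x - x' = 0.
      apply: (@ell_space_Us0 m); first by apply: (subspaceB sE) => //; exact: Ge.
      by apply: Us_subprj => //; rewrite xx'.
    by apply/(subspaceBr sM x (MS x)); rewrite -/(p x) (subr0_eq E).
  + by rewrite subnKC// rE.
Qed.

Lemma Gr_inj i j M : Gr i M -> Gr j M -> i = j.
Proof.
move=> /Gr_eventually[m1 H1] /Gr_eventually[m2 H2].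
have [_ E1] := H1 _ (leq_maxl m1 m2); have [_ E2] := H2 _ (leq_maxr m1 m2).
by move: E2; rewrite E1 => /addrI.
Qed.

Lemma Gr_transverse_rank j m M : Gr j M -> transverse m M -> (\rank (lev m M))%:Z = m%:Z + j.
Proof.
move=> GM gM; have [m0 H] := Gr_eventually GM.
have [_] := H _ (leq_maxl m0 m).
by rewrite (transverse_rank_step (leq_maxr m0 m) GM.1 gM); have := leq_maxr m0 m; lia.
Qed.

End Transversality.

(** * Charts *)

Lemma ptws_discrete_nbhs (I : eqType) (D : choiceType) (f : {ptws I -> discrete_topology D})
    (A : set {ptws I -> discrete_topology D}) :
  nbhs f A <-> exists s : seq I, forall g : I -> D, (forall i, i \in s -> g i = f i) -> A g.
Proof.
split; last first.
  move=> [s sA].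
  have nf := nbhs_filter f.
  have H : nbhs f [set g : {ptws I -> discrete_topology D} | forall i, i \in s -> g i = f i].
    elim: s {sA} => [|i s IH].
      by apply: (@filterS _ _ nf setT) => [g _ i|]; [rewrite in_nil|exact: (@filterT _ _ nf)].
    have H : nbhs f ((fun g : {ptws I -> discrete_topology D} => g i) @^-1` [set f i]).
      have := @proj_continuous I (fun=> (discrete_topology D : topologicalType)) i f [set f i].
      by apply.
    have := @filterI _ _ nf _ _ H IH; apply: (@filterS _ _ nf) => g [gi gs] k.
    by rewrite inE => /predU1P[->|/gs].
  by apply: (@filterS _ _ nf) H => g; exact: sA.
pose G : set_system {ptws I -> discrete_topology D} :=
  [set B | exists s : seq I, forall g : I -> D, (forall i, i \in s -> g i = f i) -> B g].
have FG : Filter G.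
  split; first by exists [::].
    move=> P Q [s sP] [t tQ]; exists (s ++ t) => g gst; split.
      by apply: sP => i si; apply: gst; rewrite mem_cat si.
    by apply: tQ => i si; apply: gst; rewrite mem_cat si orbT.
  by move=> P Q PQ [s sP]; exists s => g /sP /PQ.
suff : G --> f by apply.
apply/cvg_sup => i B /= [_ [[C _ <-]] /= Cf CB].
by exists [:: i] => g /(_ i (mem_head _ _)) gi; apply: CB => /=; rewrite gi.
Qed.

Section Charts.
Variables (F : finFieldType) (Omega Xi : {fset nat}).
Local Notation E := (E F).
Local Arguments ecoord : simpl never.
Local Notation R := (chart_row Omega Xi).
Local Notation row := {k | chart_row Omega Xi k}.
Local Notation col := {k | ~~ chart_row Omega Xi k}.
Local Notation cmx := (chart_matrix F Omega Xi).
Implicit Types (M : set E) (T : cmx).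

Definition chart_bound m := (forall i, i \in Omega -> (i < m)%N) /\ (forall i, i \in Xi ->
  (i < m)%N).

Lemma chart_bound_ex : exists m, chart_bound m.
Proof.
have b (A : {fset nat}) : exists m, forall i, i \in A -> (i < m)%N.
  exists (\max_(i <- enum_fset A) i).+1 => i iA; rewrite ltnS.
  exact: (@leq_bigmax_seq _ (enum_fset A) xpredT id i iA isT).
have [m1 H1] := b Omega; have [m2 H2] := b Xi; exists (maxn m1 m2); split => i.
  by move/H1 => h; apply: leq_trans h (leq_maxl _ _).
by move/H2 => h; apply: leq_trans h (leq_maxr _ _).
Qed.

Lemma chart_bound_le m n : (m <= n)%N -> chart_bound m -> chart_bound n.
Proof. by move=> mn [H1 H2]; split => i => [/H1|/H2] h; exact: leq_trans h mn. Qed.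

Local Notation W := (@chartW F Omega Xi).

Lemma chartW_subspace : is_subspace W. Proof. exact: coord_space_subspace. Qed.

Lemma chartW_Vs m : chart_bound m -> W `<=` Vs m.
Proof.
move=> [H _]; apply: coord_spaceS => -[i|i]//=; rewrite negbK; exact: H.
Qed.

Lemma chartW_Us m : chart_bound m -> Us m `<=` W.
Proof.
move=> [_ H]; apply: coord_spaceS => -[i|i]//= mi; apply/negP => /H; lia.
Qed.

Lemma row_low m (x : E) k : chart_bound m -> Vs m x -> R k -> ~~ low m k -> ecoord x k = 0.
Proof.
by move=> [_ H] Vx Rk nk; case: k Rk nk => [i|i] Ri ni; [exact: Vx|case/negP: ni; exact: H].
Qed.

(** A finite list of rows, outside of which a vector with row part supported below N
    contributes nothing to [rowsum]. *)
Definition rowseq N : seq row := pmap insub (codom (@idx N)).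

Lemma rowseq_uniq N : uniq (rowseq N).
Proof. by apply: pmap_sub_uniq; rewrite map_inj_uniq ?enum_uniq//; exact: idx_inj. Qed.

Lemma mem_rowseq N (r : row) : (r \in rowseq N) = low N (val r).
Proof.
rewrite mem_pmap_sub; apply/codomP/idP => [[i ->]|/lowP[i ->]]; last by exists i.
exact: low_idx.
Qed.

Definition colseq N : seq col := pmap insub (codom (@idx N)).

Lemma mem_colseq N (c : col) : (c \in colseq N) = low N (val c).
Proof.
rewrite mem_pmap_sub; apply/codomP/idP => [[i ->]|/lowP[i ->]]; last by exists i.
exact: low_idx.
Qed.

Definition rowsum T (x : E) (c : col) : F :=
  \sum_(r \in [set: row]) ecoord x (val r) * T (r, c).

Lemma rowsumE N T x c : (forall k, R k -> ~~ low N k -> ecoord x k = 0) ->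
  rowsum T x c = \sum_(r <- rowseq N) ecoord x (val r) * T (r, c).
Proof.
move=> x0; rewrite /rowsum (@fsbigE _ _ _ _ _ (rowseq N)) ?rowseq_uniq//; last first.
  by move=> r _; rewrite mem_rowseq => nr; rewrite x0 ?mul0r//; exact: (valP r).
by apply: eq_bigl => r; rewrite in_setT.
Qed.

Lemma row_support (x : E) : exists N, forall k, R k -> ~~ low N k -> ecoord x k = 0.
Proof.
have [m mb] := chart_bound_ex; have [N Vx] := Vs_ex x.
exists (maxn m N) => k Rk nk; apply: (row_low (m := maxn m N)) => //.
  exact: chart_bound_le (leq_maxl _ _) mb.
exact: Vs_le (leq_maxr _ _) _ Vx.
Qed.

Lemma eq_rowsum T x y c : (forall k, R k -> ecoord x k = ecoord y k) ->
  rowsum T x c = rowsum T y c.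
Proof. by move=> xy; apply: eq_fsbigr => r _; rewrite xy//; exact: (valP r). Qed.

Lemma rowsum0 T x c : (forall k, R k -> ecoord x k = 0) -> rowsum T x c = 0.
Proof. by move=> x0; apply: fsbig1 => r _; rewrite x0 ?mul0r//; exact: (valP r). Qed.

Lemma rowsumP T a x y c : rowsum T (a *: x + y) c = a * rowsum T x c + rowsum T y c.
Proof.
have [N Nx] := row_support x; have [N' Ny] := row_support y.
set K := maxn N N'.
have Kx k : R k -> ~~ low K k -> ecoord x k = 0.
  by move=> Rk nk; apply: Nx => //; apply: contra nk; exact: low_le (leq_maxl _ _).
have Ky k : R k -> ~~ low K k -> ecoord y k = 0.
  by move=> Rk nk; apply: Ny => //; apply: contra nk; exact: low_le (leq_maxr _ _).
rewrite (rowsumE _ _ Kx) (rowsumE _ _ Ky) (@rowsumE K) => [|k Rk nk]; last first.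
  by rewrite ecoordP Kx// Ky// mulr0 addr0.
rewrite big_distrr -big_split; apply: eq_bigr => r _.
by rewrite ecoordP mulrDl -mulrA.
Qed.

Lemma vector_of_rows (x : E) (f : col -> F) : exists y : E,
  (forall k, R k -> ecoord y k = ecoord x k) /\ (forall c : col, ecoord y (val c) = f c).
Proof.
have [m mb] := chart_bound_ex; have [N Vx] := ell_finsupp x.
pose g k := if insub k is Some c then f c else ecoord x k.
have [y yg] : exists y : E, forall k, ecoord y k = g k.
  apply: (@vector_of_coords _ _ (maxn m N)) => i; rewrite geq_max => /andP[mi Ni].
  rewrite /g; case: insubP => [c nc ci|_]; last exact: Vx.
  by exfalso; move: nc; rewrite /= negbK => /mb.1; lia.
exists y; split => [k Rk|c]; rewrite yg /g; first by rewrite insubN ?Rk.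
by rewrite valK.
Qed.

Lemma chart_graphP T x : chart_graph T x <-> forall c : col, ecoord x (val c) = rowsum T x c.
Proof.
split => [[v [w [Vv Ww wc ->]]] c|xc].
  have -> : ecoord (v + w) (val c) = ecoord w (val c).
    by rewrite ecoordD Vv ?add0r//; exact: (valP c).
  rewrite wc; apply: eq_rowsum => k Rk.
  by rewrite ecoordD Ww ?addr0//= negbK.
have [v [v1 v2]] := vector_of_rows x (fun=> 0).
exists v, (x - v); split.
- by move=> k nk; rewrite -(v2 (exist _ k nk)).
- by move=> k /=; rewrite negbK => Rk; rewrite ecoordB v1// subrr.
- move=> c; rewrite ecoordB v2 subr0 xc; apply: eq_rowsum => k Rk.
  by rewrite v1.
- by rewrite addrC subrK.
Qed.

Lemma chart_graph_subspace T : is_subspace (chart_graph T).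
Proof.
split; first by apply/chart_graphP => c; rewrite ecoord0 rowsum0// => k _; rewrite ecoord0.
move=> a x y /chart_graphP xT /chart_graphP yT; apply/chart_graphP => c.
by rewrite ecoordP rowsumP xT yT.
Qed.

Lemma chart_graph_point T x : exists2 y, chart_graph T y & forall k, R k ->
  ecoord y k = ecoord x k.
Proof.
have [y [y1 y2]] := vector_of_rows x (rowsum T x); exists y => //.
by apply/chart_graphP => c; rewrite y2; apply: eq_rowsum => k /y1.
Qed.

Definition agree_upto m T T' := forall r c, low m (val r) -> low m (val c) ->
  T (r, c) = T' (r, c).

(** When m bounds Omega and Xi, the row part of a vector of V_m is supported below
    m, so its column coordinates below m involve the corresponding corner of the
    matrix alone. *)
Lemma agree_upto_lev m T T' : chart_bound m -> agree_upto m T T' ->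
  lev m (chart_graph T) = lev m (chart_graph T').
Proof.
move=> mb; wlog suff aux : T T' / agree_upto m T T' ->
    forall y : 'rV[F]_(m + m), (exists x, [/\ chart_graph T x, Vs m x & prj m x = y]) ->
    (exists x, [/\ chart_graph T' x, Vs m x & prj m x = y]).
  move=> TT'; apply: eq_lev => [||y]; try exact: chart_graph_subspace.
  by split; apply: aux => // r c rm cm; rewrite TT'.
move=> TT' y [x [Tx Vx <-]].
have [x' T'x' xx'] := chart_graph_point T' x.
have V' : Vs m x'.
  move=> [i|i]//= im; rewrite xx' ?Vx//=; apply/negP => /mb.1; lia.
exists x'; split => //; apply/prjP => k km.
have [Rk|nRk] := boolP (R k); first exact: xx'.
move/chart_graphP: T'x' => /(_ (exist _ k nRk)) /= ->.
move/chart_graphP: Tx => /(_ (exist _ k nRk)) /= ->.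
rewrite (eq_rowsum _ _ xx') !(@rowsumE m); try by move=> *; apply: row_low mb Vx _ _.
rewrite big_seq [RHS]big_seq; apply: eq_bigr => r; rewrite mem_rowseq => rm.
by rewrite TT'.
Qed.

(** The entry (r, c) is the coordinate c of the point of the graph above the basis
    vector of index r. This point lies in V_m, and a point of the other graph with
    the same coordinates below m has the same row part. *)
Lemma lev_agree_upto m T T' : chart_bound m ->
  lev m (chart_graph T) = lev m (chart_graph T') -> agree_upto m T T'.
Proof.
move=> mb TT' r c rm cm.
have rsE T0 x : (forall k, R k -> ecoord x k = (k == val r)%:R) -> rowsum T0 x c = T0 (r, c).
  move=> xr; rewrite (@rowsumE m) => [|k Rk nk]; last first.
    by rewrite xr//; case: eqP nk => // ->; rewrite rm.
  rewrite (bigD1_seq r) ?rowseq_uniq ?mem_rowseq//=.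
  rewrite xr ?eqxx ?mul1r; last exact: (valP r).
  rewrite big1 ?addr0// => s sr; rewrite xr; last exact: (valP s).
  by rewrite (_ : _ == _ = false) ?mul0r//; apply: contraNF sr => /eqP kr; apply/eqP/val_inj.
have [x Tx xr] := chart_graph_point T (edelta F (val r)).
have xr' k : R k -> ecoord x k = (k == val r)%:R by move/xr; rewrite edeltaE.
have Vx : Vs m x.
  move=> [i|i]//= im; have Ri : R (inl i) by apply/negP => /mb.1; lia.
  by rewrite xr'//; case: eqP rm => // <- /=; lia.
have := lev_sub (chart_graph_subspace T) Tx Vx; rewrite TT' => /levP.
move=> /(_ (chart_graph_subspace T')) [x' [T'x' Vx' /prjP xx']].
move/chart_graphP: (Tx) => /(_ c); rewrite rsE// => <-.
rewrite -(xx' _ cm); move/chart_graphP: T'x' => /(_ c) ->; rewrite rsE// => k Rk.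
have [km|nkm] := boolP (low m k); first by rewrite xx'// xr'.
by rewrite (row_low mb Vx' Rk nkm); case: eqP nkm => // ->; rewrite rm.
Qed.

Lemma agree_upto_nbhs m T : nbhs T [set T' : cmx | agree_upto m T' T].
Proof.
apply/(@ptws_discrete_nbhs _ F); exists [seq (r, c) | r <- rowseq m, c <- colseq m].
move=> T' TT' r c rm cm; apply: TT'; apply/allpairsP; exists (r, c).
by rewrite mem_rowseq mem_colseq.
Qed.

Lemma nbhs_agree_upto T (A : set cmx) : nbhs T A -> exists m, forall m' T', (m <= m')%N ->
  agree_upto m' T' T -> A T'.
Proof.
move=> /(@ptws_discrete_nbhs _ F)[s sA].
pose n k : nat := match k with inl i | inr i => i.+1 end.
have lown k N : (n k <= N)%N -> low N k by case: k.
exists (\max_(rc <- s) maxn (n (val rc.1)) (n (val rc.2))) => m' T' mm' TT'.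
apply: sA => -[r c] rcs.
have := leq_trans (@leq_bigmax_seq _ s xpredT (fun rc =>
  maxn (n (val rc.1)) (n (val rc.2))) _ rcs isT) mm'.
by rewrite geq_max => /andP[/= rm cm]; apply: TT'; apply: lown.
Qed.

Lemma chart_graph_inj T T' : chart_graph T = chart_graph T' -> T = T'.
Proof.
move=> TT'; apply/funext => -[r c]; have [m mb] := chart_bound_ex.
pose n k : nat := match k with inl i | inr i => i.+1 end.
set N := maxn m (maxn (n (val r)) (n (val c))).
have lown k : (n k <= N)%N -> low N k by case: k.
apply: (@lev_agree_upto N).
- exact: chart_bound_le (leq_maxl _ _) mb.
- by rewrite TT'.
- by apply: lown; rewrite /N; lia.
- by apply: lown; rewrite /N; lia.
Qed.

(** The chart consists of the algebraic complements of W among the subspaces; see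
    [chart_graph_complement] and [complement_chart_graph]. *)
Definition chart_complement M :=
  (forall x, M x -> W x -> x = 0) /\ (forall x, exists2 y, M y & W (x - y)).

Lemma chart_graph_complement T : chart_complement (chart_graph T).
Proof.
split => [x /chart_graphP xT xW|x].
  have x0 k : R k -> ecoord x k = 0 by move=> Rk; apply: xW; rewrite /= negbK.
  apply: ecoord_inj => k; rewrite ecoord0; have [/x0//|nk] := boolP (R k).
  by have := xT (exist _ k nk); rewrite rowsum0.
have [y Ty xy] := chart_graph_point T x; exists y => // k /=; rewrite negbK => Rk.
by rewrite ecoordB xy// subrr.
Qed.

Lemma complement_chart_graph M : is_subspace M -> chart_complement M ->
  exists T, M = chart_graph T.
Proof.
move=> sM [M1 M2].
have /choice[y yP] : forall r : row, exists y, M y /\ W (edelta F (val r) - y).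
  by move=> r; have [y] := M2 (edelta F (val r)); exists y.
have yr r k : R k -> ecoord (y r) k = (k == val r)%:R.
  move=> Rk; have [_ /(_ k)] := yP r; rewrite /= negbK ecoordB edeltaE => /(_ Rk).
  by move/subr0_eq.
pose T : cmx := fun rc => ecoord (y rc.1) (val rc.2).
exists T.
have key x : exists s, [/\ M s, W (x - s) & forall c : col, ecoord s (val c) = rowsum T x c].
  have [N Nx] := row_support x.
  exists (\sum_(r <- rowseq N) ecoord x (val r) *: y r); split.
  - by apply: (subspace_sum sM) => r _; apply: (subspaceZ sM); have [] := yP r.
  - move=> k /=; rewrite negbK => Rk; apply/eqP; rewrite ecoordB subr_eq0 ecoord_sum; apply/eqP.
    have [kN|kN] := boolP (low N k).
      rewrite (bigD1_seq (exist _ k Rk)) ?rowseq_uniq ?mem_rowseq//=.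
      rewrite ecoordZ yr//= eqxx mulr1 big1 ?addr0// => r rk.
      rewrite ecoordZ yr// (_ : _ == _ = false) ?mulr0//.
      by apply: contraNF rk => /eqP kr; apply/eqP/val_inj.
    rewrite Nx// big_seq big1// => r; rewrite mem_rowseq => rN.
    rewrite ecoordZ yr// (_ : _ == _ = false) ?mulr0//.
    by apply: contraNF kN => /eqP ->.
  - by move=> c; rewrite ecoord_sum (rowsumE _ _ Nx); apply: eq_bigr => r _; rewrite ecoordZ.
apply/seteqP; split => x.
  move=> Mx; have [s [Ms Ws sE]] := key x; apply/chart_graphP => c; rewrite -sE.
  by rewrite -[x](subrK s) (M1 _ (subspaceB sM Mx Ms) Ws) add0r.
move=> /chart_graphP xT; have [s [Ms Ws sE]] := key x.
suff -> : x = s by [].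
apply: ecoord_inj => k; have [Rk|nk] := boolP (R k); last first.
  by have := xT (exist _ k nk); rewrite -sE.
by have := Ws k; rewrite /= negbK ecoordB => /(_ Rk)/subr0_eq.
Qed.

(** For a bound n of Omega and Xi, the space W lies between U_n and V_n, so that both
    conditions survive the intersection with V_n and the quotient by U_n. Seen at
    all large levels they become a countable family of conditions on levels. *)
Lemma chart_complementP m M : chart_bound m -> is_subspace M ->
  chart_complement M <-> (forall n, (m <= n)%N ->
     (lev n M :&: lev n W)%MS = 0 /\ row_full (lev n M + lev n W)%MS).
Proof.
move=> mb sM; have sW := chartW_subspace; split => [[M1 M2] n mn|H].
  have nb := chart_bound_le mn mb; split.
    apply/eqP/rowV0P => u; rewrite sub_capmx => /andP[/levP -/(_ sM)[x [Mx Vx <-]]].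
    move=> /levP -/(_ sW)[x' [Wx' Vx' xx']].
    have := Us_subprj Vx Vx' (esym xx') => /(chartW_Us nb) /(subspaceBr sW _ Wx') Wx.
    by rewrite (M1 _ Mx Wx) linear0.
  rewrite -sub1mx; apply/rV_subP => u _; have [y My Wy] := M2 (emb u).
  have Vy : Vs n y.
    have := chartW_Vs nb Wy => V1; rewrite -[y](subKr (emb u)).
    by apply: (subspaceB (Vs_sub F n)) => //; exact: emb_Vs.
  rewrite -[u](prj_emb (F := F)) -(subrK y (emb u)) linearD/= addrC.
  by apply: addmx_sub_adds; apply: lev_sub => //; exact: chartW_Vs Wy.
split => [x Mx Wx|x].
  apply: Us_all => n; exists (maxn m n); first exact: leq_maxr.
  have nb := chart_bound_le (leq_maxl m n) mb.
  have Vx := chartW_Vs nb Wx.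
  apply/Us_prj; split => //; apply/eqP; rewrite -submx0 -(H _ (leq_maxl m n)).1 sub_capmx.
  by rewrite !lev_sub.
have [N Vx] := Vs_ex x; set n := maxn m N.
have nb := chart_bound_le (leq_maxl m N) mb.
have {}Vx : Vs n x := Vs_le (leq_maxr m N) Vx.
have /sub_addsmxP[[u v] /= uv] : (prj n x <= lev n M + lev n W)%MS.
  exact: submx_full (H _ (leq_maxl m N)).2.
have [y [My Vy yu]] := (levP _ sM).1 (submxMl u (lev n M)).
have [w [Ww Vw wv]] := (levP _ sW).1 (submxMl v (lev n W)).
exists y => //.
apply/(subspaceBr sW _ Ww)/(chartW_Us nb)/Us_prj; split.
  by apply: (subspaceB (Vs_sub F n)) => //; exact: (subspaceB (Vs_sub F n)).
by rewrite !linearB/= uv yu wv addrAC addrK subrr.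
Qed.

Lemma chart_complement_transverse m M : chart_bound m -> chart_complement M -> transverse m M.
Proof.
move=> mb [M1 M2]; split => [x Mx /(chartW_Us mb)|x]; first exact: M1.
by have [y My Wy] := M2 x; exists y => //; exact: chartW_Vs Wy.
Qed.

End Charts.

(** A coordinate complement of the level of M lifts to a coordinate complement of M
    with the same indices. *)
Lemma transverse_chart (F : finFieldType) m0 (M : set (E F)) : is_subspace M ->
  transverse m0 M ->
  exists Omega Xi : {fset nat}, chart_bound Omega Xi m0 /\ chart_complement Omega Xi M.
Proof.
move=> sM gM.
have [S [S1 S2]] := coordinate_complement (lev m0 M).
pose inS k := [exists i, (i \in S) && (@idx m0 i == k)].
pose Om : {fset nat} := [fset i in iota 0 m0 | inS (inl i)]%fset.
pose X : {fset nat} := [fset i in iota 0 m0 | ~~ inS (inr i)]%fset.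
exists Om, X.
have OmE i : (i \in Om) = (i < m0)%N && inS (inl i) by rewrite !inE mem_iota add0n.
have XE i : (i \in X) = (i < m0)%N && ~~ inS (inr i) by rewrite !inE mem_iota add0n.
have b : chart_bound Om X m0 by split => i; rewrite ?OmE ?XE => /andP[].
have inSi i : inS (idx i) = (i \in S).
  apply/existsP/idP => [[i' /andP[iS /eqP /idx_inj <-]]//|iS].
  by exists i; rewrite iS eqxx.
have colS (i : 'I_(m0 + m0)) : ~~ chart_row Om X (idx i) = (i \in S).
  rewrite -inSi; have := low_idx i; case: (idx i) => k /= km; rewrite ?OmE ?XE km/= ?negbK//.
have sW := @chartW_subspace F Om X.
have levW : (lev m0 (@chartW F Om X) :=: \sum_(i in S) <<delta_mx ord0 i : 'rV[F]_(m0 +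
  m0)>>)%MS.
  rewrite /chartW; apply: eqmx_trans (lev_coord _ _ _) _.
  by rewrite (eq_bigl (mem S))// => i; rewrite /= colS.
have cap0 : (lev m0 M :&: lev m0 (@chartW F Om X))%MS = 0.
  by apply/eqP; rewrite -submx0 (cap_eqmx (eqmx_refl _) levW) S1.
split => //; split => [x Mx Wx|x].
  apply: gM.1 => //; apply/Us_prj; have Vx := chartW_Vs b Wx; split => //.
  by apply/eqP; rewrite -submx0 -cap0 sub_capmx !lev_sub.
have [y My Vy] := gM.2 x.
have /sub_addsmxP[[u v] /= uv] : (prj m0 (x - y) <= lev m0 M + lev m0 (@chartW F Om X))%MS.
  by apply: submx_full; rewrite -sub1mx (adds_eqmx (eqmx_refl _) levW) S2.
have [y' [My' Vy' yu]] := (levP _ sM).1 (submxMl u (lev m0 M)).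
have [w [Ww Vw wv]] := (levP _ sW).1 (submxMl v (lev m0 (@chartW F Om X))).
exists (y + y'); first exact: (subspaceD sM).
apply/(subspaceBr sW _ Ww)/(chartW_Us b)/Us_prj.
have -> : x - (y + y') - w = (x - y) - y' - w by rewrite opprD addrA.
split.
  by apply: (subspaceB (Vs_sub F m0)) => //; exact: (subspaceB (Vs_sub F m0)).
by rewrite linearB/= linearB/= uv yu wv addrAC addrK subrr.
Qed.

(** The trace of the set on each chart is open, because finitely many matrix entries
    determine the level, and with it the relative dimension. *)
Lemma borel_level (F : finFieldType) j m (K : 'M[F]_(m + m)) :
  borel_subspaces [set M : set (E F) | Gr j M /\ lev m M = K].
Proof.
move=> Om X; apply: sub_sigma_algebra; rewrite openE => T [/= GT TK].
have [m0 b0] := chart_bound_ex Om X.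
have bn := chart_bound_le (leq_maxl m0 m) b0.
apply: filterS (agree_upto_nbhs (maxn m0 m) T) => T' TT'.
have levE := agree_upto_lev bn TT'; rewrite /interior /=.
have sT' := chart_graph_subspace T'; have sT := chart_graph_subspace T.
have goodT (T0 : chart_matrix F Om X) := chart_complement_transverse bn
  (chart_graph_complement T0).
split; last by rewrite -TK; apply: lev_le levE => //; exact: leq_maxr.
by apply: (Gr_intro sT' (goodT _)); rewrite levE; apply: Gr_transverse_rank.
Qed.

(** * Operators and their finitary approximations *)

Section Operators.
Variable F : finFieldType.
Local Notation E := (E F).
Local Arguments ecoord : simpl never.
Implicit Types (g f : {linear E -> E}) (M A B : set E).

Lemma E_nbhs (x : E) A : nbhs x A <-> exists n, forall y, Us n (y - x) -> A y.
Proof.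
split => [[[P Q] /= [Px Qx] PQ]|[n nA]].
  have {}Px : P x.1 by exact: Px.
  have /ptws_discrete_nbhs[s sQ] : nbhs (x.2 : {ptws nat ->
    discrete_topology F}) Q by exact: Qx.
  exists (\max_(i <- s) i).+1 => y yx; apply: PQ; split => /=.
    rewrite (_ : y.1 = x.1)//; apply/val_inj/funext => i.
    by have := yx (inl i) isT; rewrite ecoordB => /subr0_eq.
  apply: sQ => i si; have := yx (inr i); rewrite ecoordB /= -ltnNge ltnS.
  by move=> /(_ (@leq_bigmax_seq _ s xpredT id i si isT))/subr0_eq.
exists ([set x.1], [set w | forall i, i \in iota 0 n -> w i = x.2 i]) => /=.
  split; first by [].
  have : nbhs (x.2 : {ptws nat -> discrete_topology F}) [set w | forall i,
    i \in iota 0 n -> w i = x.2 i].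
    by apply/ptws_discrete_nbhs; exists (iota 0 n).
  exact.
move=> y [/= y1 y2]; apply: nA => -[i|i] nk; rewrite ecoordB; apply/eqP; rewrite subr_eq0;
  apply/eqP.
  by rewrite /ecoord y1.
by apply: y2; move: nk; rewrite /= mem_iota add0n -ltnNge.
Qed.

Lemma continuous_linP g : continuous g <-> forall n, exists m, forall x, Us m x -> Us n (g x).
Proof.
split => [cg n|H x A /E_nbhs[n nA]].
  have : nbhs (g 0) [set y | Us n (y - g 0)] by apply/E_nbhs; exists n.
  move=> /cg/E_nbhs[m mP]; exists m => x xU.
  by have := mP x; rewrite /= linear0 !subr0; exact.
have [m mP] := H n; apply/E_nbhs; exists m => y /mP yx; apply: nA.
by rewrite -linearB.
Qed.

(** Some U_k is mapped into U_0, which lies in every V_n, and U_k has finite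
    codimension in V_m. *)
Lemma lin_Vs g : continuous g -> forall m, exists n, forall x, Vs m x -> Vs n (g x).
Proof.
move=> /continuous_linP/(_ 0%N)[k kP] m.
set N := maxn k m; have [n nP] := Vs_bigex (fun i : 'I_(N + N) => g (edelta F (idx i))).
exists n => x /(Vs_le (leq_maxr k m)) Vx.
rewrite -(subrK (emb (prj N x)) x) linearD; apply: (subspaceD (Vs_sub F n)).
  exact/(@UsVs _ 0)/kP/(Us_le (leq_maxl k m))/Us_embprj.
rewrite linear_sum; apply: (subspace_sum (Vs_sub F n)) => i _.
by rewrite linearZ; apply: (subspaceZ (Vs_sub F n)).
Qed.

Definition linear_homeo g f := [/\ continuous g, continuous f, cancel g f & cancel f g].

Lemma linear_homeo_sym g f : linear_homeo g f -> linear_homeo f g.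
Proof. by case. Qed.

Lemma GL_inverse g : GL g -> exists f : {linear E -> E}, linear_homeo g f.
Proof.
move=> [cg [h [ch gh hg]]].
have hlin : linear h := can2_linear gh hg.
pose f : {linear E -> E} := HB.pack h (GRing.isLinear.Build F E E _ h hlin).
by exists f.
Qed.

Lemma imageP g f M : cancel g f -> cancel f g -> forall x, (g @` M) x <-> M (f x).
Proof. by move=> gf fg x; split => [[y My <-]|Mfx]; [rewrite gf|exists (f x)]. Qed.

Lemma transverse_image g f n m M : cancel g f -> cancel f g ->
  (forall x, Us m x -> Us n (f x)) -> (forall x, Vs n x -> Vs m (g x)) ->
  transverse n M -> transverse m (g @` M).
Proof.
move=> gf fg Uf Vg [M1 M2]; split => [x /(imageP _ gf fg) Mx /Uf Ux|x].
  by rewrite -[x]fg (M1 _ Mx Ux) linear0.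
have [y My Vy] := M2 (f x); exists (g y); first by exists y.
by rewrite -[x]fg -linearB; exact: Vg.
Qed.

Lemma linear_homeo_transverse g f n M : linear_homeo g f -> transverse n M ->
  exists m, transverse m (g @` M).
Proof.
move=> [cg cf gf fg] gM; have [m1 H1] := (continuous_linP f).1 cf n.
have [m2 H2] := lin_Vs cg n; exists (maxn m1 m2); apply: transverse_image gf fg _ _ gM => x.
  by move/(Us_le (leq_maxl _ _)); exact: H1.
by move/H2; apply: Vs_le; exact: leq_maxr.
Qed.

(** The operator that acts by h on the 2N coordinates of index below N and fixes the
    others. Written as the identity plus a correction of finite rank it is
    visibly linear and continuous. *)
Definition finitary N (h : 'M[F]_(N + N)) (x : E) : E := x + emb (prj N x *m (h - 1%:M)).

Lemma finitary_linear N h : linear (@finitary N h).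
Proof.
move=> a x y; rewrite /finitary linearP mulmxDl -scalemxAl linearP scalerDr.
by rewrite addrACA.
Qed.
HB.instance Definition _ N h := GRing.isLinear.Build F E E _ (@finitary N h)
  (@finitary_linear N h).

Lemma prj_finitary N h x : prj N (@finitary N h x) = prj N x *m h.
Proof. by rewrite /finitary linearD/= prj_emb mulmxBr mulmx1 addrC subrK. Qed.

Lemma finitary_notlow N h x k : ~~ low N k -> ecoord (@finitary N h x) k = ecoord x k.
Proof. by move=> nk; rewrite ecoordD ecoord_emb_notlow// addr0. Qed.

Lemma prj_inj_notlow N (x y : E) : prj N x = prj N y ->
  (forall k, ~~ low N k -> ecoord x k = ecoord y k) -> x = y.
Proof.
by move=> /prjP H1 H2; apply: ecoord_inj => k; have [/H1|/H2] := boolP (low N k).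
Qed.

Lemma finitary_comp N h k x : @finitary N k (finitary h x) = finitary (h *m k) x.
Proof.
apply: (@prj_inj_notlow N) => [|i ni]; first by rewrite !prj_finitary mulmxA.
by rewrite !finitary_notlow.
Qed.

Lemma finitary1 N x : @finitary N 1%:M x = x.
Proof. by rewrite /finitary subrr mulmx0 linear0 addr0. Qed.

Lemma finitaryK N h : h \in unitmx -> cancel (@finitary N h) (finitary (invmx h)).
Proof. by move=> hu x; rewrite finitary_comp mulmxV// finitary1. Qed.
Lemma finitaryVK N h : h \in unitmx -> cancel (finitary (invmx h)) (@finitary N h).
Proof. by move=> hu x; rewrite finitary_comp mulVmx// finitary1. Qed.

Lemma finitary_Us N h x : Us N x -> @finitary N h x = x.
Proof. by move=> /Us_prj[_ x0]; rewrite /finitary x0 mul0mx linear0 addr0. Qed.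

Lemma finitary_Vs N m h x : (N <= m)%N -> Vs m x -> Vs m (@finitary N h x).
Proof.
move=> Nm Vx; apply: (subspaceD (Vs_sub F m)) => //.
exact/(Vs_le Nm)/emb_Vs.
Qed.

Lemma finitary_continuous N h : continuous (@finitary N h).
Proof.
apply/continuous_linP => n; exists (maxn n N) => x Ux.
rewrite /= (@finitary_Us N h x); first exact: Us_le (leq_maxl n N) _ Ux.
exact: Us_le (leq_maxr n N) _ Ux.
Qed.

Lemma finitary_homeo N h : h \in unitmx -> linear_homeo (@finitary N h) (@finitary N (invmx h)).
Proof.
by move=> hu; split; [exact: finitary_continuous|exact: finitary_continuous|exact:
  finitaryK|exact: finitaryVK].
Qed.

Lemma finitary_transverse N h M : h \in unitmx -> transverse N M ->
  transverse N (@finitary N h @` M).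
Proof.
move=> hu; apply: transverse_image (finitaryK hu) (finitaryVK hu) _ _ => x.
  by move=> Ux; rewrite /= finitary_Us.
exact: finitary_Vs.
Qed.

Lemma lev_finitary N h M : is_subspace M -> h \in unitmx ->
  (lev N (@finitary N h @` M) :=: lev N M *m h)%MS.
Proof.
move=> sM hu; apply: lev_ext; first exact: subspace_image.
move=> y; rewrite -[y in (y <= _)%MS](mulmxKV hu) submxMfree ?row_free_unit//.
split => [/levP -/(_ sM)[x [Mx Vx xy]]|[_ [[x Mx <-] Vx <-]]].
  exists (finitary h x); split; [by exists x|exact: finitary_Vs|by rewrite prj_finitary xy
    mulmxKV].
rewrite prj_finitary mulmxK//; apply: lev_sub => //.
by rewrite -[x](finitaryK hu); exact: finitary_Vs.
Qed.

Lemma finitary_widen n N h : (n <= N)%N -> h \in unitmx ->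
  exists2 h' : 'M[F]_(N + N), h' \in unitmx & forall x, @finitary n h x = finitary h' x.
Proof.
move=> nN hu.
have ext (k : 'M[F]_(n + n)) : exists k' : 'M[F]_(N + N), forall x,
  finitary k x = finitary k' x.
  pose s := (prj N \o finitary k \o @emb F N) : {linear _ -> _}.
  exists (lin1_mx s) => x; apply: (@prj_inj_notlow N) => [|i ni].
    rewrite prj_finitary mul_rV_lin1 /= /finitary !(linearD (prj N)) /= prj_emb;
      congr (_ + prj N (emb (_ *m _))).
    by apply: prj_le nN _; rewrite prj_emb.
  by rewrite !finitary_notlow//; apply: contra ni; exact: low_le.
have [h' h'E] := ext h; have [k' k'E] := ext (invmx h).
exists h' => //.
have /mulmx1_unit[] // : h' *m k' = 1%:M.
apply/row_matrixP => i; rewrite rowE row1 mulmxA.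
set d := delta_mx 0 i; have := prj_emb (F := F) d.
by rewrite -{1}(finitaryK hu (emb d)) k'E h'E !prj_finitary prj_emb.
Qed.

Lemma Gr_finitary j N h M : h \in unitmx -> Gr j M -> Gr j (@finitary N h @` M).
Proof.
move=> hu GM; have [m0 m0P] := Gr_eventually GM.
have [gM rM] := m0P _ (leq_maxl m0 N).
have [h' h'u hh'] := finitary_widen (leq_maxr m0 N) hu.
have -> : finitary h @` M = finitary h' @` M by congr image; apply/funext.
apply: (@Gr_intro _ _ (maxn m0 N)); first exact: subspace_image GM.1.
  exact: finitary_transverse.
rewrite (lev_finitary GM.1 h'u) mxrankMfree ?row_free_unit//.
Qed.

Section Theta.
Variables (g f : {linear E -> E}) (N : nat).
Hypotheses (gf : cancel g f) (fg : cancel f g).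
Hypothesis gU : forall x, Us N x -> Us 0 (g x).
Hypothesis fU : forall x, Us 0 x -> Vs N (f x).
Local Notation Q := (f @` Us 0).
Local Notation ell_space := (@ell_space F).

Let sQ : is_subspace Q.
Proof. by apply: subspace_image; exact: Us_sub. Qed.
Let se : is_subspace ell_space. Proof. exact: coord_space_subspace. Qed.
Let QV x : Q x -> Vs N x. Proof. by move=> [y /fU ? <-]. Qed.
Let QP x : Q x <-> Us 0 (g x). Proof. exact: imageP. Qed.
Let UQ x : Us N x -> Q x. Proof. by move=> /gU/QP. Qed.

Definition ell_in (v : ell F) : E := (v, 0).
Lemma ell_in_linear : linear ell_in.
Proof. by move=> a x y; rewrite /ell_in; congr pair; rewrite /= scaler0 addr0. Qed.
HB.instance Definition _ := GRing.isLinear.Build F (ell F) E _ ell_in ell_in_linear.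

Lemma ell_space_in x : ell_space x <-> exists v, x = ell_in v.
Proof.
split => [xe|[v ->] [i|i]//]; exists x.1; apply: ecoord_inj => -[i|i]//.
by rewrite xe.
Qed.

Lemma fst_eq (x y : E) : x.1 = y.1 <-> Us 0 (x - y).
Proof.
split => [xy [i|i]// _|xy]; first by rewrite ecoordB /ecoord xy subrr.
by apply/val_inj/funext => i; have := xy (inl i) isT; rewrite ecoordB => /subr0_eq.
Qed.

Let kerE v : block_a g v = 0 <-> Q (ell_in v).
Proof. by rewrite QP -[g _]subr0 -fst_eq. Qed.

Let levQe : (lev N (Q `&` ell_space) :=: lev N Q :&: lev N ell_space)%MS.
Proof.
apply: lev_ext => [|y]; first exact: subspaceI.
rewrite sub_capmx; split => [/andP[/levP -/(_ sQ)[x [Qx Vx <-]]]|[x [[Qx ex] Vx <-]]].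
  move=> /levP -/(_ se)[x' [ex' Vx' xx']]; exists x'; split => //; split => //.
  by have := Us_subprj Vx' Vx xx' => /UQ /(subspaceBr sQ _ Qx).
by rewrite !lev_sub.
Qed.

Let ker_dim n : quot_dim [set (0%R : ell F)] [set v | block_a g v = 0] n <->
  \rank (lev N Q :&: lev N ell_space)%MS = n.
Proof.
rewrite -levQe; have := @quot_dim_rank F (ell F) [set (0%R : ell F)] [set v | block_a g v = 0]
  _ (prj N \o ell_in) 0 (lev N (Q `&` ell_space)) n.
rewrite mxrank0 add0n; apply.
- split; first by apply/kerE; rewrite linear0; exact: sQ.1.
  move=> a u v /kerE Qu /kerE Qv; apply/kerE; rewrite linearP; exact: sQ.2.
- exact: sub0mx.
- move=> v /kerE Qv; apply: lev_sub; [exact: subspaceI|split => //|exact: QV].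
  by apply/ell_space_in; exists v.
- move=> y /levP -/(_ (subspaceI sQ se))[x [[Qx /ell_space_in[v xv]] Vx xy]].
  by exists v; [apply/kerE; rewrite -xv|rewrite /= -xv xy subrr sub0mx].
- move=> v /kerE /QV Vv; rewrite submx0; split => [->|/eqP v0]; first by rewrite linear0.
  have : ell_in v = 0.
    by apply: (@ell_space_Us0 _ N); [apply/ell_space_in; exists v|apply/Us_prj].
  by move=> /(congr1 fst).
Qed.

Let coker_dim n : quot_dim (range (block_a g)) [set: ell F] n <->
  (N + N)%N = (\rank (lev N Q + lev N ell_space)%MS + n)%N.
Proof.
have := @quot_dim_rank F (ell F) (range (block_a g)) [set: ell F]
  _ (prj N \o f \o ell_in) (lev N Q + lev N ell_space)%MS 1%:M n.
rewrite mxrank1; apply; [by []|exact: submx1|by move=> *; exact: submx1| |].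
  move=> y _; exists (g (emb y)).1 => //=.
  have -> : y - prj N (f (ell_in (g (emb y)).1)) = prj N (f (g (emb y) - ell_in (g (emb y)).1)).
    by rewrite !linearB/= gf prj_emb.
  apply: submx_trans (addsmxSl _ _); have : Q (f (g (emb y) - ell_in (g (emb y)).1)).
    by exists (g (emb y) - ell_in (g (emb y)).1) => //; exact/fst_eq.
  by move=> H; apply: lev_sub => //; exact: QV.
move=> z _ /=; split => [[v _ <-]|].
  have H : Q (f (ell_in (block_a g v)) - ell_in v).
    by apply/QP; rewrite linearB fg; apply/fst_eq.
  rewrite -(subrK (ell_in v) (f _)) linearD/=; apply: addmx_sub_adds.
    by apply: lev_sub => //; exact: QV.
  by apply/lev_coordP => i; rewrite mxE; case: (idx i).
move=> /sub_addsmxP[[u w] /= uw].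
have [r [Qr Vr ru]] := (levP _ sQ).1 (submxMl u (lev N Q)).
set x := f (ell_in z).
have [e eP] : exists e : ell F, e = (x - r).1 by exists (x - r).1.
have Us' : Us N (x - r - ell_in e).
  move=> [i|i] /=; first by move=> _; rewrite ecoordB eP subrr.
  rewrite -ltnNge => iN; rewrite ecoordB subr0.
  have iN' : low N (inr i) by [].
  have [k kE] := lowP iN'.
  have -> : ecoord (x - r) (inr i) = prj N (x - r) 0 k by rewrite mxE -kE.
  rewrite linearB/= uw ru addrAC subrr add0r.
  have := submxMl w (lev N ell_space) => /lev_coordP; apply; by rewrite -kE.
have : Us 0 (ell_in z - g (ell_in e)).
  rewrite -[ell_in z]fg -/x -linearB; apply/QP.
  by have := subspaceD sQ (UQ Us') Qr; rewrite addrAC subrK.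
by move=> /fst_eq /= ze; exists e => //; rewrite /block_a -/(ell_in e) -ze.
Qed.

(** The block a is g restricted to ell and followed by the quotient by U_0. Writing Q
    for the inverse image of U_0 under g, its kernel is the intersection of Q and
    ell, and its cokernel is the quotient of the space by their sum. Both are
    visible at level N, where ell has rank N, and the dimension formula turns the
    index into the rank of Q. *)
Lemma theta_rank k : theta g k <-> k = N%:Z - (\rank (lev N Q))%:Z.
Proof.
have sc := mxrank_sum_cap (lev N Q) (lev N ell_space); rewrite rank_ell_space in sc.
have le := rank_leq_row (lev N Q + lev N ell_space)%MS.
split => [[m [n [/coker_dim Hm /ker_dim Hn ->]]]|->]; first by lia.
exists (N + N - \rank (lev N Q + lev N ell_space)%MS)%N,
  (\rank (lev N Q :&: lev N ell_space)%MS).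
split; [by apply/coker_dim; rewrite subnKC|exact/ker_dim|by lia].
Qed.

End Theta.

Lemma quot_dim_image g f A B n : cancel g f -> cancel f g ->
  quot_dim A B n -> quot_dim (g @` A) (g @` B) n.
Proof.
move=> gf fg [b [Bb bP]]; exists (fun i => g (b i)); split; first by move=> i; exists (b i).
move=> _ [x Bx <-]; have [c [Ac cu]] := bP _ Bx.
have E (c' : 'rV[F]_n) : (g @` A) (g x - \sum_(i < n) c' ord0 i *: g (b i)) <->
    A (x - \sum_(i < n) c' ord0 i *: b i).
  rewrite (imageP A gf fg) (_ : f _ = x - \sum_(i < n) c' ord0 i *: b i)//.
  apply: (can_inj gf); rewrite fg [RHS]linearB (linear_sum g); congr (_ - _).
  by apply: eq_bigr => i _; rewrite linearZ.
by exists c; split => [|c' /E]; [exact/E|exact: cu].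
Qed.

Lemma finitary_GL0 N h : h \in unitmx -> GL0 (@finitary N h).
Proof.
move=> hu; have [cg cf gf fg] := finitary_homeo hu; split.
  by split => //; exists (finitary (invmx h)).
have hiu : invmx h \in unitmx by rewrite unitmx_inv.
apply/(@theta_rank (@finitary N h) (@finitary N (invmx h)) N) => //.
- by move=> x Ux; rewrite /= finitary_Us//; exact: Us_le Ux.
- by move=> x Ux; apply: finitary_Vs => //; exact: UsVs Ux.
- by rewrite (lev_finitary (Us_sub F 0) hiu) mxrankMfree ?row_free_unit// rank_Us// subn0 subrr.
Qed.

(** [theta_rank] gives the case m = 0, and U_m has codimension m in U_0. *)
Lemma GL0_rank g f m N : GL0 g -> linear_homeo g f -> (m <= N)%N ->
  (forall x, Us N x -> Us m (g x)) -> (forall x, Us 0 x -> Vs N (f x)) ->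
  \rank (lev N (f @` Us m)) = (N - m)%N.
Proof.
move=> [_ th] [cg cf gf fg] mN gU fU.
have gU0 x : Us N x -> Us 0 (g x) by move/gU; exact: Us_le.
have := (theta_rank gf fg gU0 fU 0).1 th => r0.
have qd : quot_dim (f @` Us m) (f @` Us 0) m.
  apply: quot_dim_image => //; apply/(@quot_dim_lev F m); try exact: Us_sub.
  - exact: Us_le.
  - exact: UsVs.
  - by [].
  - by rewrite !rank_Us// subnn subn0.
have := (@quot_dim_lev F N _ _ m (subspace_image f (Us_sub F m)) (subspace_image f (Us_sub
  F 0)) _ _ _).1.
move=> /(_ _ _ _ qd); have H1 : f @` Us m `<=` f @` Us 0 by apply: image_subset; exact: Us_le.
have H2 : f @` Us 0 `<=` Vs N by move=> _ [x /fU ? <-].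
have H3 x : (f @` Us 0) x -> Us N x -> (f @` Us m) x by move=> _ /gU; rewrite (imageP _ fg gf).
move=> /(_ H1 H2 H3) E.
move/eqP: r0; rewrite E eq_sym subr_eq0 => /eqP[] NE.
by apply/eqP; rewrite -(eqn_add2r m) subnK// -NE.
Qed.

(** The level N of the inverse image of U_m under g has the same rank as that of U_m:
    this is where the vanishing of theta enters. Hence an invertible h of size 2N
    can send the first onto the second, and at the same time send the inverse
    image of each basis vector of index below m to that vector. Modulo U_m the
    operators g and h then agree on all vectors that one of them maps to V_m. *)
Lemma GL0_approx g m : GL0 g -> exists N (h : 'M[F]_(N + N)),
  h \in unitmx /\ forall x, (Vs m (g x) <-> Vs m (finitary h x)) /\
    (Vs m (g x) -> prj m (g x) = prj m (finitary h x)).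
Proof.
move=> g0; have [f hf] := GL_inverse g0.1; have [cg cf gf fg] := hf.
have [n1 H1] := (continuous_linP g).1 cg m; have [n2 H2] := lin_Vs cf m.
set N := maxn m (maxn n1 n2).
have mN : (m <= N)%N by rewrite /N; lia.
have gU x : Us N x -> Us m (g x).
  by move=> Ux; apply/H1; apply: Us_le Ux; rewrite /N; lia.
have fV x : Vs m x -> Vs N (f x).
  by move=> /H2; apply: Vs_le; rewrite /N; lia.
have fU x : Us 0 x -> Vs N (f x) by move=> Ux; apply: fV; exact: UsVs Ux.
have sUm := Us_sub F m; have sf := subspace_image f sUm.
have ru : \rank (lev N (f @` Us m)) = \rank (lev N (@Us F m)).
  by rewrite (GL0_rank g0 hf mN gU fU) rank_Us.
have [k ku kE] := eq_rank_unitmx ru.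
(* S is to be carried onto S0, that is the inverse images of the basis vectors
   below m onto these vectors, while the level of f U_m goes to that of U_m. *)
pose S := lin1_mx (prj N \o f \o @emb F m).
pose S0 := lin1_mx (prj N \o @emb F m).
have SE (b : 'rV_(m + m)) : b *m S = prj N (f (emb b)) by rewrite mul_rV_lin1.
have S0E (b : 'rV_(m + m)) : b *m S0 = prj N (emb b) by rewrite mul_rV_lin1.
have UV (x : E) : Us m x -> Vs N x by exact: UsVs.
have eV (b : 'rV[F]_(m + m)) : Vs N (emb b) by exact/(Vs_le mN)/emb_Vs.
have prjU (x : E) (b : 'rV_(m + m)) : Us m x -> prj m (x + emb b) = b.
  by move=> /Us_prj[_ x0]; rewrite linearD/= x0 add0r prj_emb.
have [|h hu] := @unitmx_same_kernel _ _ _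
  (col_mx (lev N (f @` Us m)) S) (col_mx (lev N (f @` Us m) *m k) S0).
  apply: rV_row_mx_ind => a b; rewrite !mul_row_col SE S0E mulmxA.
  have inj (c : 'rV_(N + N)) : c *m k = 0 -> c = 0.
    by move=> /(congr1 (mulmx^~ (invmx k))); rewrite mulmxK// mul0mx.
  split => E.
    have [x [[u Uu ux] Vx xa]] := (levP _ sf).1 (submxMl a (lev N (f @` Us m))).
    have b0 : b = 0.
      rewrite -(prjU u b Uu); have : Us N (f (u + emb b)).
        apply/Us_prj; split; last by rewrite linearD/= linearD/= ux xa.
        by rewrite linearD; apply: (subspaceD (Vs_sub F N)); [by apply: fU;
          exact: Us_le Uu|exact/fV/emb_Vs].
      by move=> /gU; rewrite fg => /Us_prj[].
    by move: E; rewrite b0 !linear0 !addr0 => ->; rewrite mul0mx.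
  have : (a *m lev N (f @` Us m) *m k <= lev N (@Us F m))%MS by rewrite kE -mulmxA submxMl.
  move=> /levP -/(_ sUm)[u [Uu Vu uE]].
  have b0 : b = 0.
    rewrite -(prjU u b Uu); have : Us N (u + emb b).
      apply/Us_prj; split; first exact: (subspaceD (Vs_sub F N)).
      by rewrite linearD/= uE.
    by move=> /(Us_le mN)/Us_prj[].
  by move: E; rewrite b0 !linear0 !addr0 => /inj.
rewrite mul_col_mx => /eq_col_mx [h1 h2].
exists N, h; split => // x.
have dec (z : E) : Vs m z -> Us m (z - emb (prj m z)) by exact: Us_embprj.
have fwd : Vs m (g x) -> Vs m (finitary h x) /\ prj m (g x) = prj m (finitary h x).
  move=> Vg; set u := g x - emb (prj m (g x)); have Uu : Us m u := dec _ Vg.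
  have xE : x = f u + f (emb (prj m (g x))) by rewrite -linearD subrK gf.
  have Vfu : Vs N (f u) by apply: fV; exact: UsVs Uu.
  have Vx : Vs N x.
    by rewrite xE; apply: (subspaceD (Vs_sub F N)) => //; exact/fV/emb_Vs.
  have : (prj N (f u) *m h <= lev N (@Us F m))%MS.
    by rewrite kE -h1; apply: submxMr; apply: lev_sub => //; exists u.
  move=> /levP -/(_ sUm)[u' [Uu' Vu' u'E]].
  have : Us N (finitary h x - (u' + emb (prj m (g x)))).
    apply: Us_subprj; first exact: finitary_Vs.
      exact: (subspaceD (Vs_sub F N)).
    rewrite prj_finitary {1}xE linearD/= mulmxDl -u'E -SE -mulmxA h2 S0E.
    by rewrite linearD.
  move=> /(Us_le mN) Ud; have Vu2 : Vs m (u' + emb (prj m (g x))).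
    by apply: (subspaceD (Vs_sub F m)); [exact: UsVs Uu'|exact: emb_Vs].
  split; first by have := UsVs (N := m) Ud => /(subspaceBr (Vs_sub F m) _ Vu2).
  have /Us_prj[_ /eqP] := Ud.
  by rewrite linearB/= subr_eq0 => /eqP ->; rewrite prjU.
split; last by case/fwd.
split; first by case/fwd.
set z := finitary h x => Vz; set u := z - emb (prj m z); have Uu : Us m u := dec _ Vz.
have VNz : Vs N z := Vs_le mN Vz.
have Vx : Vs N x by rewrite -[x](finitaryK hu); exact: finitary_Vs.
have : (prj N u <= lev N (f @` Us m) *m h)%MS.
  by rewrite h1 -kE; apply: lev_sub => //; exact: UV.
move=> /submxP[c cE].
have [y [[u1 Uu1 u1y] Vy yE]] := (levP _ sf).1 (submxMl c (lev N (f @` Us m))).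
have : Us N (x - f (u1 + emb (prj m z))).
  have V2 : Vs N (f (u1 + emb (prj m z))).
    by apply: fV; apply: (subspaceD (Vs_sub F m)); [exact: UsVs Uu1|exact: emb_Vs].
  apply: Us_subprj => //.
  apply: (can_inj (mulmxK hu)); rewrite -prj_finitary -/z -{1}(subrK (emb (prj m z)) z) -/u.
  rewrite linearD/= cE (linearD f) [prj N (_ + f _)]linearD/= u1y yE mulmxDl mulmxA;
    congr (_ + _).
  by rewrite -SE -mulmxA h2 S0E.
move=> /gU; rewrite linearB/= fg.
have V2 : Vs m (u1 + emb (prj m z)).
  by apply: (subspaceD (Vs_sub F m)); [exact: UsVs Uu1|exact: emb_Vs].
by move=> /(@UsVs F m m) /(subspaceBr (Vs_sub F m) _ V2).
Qed.

Lemma approx_lev g (k : {linear E -> E}) m M : is_subspace M ->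
  (forall x, (Vs m (g x) <-> Vs m (k x)) /\ (Vs m (g x) -> prj m (g x) = prj m (k x))) ->
  lev m (g @` M) = lev m (k @` M).
Proof.
move=> sM H; apply: eq_lev; try exact: subspace_image.
move=> y; split => -[_ [[x Mx <-] Vx <-]].
  by exists (k x); have [h1 h2] := H x; split; [exists x|exact/h1|rewrite h2].
by exists (g x); have [h1 h2] := H x; split; [exists x|exact/h1|rewrite h2//; exact/h1].
Qed.

(** At level m the image g M cannot be told from a finitary translate of M, which
    lies in Gr^j by [Gr_finitary]. *)
Lemma GL0_Gr g j M : GL0 g -> Gr j M -> Gr j (g @` M).
Proof.
move=> g0 GM; have [f hf] := GL_inverse g0.1.
have [n /(_ _ (leqnn n))[gM _]] := Gr_eventually GM.
have [m gmM] := linear_homeo_transverse hf gM.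
have [N [h [hu H]]] := GL0_approx m g0.
have sM := GM.1; have sgM := subspace_image g sM.
have levE := approx_lev sM H.
have UE x : Us m (g x) <-> Us m (finitary h x).
  have [h1 h2] := H x; rewrite !Us_prj; split => -[V0 E].
    by split; [exact/h1|rewrite -h2].
  by split; [exact/h1|rewrite h2//; exact/h1].
have gF : transverse m (finitary h @` M).
  split => [_ [x Mx <-] /UE Ux|x].
    have : g x = 0 by apply: gmM.1 => //; exists x.
    have [_ _ gf _] := hf; rewrite -(linear0 g) => /(can_inj gf) ->.
    by rewrite !linear0.
  have [_ _ gf fg] := hf.
  have [_ [y My <-] Vy] := gmM.2 (g (finitary (invmx h) x)); exists (finitary h y);
    first by exists y.
  by rewrite -[x](finitaryVK hu) -linearB/=; apply/(H _).1; rewrite linearB.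
apply: (Gr_intro sgM gmM); rewrite levE.
exact: Gr_transverse_rank (Gr_finitary hu GM) gF.
Qed.

(** The image f M lies in some Gr^i since it is transverse, and applying g to it
    gives i = j. *)
Lemma GL0_Gr_inverse g f j M : GL0 g -> linear_homeo g f -> Gr j M -> Gr j (f @` M).
Proof.
move=> g0 hf GM; have sM := GM.1.
have [n /(_ _ (leqnn n))[gM _]] := Gr_eventually GM.
have [m gmM] := linear_homeo_transverse (linear_homeo_sym hf) gM.
have G' : Gr ((\rank (lev m (f @` M)))%:Z - m%:Z) (f @` M).
  by apply: (Gr_intro (subspace_image f sM) gmM); rewrite addrC subrK.
suff -> : j = (\rank (lev m (f @` M)))%:Z - m%:Z by [].
apply: (Gr_inj GM); have := GL0_Gr g0 G'.
by rewrite image_comp (_ : g \o f = id) ?image_id//; apply/funext => x;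
  case: hf => _ _ _ /(_ x).
Qed.

Lemma lev_image_determined g f m : linear_homeo g f -> exists N, forall M M',
  is_subspace M -> is_subspace M' -> lev N M = lev N M' -> lev m (g @` M) = lev m (g @` M').
Proof.
move=> [cg cf gf fg]; have [n1 H1] := (continuous_linP g).1 cg m.
have [n2 H2] := lin_Vs cf m; exists (maxn n1 n2).
set N := maxn n1 n2; wlog suff aux : / forall M M' : set E, is_subspace M -> is_subspace M' ->
    lev N M = lev N M' -> forall y : 'rV[F]_(m + m),
    (exists x, [/\ (g @` M) x, Vs m x & prj m x = y]) ->
    (exists x, [/\ (g @` M') x, Vs m x & prj m x = y]).
  by move=> M M' sM sM' MM'; apply: eq_lev; try exact: subspace_image; move=> y; split;
    apply: aux.
move=> M M' sM sM' MM' y [_ [[x Mx <-] Vx <-]].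
have VNx : Vs N x by rewrite -[x]gf; apply: Vs_le (H2 _ Vx); exact: leq_maxr.
have := lev_sub sM Mx VNx; rewrite MM' => /levP -/(_ sM')[x' [Mx' Vx' xx']].
have : Us m (g x' - g x).
  by rewrite -linearB; apply: H1; apply: Us_le (Us_subprj Vx' VNx xx'); exact: leq_maxl.
move=> Ud; exists (g x'); split; first by exists x'.
  by have := UsVs (N := m) Ud => /(subspaceBr (Vs_sub F m) _ Vx).
by apply/eqP; rewrite -subr_eq0 -linearB; apply/eqP; case/Us_prj: Ud.
Qed.

End Operators.

(** * Flags and level events *)

Lemma shift_index (x : int) m : (`|x| <= m)%N ->
  (absz (x + m%:Z)%R < (m + m).+1)%N /\ (absz (x + m%:Z))%:Z - m%:Z = x.
Proof. by lia. Qed.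

Section Flags.
Variables (F : finFieldType) (I : set int).
Local Notation E := (E F).
Local Notation flag := (flag F I).
Implicit Types (L : flag) (g f : {linear E -> E}).

Definition mem_index (j : int) (Ij : I j) : I := exist _ j (mem_set Ij).
Definition mkflag (K : I -> set E) (FK : @Fl F I K) : flag := exist _ K (mem_set FK).

Lemma flag_Gr L (j : I) : Gr (val j) (val L j).
Proof. by have [H _] := set_valP L; exact: H. Qed.
Lemma flag_subspace L (j : I) : is_subspace (val L j).
Proof. by have [] := flag_Gr L j. Qed.
Lemma flag_sub L (j k : I) : val k = val j + 1 -> val L j `<=` val L k.
Proof. by have [_ H] := set_valP L; exact: H. Qed.

(** The default value is taken only when the images do not form a flag, which is
    excluded for operators preserving every Gr^j; see [flag_actE]. *)
Definition flag_act (g : {linear E -> E}) L : flag :=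
  if pselect (@Fl F I (fun j => g @` val L j)) is left FK then mkflag FK else L.

Lemma flag_act_Fl g L : (forall (j : int) M, Gr j M -> Gr j (g @` M)) -> @Fl F I (fun j =>
  g @` val L j).
Proof.
move=> gG; split => [j|j k jk]; first exact/gG/flag_Gr.
by apply: image_subset; exact: flag_sub.
Qed.

Lemma flag_actE g L (j : I) : (forall (j : int) M, Gr j M -> Gr j (g @` M)) ->
  val (flag_act g L) j = g @` val L j.
Proof. by move=> gG; rewrite /flag_act; case: pselect => // nF; case: nF;
  exact: flag_act_Fl. Qed.

Lemma flag_eq L L' : (forall j, val L j = val L' j) -> L = L'.
Proof. by move=> LL'; apply: val_inj; apply/funext. Qed.

Definition same_levels m L L' := forall j : I, (`|val j| <= m)%N ->
  lev m (val L j) = lev m (val L' j).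

Lemma same_levels_le m n L L' : (m <= n)%N -> same_levels n L L' -> same_levels m L L'.
Proof.
move=> mn LL' j jm; apply: (lev_le mn); [exact: flag_subspace|exact: flag_subspace|].
by apply: LL'; exact: leq_trans jm mn.
Qed.

(** The sets of flags that depend on finitely many levels form an algebra, which
    generates the sigma-algebra of measurable sets by [flag_measurableE]. *)
Definition level_event : set (set flag) :=
  [set A | exists m, forall L L', same_levels m L L' -> A L -> A L'].

Lemma level_event0 : level_event set0. Proof. by exists 0%N. Qed.
Lemma level_eventC A : level_event A -> level_event (~` A).
Proof.
move=> [m Am]; exists m => L L' LL' nAL AL'; apply: nAL; apply: Am AL' => j jm.
by rewrite LL'.
Qed.
Lemma level_eventU A B : level_event A -> level_event B -> level_event (A `|` B).
Proof.
move=> [m Am] [n Bn]; exists (maxn m n) => L L' LL' [AL|BL]; [left|right].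
  by apply: Am AL; exact: same_levels_le (leq_maxl _ _) LL'.
by apply: Bn BL; exact: same_levels_le (leq_maxr _ _) LL'.
Qed.
Lemma level_eventI A B : level_event A -> level_event B -> level_event (A `&` B).
Proof. by move=> aA aB; rewrite -[_ `&` _]setCK setCI; apply/level_eventC/level_eventU;
  exact: level_eventC. Qed.
Lemma level_eventT : level_event setT. Proof. by exists 0%N. Qed.

Lemma level_event_lev n (j : I) (P : 'M[F]_(n + n) ->
  Prop) : level_event [set L : flag | P (lev n (val L j))].
Proof.
exists (maxn n `|val j|) => L L' LL' /=; rewrite (_ : lev n (val L' j) = lev n (val L j))//.
by apply: (lev_le (leq_maxl n `|val j|)); [exact: flag_subspace|exact:
  flag_subspace|rewrite LL'// leq_maxr].
Qed.

(** All levels up to m as one element of a finite type. The index i stands for the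
    degree i - m, and 0 is put in the degrees outside I. *)
Definition level_code m L : {ffun 'I_(m + m).+1 -> 'M[F]_(m + m)} :=
  [ffun i : 'I_(m + m).+1 => (if pselect (I ((i : nat)%:Z - m%:Z)) is left Ij then lev m
    (val L (mem_index Ij)) else 0) : 'M[F]_(m + m)].

Lemma level_code_same m L L' : level_code m L = level_code m L' -> same_levels m L L'.
Proof.
move=> LL' j jm.
have [im ij] := shift_index jm; pose i := Ordinal im.
have := congr1 (fun f : {ffun _} => f i) LL'; rewrite !ffunE.
case: pselect => [Ij|]; last by rewrite ij => /(_ (set_valP j)).
by have -> : mem_index Ij = j by apply: val_inj.
Qed.

Lemma level_measurable n (j : I) (K : 'M[F]_(n + n)) :
  measurable ([set L : flag | lev n (val L j) = K] : set (flag_space F I)).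
Proof.
apply: sub_sigma_algebra; exists j, [set M : set E | Gr (val j) M /\ lev n M = K]; split.
- by move=> M [].
- exact: borel_level.
- apply/seteqP; split => L /=; last by case.
  by move=> H; split => //; exact: flag_Gr.
Qed.

Lemma level_event_measurable A : level_event A -> measurable (A : set (flag_space F I)).
Proof.
move=> [m Am].
have -> : A = \bigcup_(c in [set c | exists2 L,
  A L & level_code m L = c]) [set L : flag | level_code m L = c].
  apply/seteqP; split => L; first by move=> AL; exists (level_code m L) => //; exists L.
  by move=> [c [L' AL' <-]] /esym/level_code_same LL'; exact: Am AL'.
apply: (@fin_bigcup_measurable _ (flag_space F I)); first exact: finite_finset.
move=> c _.
have -> : [set L : flag | level_code m L = c] = \bigcap_(i in [set: 'I_(m + m).+1]) [set L
  : flag | level_code m L i = c i].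
  apply/seteqP; split => L /=; first by move=> H i _; rewrite /= H.
  by move=> H; apply/ffunP => i; exact: (H i).
apply: (@fin_bigcap_measurable _ (flag_space F I)); first exact: finite_finset.
move=> i _; rewrite /level_code; under eq_set do rewrite ffunE.
case: pselect => [Ij|nI]; first exact: level_measurable.
have [->|/eqP ci] := eqVneq (c i) 0; first by rewrite (_ : [set _ | _] = setT)//;
  apply/seteqP; split.
rewrite (_ : [set _ | _] = set0)//; apply/seteqP; split => L //= E0; exact/ci/esym.
Qed.

Local Notation sflag := (g_sigma_algebraType level_event).

Lemma level_event_sigma A : level_event A -> measurable (A : set sflag).
Proof. exact: sub_sigma_algebra. Qed.

Lemma chart_complement_measurable Om X (j : I) : measurable ([set L : flag |
  chart_complement Om X (val L j)] : set sflag).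
Proof.
have [m0 b0] := chart_bound_ex Om X.
rewrite (_ : [set L | _] = \bigcap_n [set L : flag | (lev (m0 + n) (val L j) :&: lev (m0 +
  n) (@chartW F Om X))%MS = 0 /\
   row_full (lev (m0 + n) (val L j) + lev (m0 + n) (@chartW F Om X))%MS]).
  apply: bigcapT_measurable => n; apply: level_event_sigma.
  exact: (@level_event_lev _ _ (fun A => (A :&: lev (m0 + n) (@chartW F Om X))%MS = 0 /\
    row_full (A + lev (m0 + n) (@chartW F Om X))%MS)).
apply/seteqP; split => L /= H.
  by move=> n _; apply: (chart_complementP b0 (flag_subspace L j)).1 => //; exact: leq_addr.
apply/(chart_complementP b0 (flag_subspace L j)) => n /subnKC <-; exact: H.
Qed.

(** The sets B with this property form a sigma-algebra, the complements being
    handled by the injectivity of [chart_graph]. An open B is a countable union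
    of sets given by conditions on finitely many matrix entries, that is on one
    level. *)
Lemma chart_borel_measurable Om X (j : I) (B : set (chart_matrix F Om X)) :
  <<s (@open (chart_matrix F Om X)) >> B ->
  measurable ([set L : flag | exists2 T, B T & val L j = chart_graph T] : set sflag).
Proof.
pose C : set (set (chart_matrix F Om X)) :=
  [set B | measurable ([set L : flag | exists2 T, B T & val L j = chart_graph T] : set sflag)].
suff : <<s (@open (chart_matrix F Om X)) >> `<=` C by apply.
have complE : [set L : flag | chart_complement Om X (val L j)] = [set L : flag | exists2 T
  : chart_matrix F Om X, True & val L j = chart_graph T].
  apply/seteqP; split => L /=; last by move=> [T _ ->]; exact: chart_graph_complement.
  by move=> /(complement_chart_graph (flag_subspace L j))[T ->]; exists T.
apply: smallest_sub; first split.
- by rewrite /C /= (_ : [set L | _] = set0)//; apply/seteqP; split => L // -[].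
- move=> B' CB'; rewrite /C /= (_ : [set L | _] =
      [set L : flag | chart_complement Om X (val L j)] `\` [set L : flag | exists2 T,
        B' T & val L j = chart_graph T]).
    by apply: measurableD => //; exact: chart_complement_measurable.
  rewrite complE; apply/seteqP; split => L /=.
    move=> [T [_ nB] LT]; split; first by exists T.
    by move=> [T' BT']; rewrite LT => /chart_graph_inj TT'; apply: nB; rewrite TT'.
  move=> [[T _ LT] nB]; exists T => //; split => // BT; apply: nB; by exists T.
- move=> A CA; rewrite /C /= (_ : [set L | _] =
     \bigcup_n [set L : flag | exists2 T, A n T & val L j = chart_graph T]).
    exact: bigcupT_measurable.
  apply/seteqP; split => L /=; first by move=> [T [n _ An] LT]; exists n => //; exists T.
  by move=> [n _ [T An LT]]; exists T => //; exists n.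
- move=> A oA; have [m0 b0] := chart_bound_ex Om X.
  pose G n (K : 'M[F]_(m0 + n + (m0 + n))) := forall T : chart_matrix F Om X,
    lev (m0 + n) (chart_graph T) = K -> A T.
  rewrite /C /= (_ : [set L | _] = [set L : flag | chart_complement Om X (val L j)] `&`
    \bigcup_n [set L : flag | G n (lev (m0 + n) (val L j))]).
    apply: measurableI; first exact: chart_complement_measurable.
    by apply: bigcupT_measurable => n; apply: level_event_sigma; exact: level_event_lev.
  rewrite complE; apply/seteqP; split => L /=; last first.
    by move=> [[T _ LT] [n _ GL]]; exists T => //; apply: GL; rewrite LT.
  move=> [T AT LT]; split; first by exists T.
  have [m mP] := nbhs_agree_upto (open_nbhs_nbhs (conj oA AT)).
  exists m => // T' T'L; apply: (mP (m0 + m)%N); first exact: leq_addl.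
  by apply: lev_agree_upto; [exact: chart_bound_le (leq_addr _ _) b0|rewrite T'L LT].
Qed.

(** Countably many charts cover the semi-infinite subspaces. *)
Lemma cylinder_sigma : @flag_cylinders F I `<=` <<s level_event>>.
Proof.
move=> _ [j [S [SG bS ->]]].
suff H : measurable ([set L : flag | S (val L j)] : set sflag) by exact: H.
rewrite (_ : [set L : flag | _] = \bigcup_(p in [set: ({fset nat} * {fset nat})%type])
   [set L : flag | exists2 T, (@chart_graph F p.1 p.2 @^-1` S) T & val L j = chart_graph T]).
  apply: (@countable_bigcupT_measurable _ sflag) => // p.
  apply: chart_borel_measurable; exact: bS.
apply/seteqP; split => L /=; last by move=> [p _ [T ST ->]].
move=> SL; have [n /(_ _ (leqnn n)) [gL _]] := Gr_eventually (flag_Gr L j).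
have [Om [X [_ cL]]] := transverse_chart (flag_subspace L j) gL.
have [T LT] := complement_chart_graph (flag_subspace L j) cL.
by exists (Om, X) => //; exists T => //=; rewrite -LT.
Qed.

Lemma flag_measurableE (A : set flag) :
  measurable (A : set (flag_space F I)) <-> measurable (A : set sflag).
Proof.
split => [mA|mA].
  suff : <<s @flag_cylinders F I>> `<=` <<s level_event>> by apply.
  apply: smallest_sub; first exact: smallest_sigma_algebra.
  exact: cylinder_sigma.
suff : <<s level_event>> `<=` <<s @flag_cylinders F I>> by apply.
apply: smallest_sub; first exact: smallest_sigma_algebra.
exact: level_event_measurable.
Qed.

Lemma transverse_measurable n (j : I) : measurable ([set L : flag | transverse n (val L j)]
  : set (flag_space F I)).
Proof.
apply/flag_measurableE.
rewrite (_ : [set L | _] = \bigcup_(p in [set p : ({fset nat} * {fset nat})%type |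
  chart_bound p.1 p.2 n])
   [set L : flag | chart_complement p.1 p.2 (val L j)]).
  rewrite bigcup_mkcond; apply: (@countable_bigcupT_measurable _ sflag) => // p.
  by case: ifP => // _; exact: chart_complement_measurable.
apply/seteqP; split => L /=; last by move=> [p bp] /(chart_complement_transverse bp).
by move=> /(transverse_chart (flag_subspace L j))[Om [X [b c]]]; exists (Om, X).
Qed.

End Flags.

(** * Orbit counting and uniqueness *)

Lemma index_window (x : int) m (i : nat) : x + m%:Z = i%:Z -> (i < (m + m).+1)%N ->
  (`|x| <= m)%N.
Proof. by lia. Qed.

Section Orbits.
Variables (F : finFieldType) (I : set int).
Local Notation E := (E F).
Local Notation flag := (flag F I).
Implicit Types (L : flag) (g f : {linear E -> E}).

Definition pullback g (A : set flag) : set flag := [set L | A (flag_act g L)].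

Lemma pullback_level_event g f A : linear_homeo g f -> (forall (j : int) M, Gr j M ->
  Gr j (g @` M)) ->
  level_event A -> level_event (pullback g A).
Proof.
move=> gf gG [m Am]; have [N NP] := lev_image_determined m gf.
exists (maxn m N) => L L' LL'; apply: Am => j jm; rewrite !flag_actE//.
apply: NP; [exact: flag_subspace|exact: flag_subspace|].
apply: (lev_le (leq_maxr m N)); [exact: flag_subspace|exact: flag_subspace|].
by apply: LL'; exact: leq_trans jm (leq_maxl _ _).
Qed.

Lemma flag_actK g f L : linear_homeo g f -> (forall (j : int) M, Gr j M -> Gr j (g @` M)) ->
  (forall (j : int) M, Gr j M -> Gr j (f @` M)) -> flag_act f (flag_act g L) = L.
Proof.
move=> [_ _ gf fg] gG fG; apply: flag_eq => j; rewrite !flag_actE// image_comp.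
by rewrite (_ : f \o g = id) ?image_id//; apply/funext.
Qed.

Lemma translate_pullback g f (A : set flag) : linear_homeo g f ->
  (forall (j : int) M, Gr j M -> Gr j (g @` M)) ->
  (forall (j : int) M, Gr j M -> Gr j (f @` M)) ->
  flag_translate g (A : set (flag_space F I)) = pullback f A.
Proof.
move=> gf gG fG; apply/seteqP; split => L' /=.
  move=> [L AL LL']; rewrite /pullback /= (_ : flag_act f L' = L)//.
  rewrite -(flag_actK L gf gG fG); congr flag_act; apply: flag_eq => j.
  by rewrite flag_actE.
move=> AL; exists (flag_act f L') => // j.
by rewrite -(flag_actE _ _ gG) (flag_actK L' (linear_homeo_sym gf) fG gG).
Qed.

Lemma flag_act_finitary N (h : 'M[F]_(N + N)) L j : h \in unitmx ->
  val (flag_act (finitary h) L) j = finitary h @` val L j.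
Proof. by move=> hu; apply: flag_actE => k M; exact: Gr_finitary. Qed.

Lemma translate_finitary N (h : 'M[F]_(N + N)) (A : set flag) : h \in unitmx ->
  flag_translate (finitary (invmx h)) (A : set (flag_space F I)) = pullback (finitary h) A.
Proof.
move=> hu; have hiu : invmx h \in unitmx by rewrite unitmx_inv.
apply: translate_pullback; first exact/linear_homeo_sym/finitary_homeo.
- by move=> j M; exact: Gr_finitary.
- by move=> j M; exact: Gr_finitary.
Qed.

Lemma pullback_finitary N (h : 'M[F]_(N + N)) A : h \in unitmx ->
  level_event A -> level_event (pullback (finitary h) A).
Proof. by move=> hu; apply: (pullback_level_event (finitary_homeo hu)) => j M;
  exact: Gr_finitary. Qed.

Definition transverse_flags N m : set flag := [set L | forall j : I, (`|val j| <= m)%N ->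
  transverse N (val L j)].

Lemma transverse_flags_finitary N m (h : 'M[F]_(N + N)) L : h \in unitmx ->
  transverse_flags N m (flag_act (finitary h) L) <-> transverse_flags N m L.
Proof.
move=> hu; have hiu : invmx h \in unitmx by rewrite unitmx_inv.
split => gL j jm; have := gL j jm; rewrite flag_act_finitary//; last exact: finitary_transverse.
move=> /(finitary_transverse hiu); rewrite image_comp (_ : _ \o _ = id) ?image_id//.
by apply/funext => x /=; rewrite finitaryK.
Qed.

Hypothesis cI : forall i j k : int, I i -> I k -> i <= j <= k -> I j.

(** The level N of the member of degree j has rank N + j in both flags, and the
    inclusions between consecutive members form one chain as I is convex. *)
Lemma finitary_transitive m N L L' : (m <= N)%N -> transverse_flags N m L ->
  transverse_flags N m L' ->
  exists2 k : 'M[F]_(N + N), k \in unitmx &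
    forall j : I, (`|val j| <= m)%N -> (lev N (val L j) *m k :=: lev N (val L' j))%MS.
Proof.
move=> mN gL gL'.
(* Degrees are shifted by m so as to be indexed by natural numbers. *)
pose K (L : flag) (i : nat) : 'M[F]_(N + N) :=
  if pselect (I (i%:Z - m%:Z)) is left Ij then lev N (val L (mem_index Ij)) else 0.
pose p (i : nat) := `[< I (i%:Z - m%:Z) >] && (i <= m + m)%N.
have KE L0 i (Ii : I (i%:Z - m%:Z)) : K L0 i = lev N (val L0 (mem_index Ii)).
  rewrite /K; case: pselect => // Ij; congr (lev N (val L0 _)); exact: val_inj.
have pm i (Ii : I (i%:Z - m%:Z)) : (i <= m + m)%N -> (`|(val (mem_index Ii) : int)%R| <= m)%N.
  by move=> im; rewrite /=; lia.
have sK L0 i : p i -> p i.+1 -> (K L0 i <= K L0 i.+1)%MS.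
  move=> /andP[/asboolP Ii _] /andP[/asboolP Ii1 _]; rewrite (KE _ _ Ii) (KE _ _ Ii1).
  apply: levS; [exact: flag_subspace|exact: flag_subspace|apply: flag_sub => /=].
  by lia.
have [||||k ku kE] := @unitmx_flags F (N + N) (m + m) p (K L) (K L').
- move=> i j l ijl /andP[/asboolP Ii im] /andP[/asboolP Il lm]; apply/andP; split; last lia.
  by apply/asboolP; apply: (cI Ii Il); lia.
- exact: sK.
- exact: sK.
- move=> i /andP[/asboolP Ii im]; rewrite !(KE _ _ Ii).
  have r1 := Gr_transverse_rank (flag_Gr L (mem_index Ii)) (gL _ (pm _ Ii im)).
  have r2 := Gr_transverse_rank (flag_Gr L' (mem_index Ii)) (gL' _ (pm _ Ii im)).
  by apply/eqP; rewrite -eqz_nat r1 r2.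
exists k => // j jm; have [im ij] := shift_index jm.
have Ii : I ((absz (val j + m%:Z))%:Z - m%:Z) by rewrite ij; exact: set_valP.
have -> : j = mem_index Ii by apply: val_inj; rewrite /= ij.
have := kE (absz (val j + m%:Z)); rewrite !(KE _ _ Ii); apply; first by [].
by apply/andP; split; [exact/asboolP|].
Qed.

Definition hits N (A : set flag) L : nat :=
  (\sum_(h : 'M[F]_(N + N) | h \in unitmx) `[< pullback (finitary h) A L >])%N.

(** If k carries the levels of L to those of L', then L moved by k h and L' moved by h
    have the same levels, and multiplication by k permutes GL_2N. *)
Lemma hits_transverse m N (A : set flag) L L' : (m <= N)%N -> transverse_flags N m L ->
  transverse_flags N m L' ->
  (forall L L', same_levels m L L' -> A L -> A L') -> hits N A L = hits N A L'.
Proof.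
move=> mN gL gL' Am; have [k ku kE] := finitary_transitive mN gL gL'.
rewrite /hits -(sum_unitmx_mull (fun h => nat_of_bool `[< pullback (finitary h) A L >]) ku).
apply: eq_bigr => h hu; apply: (congr1 nat_of_bool).
have khu : k *m h \in unitmx by rewrite unitmx_mul ku.
have s : same_levels m (flag_act (finitary (k *m h)) L) (flag_act (finitary h) L').
  move=> j jm; have sj := flag_subspace L j; have sj' := flag_subspace L' j.
  apply: (etrans (congr1 (lev m) (flag_act_finitary L j khu))).
  apply: (etrans _ (esym (congr1 (lev m) (flag_act_finitary L' j hu)))).
  apply: (lev_le mN); try exact: subspace_image.
  rewrite -[LHS]lev_genmx -[RHS]lev_genmx; apply/genmxP/eqmxP.
  apply: eqmx_trans (lev_finitary sj khu) _; apply: eqmx_trans _ (eqmx_sym (lev_finitary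
    sj' hu)).
  by rewrite mulmxA; apply: eqmxMr; exact: kE.
apply: asbool_equiv_eq; split; first exact: Am.
by apply: Am => j jm; apply/esym/s.
Qed.

End Orbits.

Section Uniqueness.
Variables (R : realType) (F : finFieldType) (I : set int).
Local Notation E := (E F).
Local Notation flag := (flag F I).
Hypothesis cI : forall i j k : int, I i -> I k -> i <= j <= k -> I j.
Local Notation G N := #|[pred h : 'M[F]_(N + N) | h \in unitmx]|.

Lemma transverse_flags_measurable N m : measurable (@transverse_flags F I N m : set
  (flag_space F I)).
Proof.
rewrite (_ : transverse_flags N m = \bigcap_(i in [set: 'I_(m + m).+1])
  [set L : flag | forall j : I, (val j + m%:Z = (i : nat)%:Z) -> transverse N (val L j)]);
    last first.
  apply/seteqP; split => L /= H.
    by move=> i _ j ij; apply: H; apply: index_window ij (ltn_ord i).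
  move=> j jm; have [im ij] := shift_index jm; apply: (H (Ordinal im)) => //=.
  by rewrite -{1}ij subrK.
apply: (@fin_bigcap_measurable _ (flag_space F I)); first exact: finite_finset.
move=> i _; have [[j ji]|nj] := pselect (exists j : I, val j + m%:Z = (i : nat)%:Z).
  rewrite (_ : [set L | _] = [set L : flag | transverse N (val L j)]);
    first exact: transverse_measurable.
  apply/seteqP; split => L /=; first exact.
  move=> gL j' j'i; suff -> : j' = j by [].
  by apply/val_inj/(addIr m%:Z); rewrite j'i ji.
rewrite (_ : [set L | _] = setT)//; apply/seteqP; split => // L _ j ji.
by case: nj; exists j.
Qed.

Variable Q : probability (flag_space F I) R.
Hypothesis invQ : GL0_invariant Q.

Lemma invariant_pullback N (h : 'M[F]_(N + N)) (A : set (flag_space F I)) : h \in unitmx ->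
  measurable A -> Q (pullback (finitary h) A) = Q A.
Proof.
move=> hu mA; rewrite -translate_finitary// invQ//.
by apply: finitary_GL0; rewrite unitmx_inv.
Qed.

(** Integrate over the transverse flags the number of h that move the flag into A.
    The integrand is constant by [hits_transverse], and each h contributes the
    same measure by invariance. *)
Lemma orbit_count m N (A : set flag) L0 : (m <= N)%N -> transverse_flags N m L0 ->
  (forall L L', same_levels m L L' -> A L -> A L') ->
  (Q (A `&` transverse_flags N m) * (G N)%:R%:E = (hits N A L0)%:R%:E * Q (transverse_flags
    N m))%E.
Proof.
move=> mN gL0 Am; have aA : level_event A by exists m.
have mA : measurable (A : set (flag_space F I)) by exact: level_event_measurable.
have mG := @transverse_flags_measurable N m.
have mAG : measurable (A `&` transverse_flags N m : set (flag_space F I)).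
  exact: (@measurableI _ (flag_space F I)).
have mB (h : 'M[F]_(N + N)) : h \in unitmx ->
    measurable (pullback (finitary h) A : set (flag_space F I)).
  by move=> hu; apply: level_event_measurable; exact: pullback_finitary.
have QB (h : 'M[F]_(N + N)) : h \in unitmx ->
    Q (pullback (finitary h) A `&` transverse_flags N m) = Q (A `&` transverse_flags N m).
  move=> hu; rewrite -(invariant_pullback hu mAG).
  congr (Q _); apply/seteqP; split => L /= [AL gL]; split => //.
    exact/transverse_flags_finitary.
  exact/(transverse_flags_finitary _ _ hu).
pose f (h : 'M[F]_(N + N)) : flag_space F I -> \bar R :=
  if h \in unitmx then fun L => (\1_(pullback (finitary h) A) L)%:E else cst 0%E.
have := @ge0_integral_sum _ _ _ Q _ mG _ f _ _ (index_enum _).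
rewrite (eq_integral (cst (hits N A L0)%:R%:E)); last first.
  move=> L /set_mem gL; rewrite -(hits_transverse cI mN gL gL0 Am) /hits natr_sum -sumEFin
    [RHS]big_mkcond/=.
  apply: eq_bigr => h _; rewrite /f; case: ifP => // hu; rewrite indicE.
rewrite integral_cst// => H; rewrite H; first last.
- by move=> h L _; rewrite /f; case: ifP => // _; rewrite lee_fin indicE ler0n.
- move=> h; rewrite /f; case: ifP => hu; last exact: measurable_cst.
  by apply/measurable_EFinP/measurable_indic; exact: mB.
rewrite (eq_bigr (fun h : 'M[F]_(N + N) => if h \in unitmx then Q (A `&` transverse_flags N
  m) else 0%E)); last first.
  move=> h _; rewrite /f; case: ifP => hu; last by rewrite integral0.
  by rewrite integral_indic//; [exact: QB|exact: mB].
have fQ (A' : set (flag_space F I)) : measurable A' -> Q A' \is a fin_num.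
  by move=> mA'; exact: fin_num_measure.
rewrite -(fineK (fQ _ mAG)) -[in RHS](fineK (fQ _ mAG)) -big_mkcond/= sumEFin sumr_const
  -EFinM mulr_natr.
by congr ((_ *+ _)%:E); apply: eq_card => h; rewrite !inE.
Qed.

Lemma transverse_flags_le N N' m : (N <= N')%N ->
  @transverse_flags F I N m `<=` transverse_flags N' m.
Proof. by move=> NN' L gL j jm; apply: transverse_le NN' _; exact: gL. Qed.

Lemma transverse_flags_eventually m (L : flag) : exists N, transverse_flags N m L.
Proof.
have /choice[N NP] : forall j : I, exists N, transverse N (val L j).
  by move=> j; have [n /(_ _ (leqnn n))[gL _]] := Gr_eventually (flag_Gr L j); exists n.
pose n (i : 'I_(m + m).+1) : nat :=
  if pselect (I ((i : nat)%:Z - m%:Z)) is left Ij then N (mem_index Ij) else 0.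
exists (\max_i n i) => j jm; have [im ij] := shift_index jm.
have Ii : I ((Ordinal im : nat)%:Z - m%:Z) by rewrite /= ij; exact: set_valP.
apply: transverse_le (NP j); apply: leq_trans (leq_bigmax (Ordinal im)).
rewrite /n; case: pselect => // Ij.
by have -> : mem_index Ij = j by apply: val_inj; rewrite /= ij.
Qed.

Lemma transverse_flags_cvg m (A : set (flag_space F I)) : measurable A ->
  Q (A `&` transverse_flags N m) @[N --> \oo] --> Q A.
Proof.
move=> mA; have E : A = \bigcup_N (A `&` transverse_flags N m).
  apply/seteqP; split => L; last by move=> [N _ []].
  by move=> AL; have [N gN] := transverse_flags_eventually m L; exists N.
have mAG N : measurable (A `&` transverse_flags N m : set (flag_space F I)).
  by apply: measurableI => //; exact: transverse_flags_measurable.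
rewrite [in X in _ --> X]E; apply: nondecreasing_cvg_mu => //.
  by rewrite -E.
move=> N N' NN'; apply/subsetPset; apply: setIS; exact: transverse_flags_le.
Qed.

End Uniqueness.

Section UniquenessConclusion.
Variables (R : realType) (F : finFieldType) (I : set int).
Hypothesis cI : forall i j k : int, I i -> I k -> i <= j <= k -> I j.

(** By [orbit_count], with Gamma_N for the flags transverse at level N in the degrees
    up to m, P(A and Gamma_N) Q(Gamma_N) = Q(A and Gamma_N) P(Gamma_N). The sets
    Gamma_N exhaust the flags, so that P(A) Q(all) = Q(A) P(all) in the limit. *)
Lemma invariant_level_event_unique (P Q : probability (flag_space F I) R) (A : set (flag F I)) :
  GL0_invariant P -> GL0_invariant Q -> level_event A -> P A = Q A.
Proof.
move=> invP invQ aA; have [m Am] := aA.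
have mA : measurable (A : set (flag_space F I)) := level_event_measurable aA.
have cv (P' : probability (flag_space F I) R) (B : set (flag_space F I)) : measurable B ->
    fine (P' (B `&` transverse_flags N m)) @[N --> \oo] --> fine (P' B).
  by move=> mB; apply: fine_cvg; rewrite fineK ?fin_num_measure//; exact: transverse_flags_cvg.
have mT := @measurableT _ (flag_space F I).
have fT (P' : probability (flag_space F I) R) : fine (P' setT) = 1.
  by rewrite probability_setT.
have H1 : fine (P (A `&` transverse_flags N m)) * fine (Q (setT `&` transverse_flags N m))
  @[N --> \oo] -->
    fine (P A) * fine (Q setT).
  by apply: cvgM; exact: cv.
have H2 : fine (Q (A `&` transverse_flags N m)) * fine (P (setT `&` transverse_flags N m))
  @[N --> \oo] -->
    fine (Q A) * fine (P setT).
  by apply: cvgM; exact: cv.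
rewrite -[LHS]fineK ?fin_num_measure// -[RHS]fineK ?fin_num_measure//; congr EFin.
rewrite -[LHS]mulr1 -[RHS]mulr1 -{1}(fT Q) -{1}(fT P).
apply: (cvg_unique (@Rhausdorff R) H1); apply: (fun h => cvg_trans (near_eq_cvg h) H2).
have [N0 gN0] := transverse_flags_eventually m (flag0 F I).
exists (maxn m N0) => // N /=; rewrite geq_max => /andP[mN N0N].
have gN := transverse_flags_le N0N gN0.
have mG := @transverse_flags_measurable F I N m.
have mAG : measurable (A `&` transverse_flags N m : set (flag_space F I)).
  exact: (@measurableI _ (flag_space F I)).
have eqP' (P' : probability (flag_space F I) R) : GL0_invariant P' ->
    fine (P' (A `&` transverse_flags N m)) * #|[pred h : 'M[F]_(N + N) | h \in unitmx]|%:R =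
    (hits N A (flag0 F I))%:R * fine (P' (setT `&` transverse_flags N m)).
  move=> invP'; have := orbit_count cI invP' mN gN Am.
  rewrite setTI -[P' (A `&` _)]fineK ?fin_num_measure// -[P' (transverse_flags _ _)]fineK
    ?fin_num_measure//.
  by rewrite -!EFinM => -[].
have u0 : #|[pred h : 'M[F]_(N + N) | h \in unitmx]|%:R != 0 :> R.
  by rewrite pnatr_eq0 -lt0n; apply/card_gt0P; exists 1%:M; rewrite inE unitmx1.
apply: (mulIf u0); rewrite mulrAC (eqP' _ invQ) [RHS]mulrAC (eqP' _ invP).
by rewrite -!mulrA; congr (_ * _); rewrite mulrC.
Qed.

End UniquenessConclusion.

Lemma level_event_measure_unique (R : realType) (F : finFieldType) (I : set int)
    (P Q : {measure set (flag_space F I) -> \bar R}) :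
  (P setT < +oo)%E -> (forall A, @level_event F I A -> P A = Q A) ->
  forall A : set (flag_space F I), measurable A -> P A = Q A.
Proof.
move=> PT PQ A /flag_measurableE mA.
apply: (@g_sigma_algebra_measure_unique _ R (flag_space F I) (@level_event F I) _ (fun=>
  setT)) => //.
- by move=> B; exact: level_event_measurable.
- by move=> _; exact: level_eventT.
- by rewrite bigcup_const//; exists 0%N.
- by move=> B C; exact: level_eventI.
Qed.

(** * Most translates of a flag are transverse *)

Section Tightness.
Variable F : finFieldType.
Local Notation E := (E F).
Local Notation G N := #|[pred h : 'M[F]_(N + N) | h \in unitmx]|.
Local Notation q := #|F|.

Definition bad_ops m N (M : set E) : pred 'M[F]_(N + N) :=
  [pred h : 'M[F]_(N + N) | (h \in unitmx) && `[< ~ transverse m (finitary h @` M) >]].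

Arguments bad_ops : clear implicits.

(** As h M is transverse at level N, both halves of transversality at level m can be
    tested inside F^(2N). *)
Lemma not_transverse_cases m N j (M : set E) (h : 'M[F]_(N + N)) : (m <= N)%N -> Gr j M ->
  transverse N M ->
  h \in unitmx -> ~ transverse m (finitary h @` M) ->
  [exists x : 'rV[F]_(N + N), [&& (x <= lev N M)%MS,
    x != 0 & (x *m h <= lev N (@Us F m))%MS]] \/
  ~~ row_full (lev N M *m h + lev N (@Vs F m))%MS.
Proof.
move=> mN GM gM hu ng; apply: contrapT => /not_orP[/negP/existsPn nx /negP];
  rewrite negbK => full.
have sM := GM.1; have ghM := finitary_transverse hu gM;
  have shM := subspace_image (finitary h) sM.
apply: ng; split => [_ [x Mx <-] Ux|x].
  have Vfx : Vs N (finitary h x) by exact: UsVs Ux.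
  have Vx : Vs N x by rewrite -[x](finitaryK hu); exact: finitary_Vs.
  have [x0|x0] := eqVneq (prj N x) 0.
    have -> : x = 0 by apply: gM.1 => //; apply/Us_prj.
    exact: (linear0 (finitary h)).
  have := nx (prj N x); rewrite x0 lev_sub//= -prj_finitary lev_sub//; exact: Us_sub.
have [y hMy Vy] := ghM.2 x.
have : (prj N (x - y) <= lev N M *m h + lev N (@Vs F m))%MS by exact: submx_full.
move=> /sub_addsmxP[[u v] /= uv].
have : (u *m (lev N M *m h) <= lev N (finitary h @` M))%MS by rewrite lev_finitary// submxMl.
move=> /levP -/(_ shM)[z [hMz Vz zu]].
have [w [Vmw Vw wv]] := (levP _ (Vs_sub F m)).1 (submxMl v (lev N (@Vs F m))).
exists (y + z); first exact: (subspaceD shM).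
apply/(subspaceBr (Vs_sub F m) _ Vmw)/(UsVs (M := N)).
have -> : x - (y + z) - w = (x - y) - (z + w) by rewrite !opprD !addrA.
apply: Us_subprj => //; first exact: (subspaceD (Vs_sub F N)).
by rewrite uv [RHS]linearD/= zu wv.
Qed.

(** With ranks N + j for M, N - m for U_m and N + m for V_m, the two failures have
    proportions at most q^(j - m) and q^(-j - m), by [count_meet] and
    [count_not_full]. *)
Lemma count_bad_ops m N j (M : set E) : (0 < N)%N -> (m <= N)%N -> (`|j| <= m)%N ->
  Gr j M -> transverse N M ->
  (#|bad_ops m N M| * q ^ m <= 2 * (G N * q ^ `|j|))%N.
Proof.
move=> N0 mN jm GM gM; have NN0 : (0 < N + N)%N by lia.
have q1 : (1 < q)%N by exact: card_finNzRing_gt1.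
have rM := Gr_transverse_rank GM gM.
have rU := @rank_Us F N m mN; have rV := @rank_Vs F N m mN.
set A := lev N M in rM; set B := lev N (@Us F m) in rU; set C := lev N (@Vs F m) in rV.
have [d dE] : exists d : nat, d%:Z = m%:Z + j by exists (absz (m%:Z + j)); lia.
have rAC : (\rank A + \rank C = N + N + d)%N by lia.
have := count_not_full NN0 rAC; set b2 := #|_| => H2.
have := count_meet A B NN0; set b1 := #|_| => H1.
have GE : #|finset (fun h : 'M[F]_(N + N) => h \in unitmx)| = G N by rewrite cardsE.
rewrite GE in H1 H2.
have qp k : (0 < q ^ k)%N by rewrite expn_gt0 (ltnW q1).
have {}H1 : (b1 * q ^ m <= G N * q ^ `|j|)%N.
  rewrite -(@leq_pmul2r (q ^ (N + N))) ?qp// -mulnA (mulnC (q ^ m)%N) mulnA.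
  apply: leq_trans (leq_mul H1 (leqnn _)) _.
  rewrite -!mulnA -!expnD leq_mul2l leq_exp2l//; apply/orP; right; lia.
have {}H2 : (b2 * q ^ m <= G N * q ^ `|j|)%N.
  apply: leq_trans (leq_mul H2 (leqnn _)).
  by rewrite -mulnA -expnD leq_mul2l leq_exp2l//; apply/orP; right; lia.
have : (#|bad_ops m N M| <= b1 + b2)%N.
  rewrite -[#|bad_ops _ _ _|]cardsE; apply: leq_trans (leq_card_setU _ _).
  apply/subset_leq_card/fintype.subsetP => h; rewrite !inE => /andP[hu /asboolP ng].
  by rewrite hu/=; apply/orP; exact: (not_transverse_cases mN GM gM hu ng).
move=> H; apply: leq_trans (leq_mul H (leqnn _)) _.
by rewrite mulnDl mul2n -addnn leq_add.
Qed.

End Tightness.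
Arguments bad_ops {F} m N M.

Section FlagTightness.
Variables (F : finFieldType) (I : set int).
Local Notation flag := (flag F I).
Local Notation G N := #|[pred h : 'M[F]_(N + N) | h \in unitmx]|.

(** The threshold 2|j| + s absorbs the factor q^|j| of [count_bad_ops] and leaves a
    proportion of order q^-(|j| + s), which is summable over j. *)
Definition bad_flag_ops s k N (L : flag) : pred 'M[F]_(N + N) :=
  [pred h : 'M[F]_(N + N) | (h \in unitmx) &&
    `[< exists j : I, (`|val j| <= k)%N /\ ~ transverse (`|val j| + `|val j| + s) (finitary
      h @` val L j) >]].
Arguments bad_flag_ops : clear implicits.

(** Each degree j costs at most 2 / 2^(|j| + s), as q >= 2. Over the degrees |j| <= k
    this adds up to (2 + 4 (1/2 + ... + 1/2^k)) / 2^s = (6 - 4/2^k) / 2^s, which is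
    the stated bound. It is essential that it stays below 6 / 2^s for all k and N. *)
Lemma count_bad_flag_ops s k N (L : flag) : (0 < N)%N -> (k + k + s <= N)%N ->
  (forall j : I, (`|val j| <= k)%N -> transverse N (val L j)) ->
  (#|bad_flag_ops s k N L| * 2 ^ (k + s) <= G N * (6 * 2 ^ k - 4))%N.
Proof.
move=> N0; set q := #|F|.
have q1 : (1 < q)%N by exact: card_finNzRing_gt1.
(* The share of degree j, which is empty when j lies outside I. *)
have one (j : int) : (`|j| + `|j| + s <= N)%N -> (forall j' : I, val j' = j ->
  transverse N (val L j')) ->
   (#|[pred h : 'M[F]_(N + N) | (h \in unitmx) &&
     `[< exists j' : I, val j' = j /\ ~ transverse (`|j| + `|j| + s) (finitary h @` val L
       j') >]]| *
      2 ^ (`|j| + s) <= 2 * G N)%N.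
  move=> jN gL; have [Ij|nIj] := pselect (I j); last first.
    rewrite eq_card0 ?mul0n// => h; rewrite !inE; apply/negP => /andP[_ /asboolP[j' [j'j _]]].
    by apply: nIj; rewrite -j'j; exact: set_valP.
  have jm : (`|j| <= `|j| + `|j| + s)%N by lia.
  set P' := [pred h | _]; have bE : #|bad_ops (`|j| + `|j| + s) N (val L (mem_index Ij))| =
    #|P'|.
    apply: eq_card => h; rewrite !inE; case: (h \in unitmx) => //=.
    apply: asbool_equiv_eq; split; first by exists (mem_index Ij).
    by move=> [j' [j'j]]; suff -> : j' = mem_index Ij by []; exact: val_inj.
  have := count_bad_ops N0 jN jm (flag_Gr L (mem_index Ij)) (gL (mem_index Ij) erefl).
  rewrite bE -/q; move: #|P'| => b H.
  have qp k' : (0 < q ^ k')%N by rewrite expn_gt0 (ltnW q1).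
  have {}H : (b * q ^ (`|j| + s) <= 2 * G N)%N.
    rewrite -(@leq_pmul2r (q ^ `|j|)) ?qp// -!mulnA -expnD.
    by rewrite (_ : (`|j| + s + `|j|)%N = (`|j| + `|j| + s)%N)//; lia.
  apply: leq_trans H; rewrite leq_mul2l; apply/orP; right.
  by elim: (`|j| + s)%N => // n IH; rewrite !expnS leq_mul.
elim: k => [|k IH] kN gL.
  have := one 0; rewrite !absz0 !add0n => H; rewrite expn0 muln1 [leqRHS]mulnC.
  apply: leq_trans (H _ _); [|by lia|by move=> j' j0; apply: gL; rewrite j0].
  rewrite leq_mul2r; apply/orP; right; apply/subset_leq_card/fintype.subsetP => h; rewrite !inE.
  move=> /andP[-> /asboolP[j [j0 ng]]]; apply/asboolP; exists j.
  by move: j0; rewrite leqn0 => /eqP j0; rewrite j0 in ng; split=> //; apply/eqP;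
    rewrite -absz_eq0 j0.
have {}IH : (#|bad_flag_ops s k N L| * 2 ^ (k + s) <= G N * (6 * 2 ^ k - 4))%N.
  by apply: IH => [|j jk]; [lia|apply: gL; lia].
have gk (j : int) (j' : I) : val j' = j -> (`|j| = k.+1)%N -> transverse N (val L j').
  by move=> j'j jk; apply: gL; rewrite j'j jk.
have := one k.+1%:Z; rewrite absz_nat; set B1 := [pred h | _] => H1.
have := one (- k.+1%:Z); rewrite abszN absz_nat; set B2 := [pred h | _] => H2.
have {}H1 : (#|B1| * 2 ^ (k.+1 + s) <= 2 * G N)%N by apply: H1 => // j' j'j;
  exact: (gk _ _ j'j).
have {}H2 : (#|B2| * 2 ^ (k.+1 + s) <= 2 * G N)%N.
  by apply: H2 => // j' j'j; apply: (gk _ _ j'j); rewrite abszN.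
have : (#|bad_flag_ops s k.+1 N L| <= #|bad_flag_ops s k N L| + (#|B1| + #|B2|))%N.
  rewrite -[#|B1|]cardsE -[#|B2|]cardsE -[#|bad_flag_ops s k N L|]cardsE -[#|bad_flag_ops s
    k.+1 N L|]cardsE.
  apply: leq_trans (_ : (_ <= #|finset (bad_flag_ops s k N L) :|: (finset B1 :|: finset
    B2)|)%N) _; last first.
    apply: leq_trans (leq_card_setU _ _) _; rewrite leq_add2l; exact: leq_card_setU.
  apply/subset_leq_card/fintype.subsetP => h; rewrite !inE /= => /andP[hu /asboolP[j [jk ng]]].
  have [jk'|jk'] := leqP `|val j| k.
    by apply/orP; left; rewrite /bad_flag_ops /= hu; apply/asboolP; exists j.
  have {}jk : (`|val j| = k.+1)%N by apply/eqP; rewrite eqn_leq jk.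
  apply/orP; right; rewrite hu; apply/orP; rewrite jk in ng; have [j0|j0] := leP 0 (val j).
    by left; apply/asboolP; exists j; split => //; rewrite -jk gez0_abs.
  by right; apply/asboolP; exists j; split => //; rewrite -jk ltz0_abs// opprK.
move=> H; apply: leq_trans (leq_mul H (leqnn _)) _.
rewrite mulnDl mulnDl; move: H1 H2 IH; rewrite addSn !expnS.
have : (2 ^ k > 0)%N by rewrite expn_gt0.
move: (2 ^ (k + s))%N (2 ^ k)%N => x y y0 H1 H2 H3.
have -> : (G N * (6 * (2 * y) - 4) = 2 * (G N * (6 * y - 4)) + (2 * G N + 2 * G N))%N.
  by rewrite !mulnBr; nia.
apply: leq_add; last exact: leq_add.
by rewrite mulnCA leq_mul2l.
Qed.

End FlagTightness.

(** * Ultralimits of flags *)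

Lemma free_ultrafilter_ex : exists U : set_system nat, UltraFilter U /\ \oo `<=` U.
Proof. exact: ultraFilterLemma. Qed.

Definition Ult : set_system nat := projT1 (cid free_ultrafilter_ex).
Lemma Ult_ultra : UltraFilter Ult. Proof. exact: (projT2 (cid free_ultrafilter_ex)).1. Qed.
#[global] Instance Ult_proper : ProperFilter Ult. Proof. by case: Ult_ultra. Qed.

Lemma Ult_tail (P : set nat) n : (forall k, (n <= k)%N -> P k) -> Ult P.
Proof. by move=> H; apply: (projT2 (cid free_ultrafilter_ex)).2; exists n. Qed.

Lemma UltT : Ult setT. Proof. exact: filterT. Qed.
Lemma UltI (P Q : set nat) : Ult P -> Ult Q -> Ult (P `&` Q). Proof. exact: filterI. Qed.
Lemma UltS (P Q : set nat) : P `<=` Q -> Ult P -> Ult Q. Proof. exact: filterS. Qed.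
Lemma Ult_nonempty (P : set nat) : Ult P -> exists k, P k. Proof. exact: filter_ex. Qed.

Lemma Ult_ex (P : set nat) n : Ult P -> exists2 k, (n <= k)%N & P k.
Proof.
move=> UP; have UQ : Ult [set k | (n <= k)%N] by apply: (@Ult_tail _ n).
by have [k [Pk nk]] := filter_ex (filterI UP UQ); exists k.
Qed.

Lemma Ult_const (T : finType) (f : nat -> T) : exists v, Ult [set k | f k = v].
Proof.
apply: contrapT => H.
have nU v : Ult (~` [set k | f k = v]).
  by have [Uv|//] := in_ultra_setVsetC [set k | f k = v] Ult_ultra; case: H; exists v.
have /Ult_nonempty[k] := @filter_forall _ T (fun v =>
  ~` [set k | f k = v]) Ult (@filter_filter _ _ Ult_proper) nU.
by move=> /(_ (f k)); apply.
Qed.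

Section UltralimitSubspace.
Variable F : finFieldType.
Local Notation E := (E F).
Local Arguments ecoord : simpl never.
Variables (M : nat -> set E) (j : int) (mu : nat).
Hypothesis GM : forall k, Gr j (M k).
Hypothesis gM : Ult [set k | transverse mu (M k)].
Let sM k : is_subspace (M k). Proof. by case: (GM k). Qed.

(** The vectors that can be approximated, in the topology of the space, by vectors of
    M k for almost all k along the ultrafilter. *)
Definition ulim : set E := [set x | forall n, Ult [set k | exists2 y, M k y & Us n (x - y)]].

Lemma ulim_subspace : is_subspace ulim.
Proof.
split.
  move=> n; apply: UltS UltT => k _; exists 0; first exact: subspace0.
  by rewrite subr0; exact: subspace0 (Us_sub F n).
move=> a x y xU yU n; have := UltI (xU n) (yU n); apply: UltS => k [[x' Mx' xx'] [y' My' yy']].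
exists (a *: x' + y'); first exact: (sM k).2.
rewrite opprD addrACA -scalerBr; exact: (Us_sub F n).2.
Qed.

(** V_n is compact: each coordinate takes finitely many values and is therefore
    constant along the ultrafilter, and the limit has its e-part bounded by n. *)
Lemma ulim_vector n (y : nat -> E) : Ult [set k | M k (y k) /\ Vs n (y k)] ->
  exists x, [/\ ulim x, Vs n x & forall N, Ult [set k | Us N (x - y k)]].
Proof.
move=> My; have /choice[x xP] : forall c, exists v, Ult [set k | ecoord (y k) c = v].
  by move=> c; exact: Ult_const.
have [z zx] : exists z : E, forall c, ecoord z c = x c.
  apply: (@vector_of_coords _ _ n) => i ni.
  by have [k [/= <- [_ Vk]]] := Ult_nonempty (UltI (xP (inl i)) My); apply: Vk;
    rewrite /= -leqNgt.
have Vz : Vs n z.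
  by move=> c nc; rewrite zx; have [k [/= <- [_ Vk]]] := Ult_nonempty (UltI (xP c) My);
    exact: Vk.
have Uz N : Ult [set k | Us N (z - y k)].
  set N' := maxn n N.
  have Uc : Ult [set k | forall i : 'I_(N' + N'), ecoord (y k) (idx i) = x (idx i)].
    apply: (@filter_forall _ _ (fun i => [set k | ecoord (y k) (idx i) = x (idx i)])) => i.
    exact: xP.
  apply: UltS (UltI My Uc) => k [[_ Vk] H].
  apply: (Us_le (leq_maxr n N)); apply: Us_subprj;
    [exact: Vs_le (leq_maxl _ _) _ Vz|exact: Vs_le (leq_maxl _ _) _ Vk|].
  by apply/rowP => i; rewrite !mxE zx; apply/esym/H.
exists z; split => // N; apply: UltS (UltI My (Uz N)) => k [[Mk _] zk].
by exists (y k).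
Qed.

(** Vectors of the limit are close modulo U_n, hence equal at level n, to vectors of
    the M k; conversely vectors of M k in V_n have limits by compactness. *)
Lemma lev_ulim n : Ult [set k | lev n (M k) = lev n ulim].
Proof.
have [K KP] := Ult_const (fun k => lev n (M k)).
suff -> : lev n ulim = K by [].
have [k0 K0] := Ult_nonempty KP.
rewrite -lev_genmx -K0 -[lev n (M k0)]lev_genmx; apply/genmxP/andP; split; apply/rV_subP => u.
  move=> /levP -/(_ ulim_subspace)[x [xU Vx <-]].
  have [k [[y My xy] /= Kk]] := Ult_nonempty (UltI (xU n) KP).
  rewrite K0 -Kk; have Vy : Vs n y.
    by rewrite -(subKr x y); apply: (subspaceB (Vs_sub F n)) => //; exact: UsVs xy.
  have -> : prj n x = prj n y.
    by apply/eqP; rewrite -subr_eq0 -linearB; apply/eqP; case/Us_prj: xy.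
  exact: lev_sub.
move=> uK; have /choice[y yP] : forall k, exists y, lev n (M k) = K ->
  [/\ M k y, Vs n y & prj n y = u].
  move=> k; have [E|] := pselect (lev n (M k) = K); last by exists 0.
  by have := uK; rewrite K0 -E => /levP -/(_ (sM k))[y yP]; exists y.
have [|x [xU Vx xy]] := @ulim_vector n y.
  by apply: UltS KP => k /yP[].
have [k [/yP[Mk Vk <-] xk]] := Ult_nonempty (UltI KP (xy n)).
have -> : prj n (y k) = prj n x.
  by apply/esym/eqP; rewrite -subr_eq0 -linearB; apply/eqP; case/Us_prj: xk.
exact: lev_sub ulim_subspace xU Vx.
Qed.

(** Both halves of transversality pass to the limit because the threshold mu is the
    same for almost all k: the first is a closed condition, and in the second
    the approximating vectors of M k stay in one compact V_N. *)
Lemma transverse_ulim : transverse mu ulim.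
Proof.
split => [x xU Ux|x].
  apply: Us_all => n; exists (maxn mu n); first exact: leq_maxr.
  have [k [[y My xy] gk]] := Ult_nonempty (UltI (xU (maxn mu n)) gM).
  suff y0 : y = 0 by rewrite y0 subr0 in xy.
  apply: gk.1 => //; rewrite -(subKr x y); apply: (subspaceB (Us_sub F mu)) => //.
  exact: Us_le (leq_maxl _ _) _ xy.
have /choice[y yP] : forall k, exists y, transverse mu (M k) -> M k y /\ Vs mu (x - y).
  move=> k; have [gk|] := pselect (transverse mu (M k)); last by exists 0.
  by have [y My xy] := gk.2 x; exists y.
have [N0 Vx] := Vs_ex x; set N := maxn mu N0.
have {}Vx : Vs N x := Vs_le (leq_maxr mu N0) Vx.
have [|z [zU Vz zy]] := @ulim_vector N y.
  apply: UltS gM => k /yP[My xy]; split => //.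
  rewrite -(subKr x (y k)); apply: (subspaceB (Vs_sub F N)) => //.
  exact: Vs_le (leq_maxl _ _) _ xy.
exists z => //; have [k [/yP[My xy] zk]] := Ult_nonempty (UltI gM (zy 0%N)).
have -> : x - z = (x - y k) - (z - y k) by rewrite opprB addrA subrK.
by apply: (subspaceB (Vs_sub F mu)) => //; exact: UsVs zk.
Qed.

Lemma Gr_ulim : Gr j ulim.
Proof.
apply: (Gr_intro ulim_subspace transverse_ulim).
have [k [/= <- gk]] := Ult_nonempty (UltI (lev_ulim mu) gM).
exact: Gr_transverse_rank.
Qed.

End UltralimitSubspace.

Section UltralimitFlag.
Variables (F : finFieldType) (I : set int).
Local Notation flag := (flag F I).

(** Flags whose members have prescribed transversality thresholds form a compact
    family: the ultralimits of the members make up a flag with the limiting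
    levels. *)
Lemma flag_compactness (mu : int -> nat) (L : nat -> flag) :
  (forall (k : nat) (j : I), (`|val j| <= k)%N -> transverse (mu (val j)) (val (L k) j)) ->
  exists L0 : flag, forall m, Ult [set k | same_levels m L0 (L k)].
Proof.
move=> gL.
have g (j : I) : Ult [set k | transverse (mu (val j)) (val (L k) j)].
  by apply: (@Ult_tail _ `|val j|) => k jk; exact: gL.
pose K (j : I) := ulim (fun k => val (L k) j).
have FK : @Fl F I K.
  split => [j|j k jk x xU n].
    by apply: Gr_ulim (g j) => k; exact: flag_Gr.
  by apply: UltS (xU n) => i [y My xy]; exists y => //; exact: flag_sub My.
exists (mkflag FK) => m.
have H (i : 'I_(m + m).+1) : Ult [set k | forall j : I, val j + m%:Z = (i : nat)%:Z ->
    lev m (K j) = lev m (val (L k) j)].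
  have [[j ji]|nj] := pselect (exists j : I, val j + m%:Z = (i : nat)%:Z); last first.
    by apply: UltS UltT => k _ j ji; case: nj; exists j.
  have := @lev_ulim F (fun k => val (L k) j) (val j) (fun k => flag_Gr (L k) j) m.
  apply: UltS => k /= E j' j'i; suff -> : j' = j by [].
  by apply/val_inj/(addIr m%:Z); rewrite j'i ji.
have : Ult [set k | forall (i : 'I_(m + m).+1) (j : I), val j + m%:Z = (i : nat)%:Z ->
    lev m (K j) = lev m (val (L k) j)].
  exact: (@filter_forall _ _ (fun i : 'I_(m + m).+1 => [set k | forall j : I,
    val j + m%:Z = (i : nat)%:Z -> lev m (K j) = lev m (val (L k) j)])).
apply: UltS => k Hk j jm; have [im ij] := shift_index jm.
by apply: (Hk (Ordinal im)); rewrite -{1}ij subrK.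
Qed.

End UltralimitFlag.

(** * Limiting frequencies of level events *)

Lemma Ult_cvg (R : realType) (f : nat -> R) : (forall N, 0 <= f N <= 1) ->
  cvg (f N @[N --> Ult]).
Proof.
move=> f01; have UI01 : (f N @[N --> Ult]) `[0, 1]%classic.
  by apply: UltS UltT => N _; rewrite /= in_itv/=.
have [p [_ clp]] := @segment_compact R 0 1 (f N @[N --> Ult]) _ UI01.
apply/cvg_ex; exists p => B Bp.
have [//|nB] := in_ultra_setVsetC (f @^-1` B) Ult_ultra.
have [x [nBx Bx]] := clp (~` B) B nB Bp.
by [].
Qed.

Section Content.
Variables (R : realType) (F : finFieldType) (I : set int).
Local Notation flag := (flag F I).
Local Notation G N := #|[pred h : 'M[F]_(N + N) | h \in unitmx]|.
Local Notation L0 := (flag0 F I).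

Lemma cardG_gt0 N : (0 < G N)%N.
Proof. by apply/card_gt0P; exists 1%:M; rewrite inE unitmx1. Qed.

Lemma hitsT N L : hits N [set: flag] L = G N.
Proof. by rewrite -sum1_card; apply: eq_bigr => h _; rewrite asboolT. Qed.

Lemma hits_le N (A : set flag) L : (hits N A L <= G N)%N.
Proof. by rewrite -(hitsT N L); apply: leq_sum => h _;
  rewrite [X in (_ <= nat_of_bool X)%N]asboolT// leq_b1. Qed.

Lemma hitsU N (A B : set flag) L : A `&` B = set0 ->
  hits N (A `|` B) L = (hits N A L + hits N B L)%N.
Proof.
move=> AB; rewrite /hits -big_split/=; apply: eq_bigr => h _.
have : ~ (pullback (finitary h) A L /\ pullback (finitary h) B L).
  by move=> [a b]; have : (A `&` B) (flag_act (finitary h) L) by []; rewrite AB.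
rewrite /pullback/=; do 3 case: asboolP => //=; tauto.
Qed.

Definition hit_freq N (A : set flag) : R := (hits N A L0)%:R / (G N)%:R.

Lemma hit_freq01 A N : 0 <= hit_freq N A <= 1.
Proof.
by rewrite divr_ge0 ?ler0n//= ler_pdivrMr ?ltr0n ?cardG_gt0// mul1r ler_nat hits_le.
Qed.

Definition limit_freq (A : set flag) : R := lim (hit_freq N A @[N --> Ult]).

Lemma limit_freq_cvg A : hit_freq N A @[N --> Ult] --> limit_freq A.
Proof. by apply: Ult_cvg => N; exact: hit_freq01. Qed.

Lemma limit_freq_eq A (l : R) : hit_freq N A @[N --> Ult] --> l -> limit_freq A = l.
Proof. by move=> h; exact: cvg_lim. Qed.

Lemma limit_freqT : limit_freq setT = 1.
Proof.
apply: limit_freq_eq; apply: cvg_near_cst.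
by apply: UltS UltT => N _; rewrite /hit_freq hitsT divff// pnatr_eq0 -lt0n cardG_gt0.
Qed.

Lemma limit_freqU A B : A `&` B = set0 -> limit_freq (A `|` B) = limit_freq A + limit_freq B.
Proof.
move=> AB; apply: limit_freq_eq.
apply: (fun h => cvg_trans (near_eq_cvg h) (cvgD (limit_freq_cvg (A :=
  A)) (limit_freq_cvg (A := B)))).
by apply: UltS UltT => N _; rewrite /hit_freq hitsU// natrD mulrDl.
Qed.

Lemma limit_freq_ge0 A : 0 <= limit_freq A.
Proof.
apply: limr_ge; first by apply: Ult_cvg => N; exact: hit_freq01.
by apply: UltS UltT => N _; case/andP: (hit_freq01 A N).
Qed.

Lemma limit_freq0 : limit_freq set0 = 0.
Proof. by have := @limit_freqU set0 set0; rewrite setI0 setU0 => /(_ erefl)/esym/eqP;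
  rewrite -subr_eq0 addrK => /eqP. Qed.

Lemma limit_freq_le A B : A `<=` B -> limit_freq A <= limit_freq B.
Proof.
move=> AB; rewrite -(setDUK AB) limit_freqU ?setDIK//.
by rewrite lerDl limit_freq_ge0.
Qed.

Lemma limit_freq_leU A B : limit_freq (A `|` B) <= limit_freq A + limit_freq B.
Proof.
have -> : A `|` B = A `|` (B `\` A).
  apply/seteqP; split => x [Ax|Bx]; [by left| |by left|by right; case: Bx].
  by have [Ax|nA] := pselect (A x); [left|right].
by rewrite limit_freqU ?setDIK// lerD2l; apply: limit_freq_le => x [].
Qed.

Lemma hits_finitary n N (h : 'M[F]_(n + n)) (A : set flag) L : (n <= N)%N -> h \in unitmx ->
  hits N (pullback (finitary h) A) L = hits N A L.
Proof.
move=> nN hu; have [h' h'u hh'] := finitary_widen nN hu.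
rewrite /hits -(sum_unitmx_mulr (fun k => nat_of_bool `[< pullback (finitary k) A L >]) h'u).
apply: eq_bigr => k ku; apply: (congr1 nat_of_bool); apply: (congr1 asbool).
rewrite /pullback /=; apply: (congr1 A); apply: flag_eq => j.
have kh' : k *m h' \in unitmx by rewrite unitmx_mul ku.
apply: (etrans (flag_act_finitary _ _ hu)); apply: (etrans _ (esym (flag_act_finitary _ _
  kh'))).
apply: (etrans (congr1 (image^~ (finitary h)) (flag_act_finitary L j ku))).
rewrite image_comp; apply: eq_imagel => x _ /=.
by rewrite hh' finitary_comp.
Qed.

Lemma limit_freq_finitary n (h : 'M[F]_(n + n)) A : h \in unitmx ->
  limit_freq (pullback (finitary h) A) = limit_freq A.
Proof.
move=> hu; apply: limit_freq_eq; apply: (fun e =>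
  cvg_trans (near_eq_cvg e) (limit_freq_cvg (A := A))).
by apply: (@Ult_tail _ n) => N nN; rewrite /hit_freq hits_finitary.
Qed.

(** For large N in the ultrafilter the event A has frequency above e / 2, whereas the
    operators that spoil transversality have frequency at most 6 / 2^s < e / 2. *)
Lemma limit_freq_pick (e : R) s k A : 0 < e -> e <= limit_freq A -> 12 < e * 2 ^+ s ->
  exists2 L, A L & forall j : I, (`|val j| <= k)%N ->
    transverse (`|val j| + `|val j| + s) (val L j).
Proof.
move=> e0 eA se; have [N0 gN0] := transverse_flags_eventually k L0.
have : Ult [set N | e / 2 < hit_freq N A].
  have : nbhs (limit_freq A) [set x : R | e / 2 < x].
    apply: open_nbhs_nbhs; split; first exact: open_gt.
    by rewrite /=; apply: lt_le_trans eA; rewrite ltr_pdivrMr// ltr_pMr// ltr1n.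
  by move=> /(@limit_freq_cvg A).
move=> /(@Ult_ex _ (maxn 1 (maxn (k + k + s) N0)))[N];
  rewrite !geq_max => /and3P[N1 ksN N0N] /= eN.
have gN := transverse_flags_le N0N gN0.
apply: contrapT => nex.
have : (hits N A L0 <= #|@bad_flag_ops F I s k N L0|)%N.
  rewrite -sum1_card /hits big_mkcond [leqRHS]big_mkcond; apply: leq_sum => h _.
  rewrite /bad_flag_ops inE; case: ifP => //= hu; case: asboolP => // Ah.
  case: asboolP => // nb; case: nex; exists (flag_act (finitary h) L0) => // j jk.
  rewrite flag_act_finitary//; apply: contrapT => ng; apply: nb; by exists j.
move=> le1; have le2 := count_bad_flag_ops N1 ksN gN.
have : (hits N A L0 * 2 ^ s <= 6 * G N)%N.
  have p2 : (0 < 2 ^ k)%N by rewrite expn_gt0.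
  rewrite -(leq_pmul2r p2) -mulnA -expnD addnC.
  apply: leq_trans (leq_mul le1 (leqnn _)) _; apply: leq_trans le2 _.
  by rewrite -mulnA mulnCA leq_mul2l leq_subr orbT.
rewrite -(ler_nat R) !natrM natrX => H.
have G0 : 0 < (G N)%:R :> R by rewrite ltr0n cardG_gt0.
move: eN; rewrite /hit_freq ltr_pdivlMr// => eN.
have : e / 2 * (G N)%:R * 2 ^+ s < 6 * (G N)%:R.
  by apply: lt_le_trans H; rewrite ltr_pM2r// exprn_gt0.
rewrite mulrAC ltr_pM2r// ltNge => /negP; apply.
by rewrite mulrAC ler_pdivlMr// -natrM ltW.
Qed.

End Content.

(** * Extension to a measure *)

Section LimitInvariance.
Variables (R : realType) (F : finFieldType) (I : set int).
Local Notation flag := (flag F I).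

(** The threshold s depends on e alone, so the flags picked in the successive A n have
    a limit flag by compactness. Each A n is decided by finitely many levels, hence
    contains that limit. This is continuity at the empty set. *)
Lemma limit_freq_decreasing (e : R) (A : nat -> set flag) : 0 < e ->
  (forall n, level_event (A n)) -> (forall m n, (m <= n)%N -> A n `<=` A m) ->
  (forall n, e <= limit_freq R (A n)) -> exists L, forall n, A n L.
Proof.
move=> e0 aA dA eA.
have [s se] : exists s, 12 < e * 2 ^+ s.
  have [s sP] : exists s : nat, 12 / e < s%:R.
    by exists (Num.bound (12 / e)); apply: le_lt_trans (archi_boundP _);
      rewrite ?ler_norm ?divr_ge0// ltW.
  exists s; rewrite mulrC -ltr_pdivrMr//; apply: lt_trans sP _.
  by rewrite -natrX ltr_nat ltn_expl.
have /choice[L LP] : forall k, exists L, A k L /\ forall j : I, (`|val j| <= k)%N ->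
    transverse (`|val j| + `|val j| + s) (val L j).
  by move=> k; have [L AL gL] := limit_freq_pick k e0 (eA k) se; exists L.
have [L0 L0P] := @flag_compactness F I (fun j => `|j| + `|j| + s)%N L (fun k => (LP k).2).
exists L0 => n; have [m Am] := aA n.
have [k nk sk] := Ult_ex n (L0P m).
apply: (Am (L k)); last exact: dA nk _ (LP k).1.
by move=> j jm; rewrite sk.
Qed.

(** The event depends on finitely many levels, on which g acts as a finitary
    operator. *)
Lemma limit_freq_GL0 (g : {linear E F -> E F}) (A : set flag) : GL0 g -> level_event A ->
  limit_freq R (pullback g A) = limit_freq R A.
Proof.
move=> g0 [m Am]; have [N [h [hu H]]] := GL0_approx m g0.
rewrite -(limit_freq_finitary R A hu); congr (limit_freq R _).
have s L : same_levels m (flag_act g L) (flag_act (finitary h) L).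
  move=> j jm; apply: (etrans (congr1 (lev m) (flag_actE L j (fun j M => GL0_Gr g0)))).
  apply: (etrans _ (esym (congr1 (lev m) (flag_act_finitary L j hu)))).
  by apply: approx_lev => //; exact: flag_subspace.
by apply/seteqP; split => L; apply: Am => // j jm; apply/esym/s.
Qed.

End LimitInvariance.

(** A copy of the type of flags that carries the algebra of level events instead of
    the sigma-algebra, as the starting point of the extension theorem. *)
Definition event_flag (F : finFieldType) (I : set int) : Type := flag F I.
HB.instance Definition _ F I := Pointed.on (event_flag F I).
HB.instance Definition _ F I := @isAlgebraOfSets.Build default_measure_display (event_flag F I)
  (@level_event F I) (@level_event0 F I) (@level_eventU F I) (@level_eventC F I).

Section Extension.
Variables (R : realType) (F : finFieldType) (I : set int).
Local Notation aflag := (event_flag F I).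

Definition freq_content (A : set aflag) : \bar R := (limit_freq R (A : set (flag F I)))%:E.

Let freq_content_ge0 A : (0 <= freq_content A)%E.
Proof. by rewrite lee_fin limit_freq_ge0. Qed.

Let freq_content_additive : measure_function.semi_additive freq_content.
Proof.
apply/additive2P; first by rewrite /freq_content limit_freq0.
by move=> A B _ _ AB; rewrite /freq_content limit_freqU// EFinD.
Qed.

HB.instance Definition _ := isContent.Build default_measure_display aflag R freq_content
  freq_content_ge0 freq_content_additive.

Lemma limit_freq_bigcup (B : nat -> set (flag F I)) n :
  limit_freq R (\big[setU/set0]_(k < n) B k) <= \sum_(k < n) limit_freq R (B k).
Proof.
elim: n => [|n IH]; first by rewrite !big_ord0 limit_freq0.
by rewrite !big_ord_recr/=; apply: le_trans (limit_freq_leU _ _ _) _; rewrite lerD2r.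
Qed.

(** If the B k had total frequency less than that of A, what remains of A after
    removing finitely many of them would keep a frequency bounded below, and
    [limit_freq_decreasing] would produce a flag of A outside all of them. *)
Lemma freq_content_sigma_subadditive : measurable_subset_sigma_subadditive freq_content.
Proof.
move=> A B mB mA AB; rewrite /subset_sigma_subadditive leNgt; apply/negP => lt.
have S0 n : (\sum_(k < n) freq_content (B k) <= \sum_(k <oo) freq_content (B k))%E.
  by rewrite -(big_mkord xpredT (fun k => freq_content (B k)));
    apply: nneseries_lim_ge => k _ _.
have [r rE] : exists r : R, (\sum_(k <oo) freq_content (B k))%E = r%:E.
  move: lt (S0 0%N); rewrite big_ord0; case: (\sum_(k <oo) _)%E => [r _ _|lt _|_].
  - by exists r.
  - by move: lt; rewrite ltNge leey.
  - by rewrite leeNy_eq.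
have e0 : 0 < limit_freq R A - r by move: lt; rewrite rE lte_fin subr_gt0.
pose C n : set (flag F I) := A `\` \big[setU/set0]_(k < n) B k.
have aU n : level_event (\big[setU/set0]_(k < n) B k).
  by apply: (big_ind (@level_event F I)); [exact: level_event0|exact: level_eventU|move=> k
    _; exact: mB].
have [L LP] : exists L, forall n, C n L.
  apply: (limit_freq_decreasing e0) => [n|m n mn L [AL nL]|n].
  - by rewrite /C setDE; apply: level_eventI => //; exact: level_eventC.
  - split => // mL; apply: nL; move: mL; rewrite -!bigcup_mkord => -[k /= km Bk].
    by exists k => //=; exact: leq_trans km mn.
  - have : limit_freq R A <= limit_freq R (C n) + limit_freq R (\big[setU/set0]_(k < n) B k).
      apply: le_trans (limit_freq_leU _ _ _); apply: limit_freq_le => x Ax.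
      by have [|] := pselect ((\big[setU/set0]_(k < n) B k) x); [right|left].
    have : limit_freq R (\big[setU/set0]_(k < n) B k) <= r.
      apply: le_trans (limit_freq_bigcup _ _) _.
      by have := S0 n; rewrite rE /freq_content sumEFin lee_fin.
    by move=> h1 h2; rewrite lerBlDr; apply: le_trans h2 _; rewrite lerD2l.
have [AL _] := LP 0%N; have [k _ Bk] := AB _ AL.
have [_] := LP k.+1; apply; rewrite -bigcup_mkord; by exists k => /=.
Qed.

HB.instance Definition _ := Content_SigmaSubAdditive_isMeasure.Build
  default_measure_display R aflag
  freq_content freq_content_sigma_subadditive.

Definition flag_prob (A : set (flag_space F I)) : \bar R := measure_extension freq_content A.

Lemma flag_prob_level_event A : @level_event F I A -> flag_prob A = (limit_freq R A)%:E.
Proof. by move=> aA; rewrite /flag_prob /measure_extension /= measurable_mu_extE. Qed.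

Let flag_prob0 : flag_prob set0 = 0%E.
Proof. exact: measure0. Qed.
Let flag_prob_ge0 A : (0 <= flag_prob A)%E.
Proof. exact: measure_ge0. Qed.
Let flag_prob_additive : semi_sigma_additive flag_prob.
Proof.
move=> B mB tB mUB; apply: (@measure_semi_sigma_additive _ _ _ (measure_extension
  freq_content)) => //.
- by move=> k; exact/flag_measurableE.
- exact/flag_measurableE.
Qed.
HB.instance Definition _ := isMeasure.Build _ (flag_space F I) R flag_prob
  flag_prob0 flag_prob_ge0 flag_prob_additive.

Let flag_probT : flag_prob setT = 1%E.
Proof. by rewrite flag_prob_level_event ?limit_freqT//; exact: level_eventT. Qed.
HB.instance Definition _ := Measure_isProbability.Build _ (flag_space F I) R flag_prob
  flag_probT.

Lemma flag_act_measurable (g f : {linear E F -> E F}) : linear_homeo g f ->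
  (forall (j : int) M, Gr j M -> Gr j (g @` M)) ->
  measurable_fun setT (flag_act g : flag_space F I -> flag_space F I).
Proof.
move=> gf gG; apply: (@measurability _ _ (flag_space F I) (flag_space F I) _ _
  (@level_event F I)).
  by apply/seteqP; split => A /flag_measurableE.
move=> _ [A aA <-]; rewrite setTI; apply: level_event_measurable.
exact: (pullback_level_event gf gG aA).
Qed.

(** The image of the measure under g is a measure with the same values on level
    events, hence the same measure. *)
Lemma flag_prob_invariant : GL0_invariant (flag_prob : probability (flag_space F I) R).
Proof.
move=> g g0 A mA; have [f gf] := GL_inverse g0.1.
have gG (j : int) M : Gr j M -> Gr j (g @` M) := GL0_Gr g0.
have fG (j : int) M : Gr j M -> Gr j (f @` M) := GL0_Gr_inverse g0 gf.
rewrite (translate_pullback A gf gG fG).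
have mB : measurable (pullback f A : set (flag_space F I)).
  by rewrite -[pullback f A]setTI; apply: (flag_act_measurable (linear_homeo_sym gf) fG).
have mg := flag_act_measurable gf gG.
have AE : A = pullback g (pullback f A).
  by apply/seteqP; split => L; rewrite /pullback /= (flag_actK L gf gG fG).
rewrite [in RHS]AE.
pose ag : {mfun flag_space F I >-> flag_space F I} :=
  HB.pack (flag_act g : flag_space F I -> flag_space F I)
    (isMeasurableFun.Build _ _ (flag_space F I) (flag_space F I) (flag_act g) mg).
apply/esym; apply: (@level_event_measure_unique R F I (pushforward flag_prob ag) flag_prob)
  => // [|B aB].
  by rewrite [X in (X < _)%E](_ : _ = 1%E) ?ltry//; exact: flag_probT.
rewrite [LHS](_ : _ = flag_prob (pullback g B))// (flag_prob_level_event
  (pullback_level_event gf gG aB)).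
rewrite limit_freq_GL0//; exact/esym/flag_prob_level_event.
Qed.

End Extension.

Theorem proposition1p6 (R : realType) (F : finFieldType) (I : set int)
    (hI : is_segment I) :
  exists P : probability (flag_space F I) R,
    GL0_invariant P /\
    forall Q : probability (flag_space F I) R, GL0_invariant Q ->
      forall A : set (flag_space F I), measurable A -> Q A = P A.
Proof.
have cI (i j k : int) : I i -> I k -> i <= j <= k -> I j.
  move=> Ii Ik /andP[ij jk]; case: hI => [[a [b [_ IE]]]|[a IE]|[b IE]|IE];
    rewrite IE in Ii Ik *.
  - move: Ii Ik; rewrite /= !in_itv/= => /andP[ai _] /andP[_ kb].
    by rewrite (le_trans ai ij) (le_trans jk kb).
  - by move: Ii; rewrite /= !in_itv/= !andbT => ai; exact: le_trans ai ij.
  - by move: Ik; rewrite /= !in_itv/= => kb; exact: le_trans jk kb.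
  - by [].
exists (@flag_prob R F I : probability (flag_space F I) R); split;
  first exact: flag_prob_invariant.
move=> Q invQ A mA; apply: level_event_measure_unique mA => [|B aB].
  by rewrite [X in (X < _)%E](_ : _ = 1%E) ?ltry//; exact: (@probability_setT _ _ _ Q).
exact: (invariant_level_event_unique cI invQ (@flag_prob_invariant R F I) aB).
Qed.
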